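(* Let $f$ be a quasi-homogeneous polynomial on $\mathbb{K}^2$ of degree $d$ with respect to the weights $(\omega_1,\omega_2)$, whose germ at $0$ is of finite codimension, and let $\Pi_0=f\,\frac{\partial}{\partial x}\wedge\frac{\partial}{\partial y}$. Let $\{e_1,\dots,e_r\}$ be a basis of the vector space of quasi-homogeneous polynomials of degree $d-\omega_1-\omega_2$ (with $0$ included). Then the family $\{[H_f]_{\Pi_0},[e_1W]_{\Pi_0},\dots,[e_rW]_{\Pi_0}\}$ is a basis of $H^1(\Pi_0)$. In particular, $H^1(\Pi_0)$ is a finite-dimensional vector space of dimension $r+1$.
   Context: $\mathbb{K}=\mathbb{R}$ or $\mathbb{C}$. $\mathcal{F}(\mathbb{K}^2)$, $\mathcal{X}(\mathbb{K}^2)$, $\mathcal{V}(\mathbb{K}^2)$ are the spaces of germs at $(0,0)$ of functions, vector fields and 2-vectors (bivector fields) on $\mathbb{K}^2$, in one fixed category: holomorphic if $\mathbb{K}=\mathbb{C}$; real analytic or $C^\infty$ if $\mathbb{K}=\mathbb{R}$. Fix positive integers $\omega_1,\omega_2$ and put $W=\omega_1x\frac{\partial}{\partial x}+\omega_2y\frac{\partial}{\partial y}$. A polynomial $g$ is quasi-homogeneous of degree $k\in\mathbb{Z}$ if $W.g=kg$ ($0$ is included when forming the vector space of such polynomials, which is $\{0\}$, so $r=0$, if $k$ is not the quasi-degree of any monomial). $X.g$ is the derivative of $g$ along $X$. For $g\in\mathcal{F}(\mathbb{K}^2)$, $H_g=\frac{\partial g}{\partial y}\frac{\partial}{\partial x}-\frac{\partial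 g}{\partial x}\frac{\partial}{\partial y}$. For $X=A\frac{\partial}{\partial x}+B\frac{\partial}{\partial y}$, $\operatorname{div}X=\frac{\partial A}{\partial x}+\frac{\partial B}{\partial y}$. The germ $f$ is of finite codimension if $\mathcal{F}(\mathbb{K}^2)/I_f$ is finite-dimensional over $\mathbb{K}$, where $I_f$ is the ideal of $\mathcal{F}(\mathbb{K}^2)$ generated by $\frac{\partial f}{\partial x},\frac{\partial f}{\partial y}$. For a germ $\Pi=F\frac{\partial}{\partial x}\wedge\frac{\partial}{\partial y}$ of Poisson structure, the (germified) Poisson complex is $0\to\mathcal{F}(\mathbb{K}^2)\xrightarrow{\delta_1}\mathcal{X}(\mathbb{K}^2)\xrightarrow{\delta_2}\mathcal{V}(\mathbb{K}^2)\to0$ with $\delta_1(g)=[g,\Pi]=F\,H_g$ and $\delta_2(X)=[X,\Pi]=(X.F-(\operatorname{div}X)F)\frac{\partial}{\partial x}\wedge\frac{\partial}{\partial y}$. $Z^1(\Pi)=\ker\delta_2$, $B^1(\Pi)=\operatorname{Im}\delta_1$, $H^1(\Pi)=Z^1(\Pi)/B^1(\Pi)$. $[X]_{\Pi_0}$ is the class of $X\in Z^1(\Pi_0)$ modulo $B^1(\Pi_0)$. *)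

(* Defs.v *)
From HB Require Import structures.
From mathcomp Require Import all_boot all_order all_algebra.
From mathcomp Require Import polyXY.
From mathcomp Require Import complex.
From mathcomp Require Import all_classical all_reals all_analysis.

Set Implicit Arguments.
Unset Strict Implicit.
Unset Printing Implicit Defensive.

Import Order.TTheory GRing.Theory Num.Theory.
Import numFieldNormedType.Exports.

Local Open Scope classical_set_scope.
Local Open Scope ring_scope.

(* Bases and dimension of a quotient Z / B of subspaces of V; the classes are
   given by representatives in Z. *)
Section QuotientBasis.
Variables (K : fieldType) (V : lmodType K).

Definition is_quot_basis (Z B : set V) (I : finType) (u : I -> V) : Prop :=
  [/\ forall i, Z (u i),
      forall c : I -> K, B (\sum_i c i *: u i) -> forall i, c i = 0
    & forall v, Z v -> exists c : I -> K, B (v - \sum_i c i *: u i)].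

Definition quot_dim (Z B : set V) (n : nat) : Prop :=
  exists u : 'I_n -> V, is_quot_basis Z B u.

Definition quot_findim (Z B : set V) : Prop := exists n, quot_dim Z B n.

Definition is_basis (Z : set V) (I : finType) (u : I -> V) : Prop :=
  is_quot_basis Z [set 0] u.

End QuotientBasis.

(* Scalar fields, functions on the plane and vector fields.  Germs at the
   origin are represented by total functions, and equality of germs is
   equality near 0. *)
Notation scalar K := (K * K -> K)%type (only parsing).
Notation vfield K := ((K * K -> K) * (K * K -> K))%type (only parsing).

Section Calculus.
Variable K : numFieldType.
Implicit Types (f g F : scalar K) (X Y : vfield K) (O : set (scalar K)).

Definition germ_eq f g : Prop := \forall z \near (0 : K * K), f z = g z.

Definition dx f : scalar K := fun z => 'D_((1, 0) : K * K) f z.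
Definition dy f : scalar K := fun z => 'D_((0, 1) : K * K) f z.

Definition lie X g : scalar K := fun z => X.1 z * dx g z + X.2 z * dy g z.

Definition divergence X : scalar K := fun z => dx X.1 z + dy X.2 z.

Definition fmul f X : vfield K :=
  (fun z => f z * X.1 z, fun z => f z * X.2 z).

Definition hamiltonian g : vfield K := (dy g, fun z => - dx g z).

Definition euler (w1 w2 : nat) : vfield K :=
  (fun z => w1%:R * z.1, fun z => w2%:R * z.2).

(* K is infinite, so that polynomials are identified with the polynomial
   functions they define. *)
Definition polynomial_fun g : Prop :=
  exists p : {poly {poly K}}, forall z, g z = p.[z.1, z.2].

Definition quasi_homogeneous (w1 w2 : nat) (k : int) : set (scalar K) :=
  [set g | polynomial_fun g /\ forall z, lie (euler w1 w2) g z = k%:~R * g z].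

(* The germ at 0 is the sum of an absolutely convergent power series. *)
Definition analytic_germ : set (scalar K) :=
  [set f | exists a : nat -> nat -> K, \forall z \near (0 : K * K),
     cvgn (fun n : nat =>
       \sum_(i < n) \sum_(j < n) `|a i j * z.1 ^+ i * z.2 ^+ j|) /\
     (fun n : nat =>
       \sum_(i < n) \sum_(j < n) a i j * z.1 ^+ i * z.2 ^+ j) @ \oo --> f z].

Definition iter_partial (s : seq bool) f : scalar K :=
  foldr (fun b g => if b then dx g else dy g) f s.

(* All partial derivatives of all orders exist and are continuous on one
   neighbourhood of 0, independent of the order. *)
Definition smooth_germ : set (scalar K) :=
  [set f | \forall z \near (0 : K * K), forall s : seq bool,
     [/\ {for z, continuous (iter_partial s f)},
         derivable (iter_partial s f) z ((1, 0) : K * K)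
       & derivable (iter_partial s f) z ((0, 1) : K * K)]].

(* In what follows, O stands for the germs of functions of the category. *)

Definition jacobian_ideal O f : set (scalar K) :=
  [set h | O h /\ exists a b, [/\ O a, O b &
     germ_eq h (fun z => a z * dx f z + b z * dy f z)]].

Definition finite_codimension O f : Prop :=
  quot_findim O (jacobian_ideal O f).

(* The Poisson complex of F d/dx /\ d/dy; bivector fields are given by their
   coefficient on d/dx /\ d/dy. *)
Definition delta1 F g : vfield K := fmul F (hamiltonian g).

Definition delta2 F X : scalar K :=
  fun z => lie X F z - divergence X z * F z.

Definition vfield_germ O : set (vfield K) := [set X | O X.1 /\ O X.2].

Definition Z1 O F : set (vfield K) :=
  [set X | vfield_germ O X /\ germ_eq (delta2 F X) (fun=> 0)].

Definition B1 O F : set (vfield K) :=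
  [set X | vfield_germ O X /\ exists g, [/\ O g,
     germ_eq X.1 (delta1 F g).1 & germ_eq X.2 (delta1 F g).2]].

Definition is_H1_basis O F (I : finType) (u : I -> vfield K) : Prop :=
  is_quot_basis (Z1 O F) (B1 O F) u.

Definition H1_dim O F (n : nat) : Prop := quot_dim (Z1 O F) (B1 O F) n.

End Calculus.

Inductive category := Holomorphic | RealAnalytic | Smooth.

Definition base_field (R : realType) (c : category) : numFieldType :=
  if c is Holomorphic then (R[i] : numFieldType) else (R : numFieldType).

(* A function of two complex variables is holomorphic at a point when it is
   the sum of a convergent power series near that point. *)
Definition germs (R : realType) (c : category) :
    set (scalar (base_field R c)) :=
  if c is Smooth then @smooth_germ (base_field R c)
  else @analytic_germ (base_field R c).
Arguments germs : clear implicits.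

(* The family H_f, e_1 W, ..., e_r W, with H_f at index None. *)
Definition H1_family (K : numFieldType) (w1 w2 : nat) (f : scalar K)
    (r : nat) (e : 'I_r -> scalar K) (i : option 'I_r) : vfield K :=
  if i is Some j then fmul (e j) (euler K w1 w2) else hamiltonian f.

(* Main.v *)
Require Import Defs.
From HB Require Import structures.
From mathcomp Require Import all_boot all_order all_algebra.
From mathcomp Require Import complex.
From mathcomp Require Import polyXY ring lra zify.
From mathcomp Require Import all_classical all_reals all_analysis.

Set Implicit Arguments.
Unset Strict Implicit.
Unset Printing Implicit Defensive.

Import Order.TTheory GRing.Theory Num.Theory.
Import numFieldNormedType.Exports.

Local Open Scope classical_set_scope.
Local Open Scope ring_scope.

(** Write p = f_x, q = f_y, W = w1 x d/dx + w2 y d/dy and k = d - w1 - w2.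
    Finite codimension makes monomials in x alone or y alone linearly dependent
    modulo the ideal (p, q); as that ideal is stable under W, it contains a
    power of x and a power of y, so that the syzygies of (p, q) are the
    multiples of (q, -p).  If X = (a, b) is a cocycle and h = div X / d, then
    X - h W kills f because W f = d f, whence X = h W + al H_f.  Solving
    W g = d (al - al(0)) and subtracting the coboundary f H_g leaves
    al(0) H_f + h' W with W h' = k h', and an eigenfunction of W is the germ of
    a quasi-homogeneous polynomial.  Conversely c H_f + e W = f H_g forces
    e = H_g f / d and c = W g / d, hence c = 0 at the origin, then g is constant
    and e = 0.

    The two equations to be solved, the division of g by x when g(0, y) = 0 and
    W g = al - al(0), both follow from the operators
    phi |-> int_0^1 t^(k-1) phi(t^a x, t^b y) dt, which divide the (i, j)
    coefficient of a power series by a i + b j + k. *)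

(** Both halves rest on one identity, a consequence of [W f = d f]: d f H_g = (W g) H_f + (H_g f) W.
    It expands coboundaries in the pair (H_f, W), so that the normal form and its uniqueness become
    comparisons of coefficients. The eigenvalue of h' is forced: al(0) H_f + h' W is a cocycle of
    divergence W h' + (w1 + w2) h', and applying it to f shows that this divergence is d h'. The
    term al(0) H_f cannot be removed because every W g vanishes at the origin. Division by d is
    legitimate: d = 0 would make f constant near 0 and the Jacobian ideal zero. The obstacle is to
    treat three categories at once. Smooth germs have zero divisors and flat functions, so neither
    integrality nor comparison of coefficients is at hand. Cancellation is therefore done only by
    nonzero polynomials, whose nonzero set is dense, and eigenfunctions of W are shown to be
    polynomial by descending through their partial derivatives. *)

Local Notation scalar K := (K * K -> K)%type (only parsing).

(** * Polynomial functions *)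

Section PolynomialFunctions.
Variable K : numFieldType.
Implicit Types (f g u : scalar K) (z v : K * K).

(** Derivatives at a point need agreement on a whole neighbourhood of that point, which germ
    equality provides at every point close to 0. *)
Lemma near_germ_eq f g :
  germ_eq f g -> \forall z \near (0 : K * K), \forall w \near z, f w = g w.
Proof. exact: near_join. Qed.

Lemma germ_eq_derive v f g :
  germ_eq f g -> germ_eq (fun z => 'D_v f z) (fun z => 'D_v g z).
Proof.
move=> /near_germ_eq fg; near=> z.
by apply: near_eq_derive; near: z.
Unshelve. all: by end_near. Qed.

Lemma is_derive_fst v z : is_derive z v (fst : K * K -> K) v.1.
Proof.
have c : continuous (fst : K * K -> K) by move=> ?; exact: cvg_fst.
have d : differentiable (fst : K * K -> K) z by exact: linear_differentiable.
apply: DeriveDef; first exact: diff_derivable.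
by rewrite deriveE// diff_lin.
Qed.

Lemma is_derive_snd v z : is_derive z v (snd : K * K -> K) v.2.
Proof.
have c : continuous (snd : K * K -> K) by move=> ?; exact: cvg_snd.
have d : differentiable (snd : K * K -> K) z by exact: linear_differentiable.
apply: DeriveDef; first exact: diff_derivable.
by rewrite deriveE// diff_lin.
Qed.

Lemma polynomial_fun_cst (c : K) : polynomial_fun (fun _ : K * K => c).
Proof. by exists c%:P%:P => z; rewrite !hornerE. Qed.

Lemma polynomial_fun_fst : polynomial_fun (fst : K * K -> K).
Proof. by exists 'X => z; rewrite !hornerE. Qed.

Lemma polynomial_fun_snd : polynomial_fun (snd : K * K -> K).
Proof. by exists 'X%:P => z; rewrite !hornerE. Qed.

Lemma polynomial_fun_add f g : polynomial_fun f -> polynomial_fun g ->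
  polynomial_fun (fun z => f z + g z).
Proof. by move=> [p fp] [q gq]; exists (p + q) => z; rewrite !hornerE fp gq.
  Qed.

Lemma polynomial_fun_mul f g : polynomial_fun f -> polynomial_fun g ->
  polynomial_fun (fun z => f z * g z).
Proof. by move=> [p fp] [q gq]; exists (p * q) => z; rewrite !hornerE fp gq.
  Qed.

Lemma polynomial_fun_ind (P : set (scalar K)) :
  (forall c, P (fun=> c)) -> P fst -> P snd ->
  (forall f g, P f -> P g -> P (fun z => f z + g z)) ->
  (forall f g, P f -> P g -> P (fun z => f z * g z)) ->
  forall f, polynomial_fun f -> P f.
Proof.
move=> Pc P1 P2 PD PM f [p fp].
have -> : f = (fun z => p.[z.1, z.2]) by apply/funext.
elim/poly_ind: p {f fp} => [|p q IHp].
  rewrite (_ : (fun _ => _) = (fun=> 0)); first exact: Pc.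
  by apply/funext => z; rewrite !hornerE.
rewrite (_ : (fun _ => _) =
  (fun z => (fun z => p.[z.1, z.2] * z.1) z + (fun z => q.[z.2]) z));
    last first.
  by apply/funext => z; rewrite !hornerE.
apply/PD; first exact/PM.
elim/poly_ind: q => [|q c IHq].
  rewrite (_ : (fun _ => _) = (fun=> 0)); first exact: Pc.
  by apply/funext => z; rewrite !hornerE.
rewrite (_ : (fun _ => _) =
  (fun z => (fun z => q.[z.2] * z.2) z + (fun=> c) z)); last first.
  by apply/funext => z; rewrite !hornerE.
by apply/PD => //; apply/PM.
Qed.

Lemma polynomial_fun_derive f v : polynomial_fun f ->
  (forall z, derivable f z v) /\ polynomial_fun (fun z => 'D_v f z).
Proof.
move=> pf.
(* The induction must also carry [polynomial_fun f], since the product rule reuses the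
   undifferentiated factors. *)
suff [? []//] : (forall z, derivable f z v) /\
    polynomial_fun (fun z => 'D_v f z) /\ polynomial_fun f.
move: f pf; apply: polynomial_fun_ind => [c|||f g|f g].
- split=> [z|]; first exact: derivable_cst.
  split; last exact: polynomial_fun_cst.
  by under eq_fun do rewrite derive_cst; exact: polynomial_fun_cst.
- have d z := is_derive_fst v z.
  split=> [z|]; first exact: ex_derive.
  split; last exact: polynomial_fun_fst.
  by under eq_fun do rewrite derive_val; exact: polynomial_fun_cst.
- have d z := is_derive_snd v z.
  split=> [z|]; first exact: ex_derive.
  split; last exact: polynomial_fun_snd.
  by under eq_fun do rewrite derive_val; exact: polynomial_fun_cst.
- move=> [df [pdf pf]] [dg [pdg pg]].
  split=> [z|]; first exact: derivableD.
  split; last exact: polynomial_fun_add.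
  rewrite (_ : (fun z => _) = (fun z => 'D_v f z + 'D_v g z)).
    exact: polynomial_fun_add.
  by apply/funext => z; rewrite -deriveD.
- move=> [df [pdf pf]] [dg [pdg pg]].
  split=> [z|]; first exact: derivableM.
  split; last exact: polynomial_fun_mul.
  rewrite (_ : (fun z => _) = (fun z => f z * 'D_v g z + g z * 'D_v f z)).
    by apply: polynomial_fun_add; exact: polynomial_fun_mul.
  by apply/funext => z; rewrite -deriveM.
Qed.

(* The restriction of g to the line through z and a point where g does not
   vanish is a nonzero polynomial in one variable, hence has finitely many
   zeros. *)
Lemma polynomial_fun_dense g z w : polynomial_fun g -> g w != 0 ->
  forall A, nbhs z A -> exists2 z', A z' & g z' != 0.
Proof.
move=> pg gw0 A zA.
have [r gr] : exists r : {poly K}, forall t, g (t *: (w - z) + z) = r.[t].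
  move: {gw0} g pg; apply: polynomial_fun_ind =>
    [c|||f g [p fp] [q gq]|f g [p fp] [q gq]].
  - by exists c%:P => t; rewrite hornerC.
  - by exists ((w.1 - z.1) *: 'X + z.1%:P) => t; rewrite !hornerE/= mulrC.
  - by exists ((w.2 - z.2) *: 'X + z.2%:P) => t; rewrite !hornerE/= mulrC.
  - by exists (p + q) => t; rewrite fp gq hornerD.
  - by exists (p * q) => t; rewrite fp gq hornerM.
have r0 : r != 0.
  apply: contraNneq gw0 => r0.
  by have := gr 1; rewrite r0 horner0 scale1r subrK => ->.
have [t0 | ] := pselect (exists2 t, A (t *: (w - z) + z) & r.[t] != 0).
  by have [t At rt] := t0; exists (t *: (w - z) + z) => //; rewrite gr.
move=> /forall2NP rz.
move/nbhs_normP: zA => [_/posnumP[e'] e'A].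
pose e := e'%:num / (`|w - z| + 1).
have wz0 : 0 < `|w - z| + 1 by rewrite ltr_wpDl.
have e0 : 0 < e by rewrite divr_gt0.
have eA t : `|t| < e -> A (t *: (w - z) + z).
  rewrite ltr_pdivlMr// => te; apply: e'A.
  rewrite /ball_/= opprD addrCA subrr addr0 normrN normrZ;
    apply: le_lt_trans te.
  by rewrite ler_wpM2l// lerDl.
(* These are [size r] distinct roots, one more than the degree of [r]. The shift [i.+2] makes each
   of them strictly smaller than [e]. *)
pose s := [seq e / (i.+2)%:R | i <- iota 0 (size r)].
have rs : all (root r) s.
  apply/allP => _ /mapP[i _ ->]; apply/rootP; apply/eqP.
  case: (rz (e / i.+2%:R)) => [nA|/negP]; last by rewrite negbK.
  exfalso; apply: nA; apply: eA.
  rewrite ger0_norm ?divr_ge0// ?ltW// ltr_pdivrMr ?ltr0n//.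
  by rewrite ltr_pMr// ltr1n.
suff us : uniq s.
  by have := max_poly_roots r0 rs us; rewrite size_map size_iota ltnn.
rewrite map_inj_uniq ?iota_uniq// => i j /(mulfI (lt0r_neq0 e0))/invr_inj/eqP.
by rewrite eqr_nat => /eqP[].
Qed.

(** If [u] were nonzero at a point near 0, it would be nonzero around it by continuity, and [g]
    would have to vanish on an open set. This replaces integrality, which fails for smooth germs. *)
Lemma polynomial_fun_cancel g u : polynomial_fun g -> (exists w, g w != 0) ->
  (\forall z \near (0 : K * K), {for z, continuous u}) ->
  (\forall z \near (0 : K * K), g z * u z = 0) ->
  \forall z \near (0 : K * K), u z = 0.
Proof.
move=> pg [w gw] cu /near_join gu; near=> z.
apply/eqP; apply: contrapT => /negP uz.
have cuz : {for z, continuous u} by near: z.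
have guz : \forall z' \near z, g z' * u z' = 0 by near: z.
have : \forall z' \near z, g z' * u z' = 0 /\ u z' != 0.
  apply: filterS2 guz _; first by move=> z'; exact: conj.
  exact: cvgr_neq0 cuz uz.
move=> /(polynomial_fun_dense pg gw)[z' [/eqP + uz'] gz'].
by rewrite mulf_eq0 (negPf gz') (negPf uz').
Unshelve. all: by end_near. Qed.

End PolynomialFunctions.

Lemma sum_option (V : zmodType) r (F : option 'I_r -> V) :
  \sum_i F i = F None + \sum_j F (Some j).
Proof.
rewrite (bigD1 None)//=; congr (_ + _).
by rewrite (reindex_omap Some id) => [|[]]//; apply: eq_bigl => j; rewrite eqxx.
Qed.

(** Passes from the index type [option 'I_r] of the family to the ordinal that counts the
    dimension. *)
Lemma quot_basis_card (K : fieldType) (V : lmodType K) (Z B : set V)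
  (I J : finType) (u : I -> V)
  (h : J -> I) : bijective h -> is_quot_basis Z B u ->
    is_quot_basis Z B (u \o h).
Proof.
move=> [h' hK h'K] [Zu indep span]; split=> [i|c Bc i|v /span[c Bc]].
- exact: Zu.
- rewrite -(hK i); apply: (indep (c \o h')); move: Bc; congr (B _).
  rewrite (reindex h)/=; last by exists h' => ? _.
  by apply: eq_bigr => j _; rewrite hK.
- exists (c \o h); move: Bc; congr (B (v - _)).
  by rewrite (reindex h)//=; exists h' => ? _.
Qed.

(** * Partial derivatives *)

Definition derivable_xy (K : numFieldType) (f : scalar K) (z : K * K) :=
  derivable f z (1, 0) /\ derivable f z (0, 1).

(** [dx] and [dy] are total, so their values say nothing about existence. Bundling values with
    derivability makes the rules below composable, which [derive_at] exploits. *)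
Definition has_partials (K : numFieldType) (f : scalar K) (z : K * K)
  (a b : K) :=
  [/\ derivable_xy f z, dx f z = a & dy f z = b].

Section DerivationRules.
Variable K : numFieldType.
Implicit Types (f g u : scalar K) (z : K * K) (a b c : K).

Lemma has_partials_at f z :
  derivable_xy f z -> has_partials f z (dx f z) (dy f z).
Proof. by []. Qed.

Lemma has_partials_cst c z : has_partials (fun=> c) z 0 0.
Proof.
by split; [split; exact: derivable_cst | exact: derive_cst..].
Qed.

Lemma has_partials_fst z : has_partials (fun z => z.1) z 1 0.
Proof.
have dx := is_derive_fst (1, 0) z; have dy := is_derive_fst (0, 1) z.
by split; [split; exact: ex_derive | exact: derive_val..].
Qed.

Lemma has_partials_snd z : has_partials (fun z => z.2) z 0 1.
Proof.
have dx := is_derive_snd (1, 0) z; have dy := is_derive_snd (0, 1) z.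
by split; [split; exact: ex_derive | exact: derive_val..].
Qed.

Lemma has_partialsD f g z a b a' b' :
  has_partials f z a b -> has_partials g z a' b' ->
  has_partials (fun z => f z + g z) z (a + a') (b + b').
Proof.
move=> [[fx fy] <- <-] [[gx gy] <- <-].
by split; [split; [exact (derivableD fx gx) | exact (derivableD fy gy)]
  | exact (deriveD fx gx) | exact (deriveD fy gy)].
Qed.

Lemma has_partialsB f g z a b a' b' :
  has_partials f z a b -> has_partials g z a' b' ->
  has_partials (fun z => f z - g z) z (a - a') (b - b').
Proof.
move=> [[fx fy] <- <-] [[gx gy] <- <-].
by split; [split; [exact (derivableB fx gx) | exact (derivableB fy gy)]
  | exact (deriveB fx gx) | exact (deriveB fy gy)].
Qed.

Lemma has_partialsN f z a b : has_partials f z a b ->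
  has_partials (fun z => - f z) z (- a) (- b).
Proof.
move=> [[fx fy] <- <-].
by split; [split; [exact (derivableN fx) | exact (derivableN fy)]
  | exact (deriveN fx) | exact (deriveN fy)].
Qed.

Lemma has_partialsM f g z a b a' b' :
  has_partials f z a b -> has_partials g z a' b' ->
  has_partials (fun z => f z * g z) z (f z * a' + g z * a) (f z * b' + g z * b).
Proof.
move=> [[fx fy] <- <-] [[gx gy] <- <-].
by split; [split; [exact (derivableM fx gx) | exact (derivableM fy gy)]
  | exact (deriveM fx gx) | exact (deriveM fy gy)].
Qed.

Lemma has_partialsX f n z a b : has_partials f z a b ->
  has_partials (fun z => f z ^+ n) z
    (n%:R * f z ^+ n.-1 * a) (n%:R * f z ^+ n.-1 * b).
Proof.
move=> df; elim: n => [|n IHn].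
  by rewrite !mul0r; exact: has_partials_cst.
under [fun _ => _]eq_fun do rewrite exprS.
(* At [n = 0] the truncated predecessor is harmless: its coefficient [n%:R] vanishes. *)
have E c : f z * (n%:R * f z ^+ n.-1 * c) + f z ^+ n * c = n.+1%:R * f z ^+
  n * c.
  by case: n {IHn} => [|n]; rewrite ?exprS -?natr1/=; ring.
by rewrite -!E; exact: has_partialsM.
Qed.

Lemma germ_eq_dx f g : germ_eq f g -> germ_eq (dx f) (dx g).
Proof. exact: germ_eq_derive. Qed.

Lemma germ_eq_dy f g : germ_eq f g -> germ_eq (dy f) (dy g).
Proof. exact: germ_eq_derive. Qed.

Lemma polynomial_fun_derivable_xy f z : polynomial_fun f -> derivable_xy f z.
Proof. by move=> pf; split; apply: (polynomial_fun_derive _ pf).1. Qed.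

Lemma polynomial_fun_dx f : polynomial_fun f -> polynomial_fun (dx f).
Proof. by move=> pf; exact: (polynomial_fun_derive _ pf).2. Qed.

Lemma polynomial_fun_dy f : polynomial_fun f -> polynomial_fun (dy f).
Proof. by move=> pf; exact: (polynomial_fun_derive _ pf).2. Qed.

Lemma germ_app (P Q : K * K -> Prop) : (\forall z \near (0 : K * K), P z) ->
  (\forall z \near (0 : K * K), P z -> Q z) ->
  \forall z \near (0 : K * K), Q z.
Proof. by move=> FP FPQ; exact: filter_app FPQ FP. Qed.

Lemma germ_forall (P : K * K -> Prop) :
  (forall z, P z) -> \forall z \near (0 : K * K), P z.
Proof. by move=> HP; apply: filterE. Qed.

End DerivationRules.

Ltac nearby A := refine (germ_app A _).

Ltac at_point z := refine (germ_forall _); intro z; cbv beta.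

(* The tactics below are directed by syntax: unifying two distinct expressions
   in an abstract field up to conversion can be very slow. *)
Ltac exact_derivable := lazymatch goal with
  | |- derivable_xy ?f ?z => match goal with
    | H : derivable_xy ?g z |- _ => constr_eq f g; exact H end end.

Ltac partials := lazymatch goal with
  | |- has_partials (fun _ => ?c) _ _ _ => exact (has_partials_cst c _)
  | |- has_partials (fun t => t.1) _ _ _ => exact (has_partials_fst _)
  | |- has_partials (fun t => t.2) _ _ _ => exact (has_partials_snd _)
  | |- has_partials (fun t => ?h t) ?z _ _ =>
      refine (@has_partials_at _ h z _); exact_derivable
  | |- has_partials (fun t => @?f t - @?g t) ?z _ _ =>
      refine (@has_partialsB _ f g z _ _ _ _ _ _); partials
  | |- has_partials (fun t => @?f t + @?g t) ?z _ _ =>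
      refine (@has_partialsD _ f g z _ _ _ _ _ _); partials
  | |- has_partials (fun t => - @?f t) ?z _ _ =>
      refine (@has_partialsN _ f z _ _ _); partials
  | |- has_partials (fun t => @?f t * @?g t) ?z _ _ =>
      refine (@has_partialsM _ f g z _ _ _ _ _ _); partials
  | |- has_partials (fun t => @?f t ^+ ?n) ?z _ _ =>
      refine (@has_partialsX _ f n z _ _ _); partials
  | |- has_partials ?h ?z _ _ =>
      refine (@has_partials_at _ h z _); exact_derivable
  end.

Ltac atomize_partials := repeat match goal with
  | |- context [dx ?f ?z] => generalize (dx f z); intro
  | |- context [dy ?f ?z] => generalize (dy f z); intro end.

Ltac ring_partials := atomize_partials; ring.

Ltac derive_at v z :=
  let H := fresh in let Hx := fresh in let Hy := fresh in
  eassert (H : has_partials v z _ _); [first [unfold v | match v with ?h _ _ =>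
    unfold h end | idtac]; rewrite ?/lie/=; partials |];
  destruct H as [_ Hx Hy]; cbv beta in Hx, Hy; try rewrite -> Hx; try rewrite ->
    Hy; clear Hx Hy.

(** * Poisson cohomology in an abstract category of germs *)

(* What the proof needs from a category of germs: [germ_solve] is
   psi(x, y) = int_0^1 t^(k-1) phi(t^a x, t^b y) dt, and [germ_euler] says that
   functions constant along the curves (t^a x, t^b y) are determined by their
   values at t = 0; weights may vanish (0 ^+ 0 = 1). *)
Record germ_class (K : numFieldType) (O : set (scalar K)) := GermClass {
  germ_ext : forall f g, O f -> germ_eq f g -> O g;
  germ_cst : forall c, O (fun=> c);
  germ_fst : O (fun z => z.1);
  germ_snd : O (fun z => z.2);
  germ_add : forall f g, O f -> O g -> O (fun z => f z + g z);
  germ_mul : forall f g, O f -> O g -> O (fun z => f z * g z);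
  germ_continuous : forall f, O f ->
    \forall z \near (0 : K * K), {for z, continuous f};
  germ_derivable : forall f, O f ->
    \forall z \near (0 : K * K), derivable_xy f z;
  germ_dx : forall f, O f -> O (dx f);
  germ_dy : forall f, O f -> O (dy f);
  germ_dxy : forall f, O f -> germ_eq (dx (dy f)) (dy (dx f));
  germ_solve : forall a b k phi, (0 < k)%N -> O phi -> exists2 psi, O psi &
    germ_eq (fun z => lie (euler K a b) psi z + k%:R * psi z) phi;
  germ_euler : forall a b u, O u -> germ_eq (lie (euler K a b) u) (fun=> 0) ->
    germ_eq u (fun z => u (0 ^+ a * z.1, 0 ^+ b * z.2)) }.

Section GermClass.
Variables (K : numFieldType) (O : set (scalar K)).
Hypothesis GO : germ_class O.
Implicit Types (f g u : scalar K) (z : K * K).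

Lemma germ_scale c f : O f -> O (fun z => c * f z).
Proof. by move=> Of; exact: (germ_mul GO (germ_cst GO c) Of). Qed.

Lemma germ_sub f g : O f -> O g -> O (fun z => f z - g z).
Proof.
move=> Of Og; under eq_fun do rewrite -mulN1r.
by apply: (germ_add GO Of); exact: germ_scale.
Qed.

Lemma germ_exp f n : O f -> O (fun z => f z ^+ n).
Proof.
move=> Of; elim: n => [|n IHn]; first exact: germ_cst.
by under eq_fun do rewrite exprS; exact: germ_mul.
Qed.

Lemma germ_polynomial f : polynomial_fun f -> O f.
Proof.
apply: polynomial_fun_ind.
- exact: germ_cst.
- exact: germ_fst.
- exact: germ_snd.
- exact: germ_add.
- exact: germ_mul.
Qed.

Lemma germ_opp f : O f -> O (fun z => - f z).
Proof. by move=> /(germ_scale (-1)); under eq_fun do rewrite mulN1r. Qed.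

Ltac germs := lazymatch goal with
  | |- _ (fun _ => ?c) => exact (germ_cst GO c)
  | |- _ (fun t => t.1) => exact (germ_fst GO)
  | |- _ (fun t => t.2) => exact (germ_snd GO)
  | |- ?P (fun t => ?h t) => change (P h); germs
  | |- _ (fun t => @?f t - @?g t) => refine (@germ_sub f g _ _); germs
  | |- _ (fun t => @?f t + @?g t) => refine (@germ_add _ _ GO f g _ _); germs
  | |- _ (fun t => - @?f t) => refine (@germ_opp f _); germs
  | |- _ (fun t => @?f t * @?g t) => refine (@germ_mul _ _ GO f g _ _); germs
  | |- _ (fun t => @?f t ^+ ?n) => refine (@germ_exp f n _); germs
  | |- ?P (dx ?f) => first [match goal with H : P (dx f) |- _ => exact H end
                          | refine (@germ_dx _ _ GO f _); germs]
  | |- ?P (dy ?f) => first [match goal with H : P (dy f) |- _ => exact H end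
                          | refine (@germ_dy _ _ GO f _); germs]
  | |- ?P ?f => first
      [match goal with H : P ?g |- _ => constr_eq f g; exact H end | assumption]
  end.

(** With weights (1, 0), the quotient is int_0^1 g_x(t x, y) dt. The operator x d/dx kills x h - g,
    which is thus equal to its value at (0, y): the zero weight fixes y because [0 ^+ 0 = 1]. *)
Lemma germ_hadamard g : O g -> (\forall z \near (0 : K * K), g (0, z.2) = 0) ->
  exists2 h, O h & germ_eq g (fun z => z.1 * h z).
Proof.
move=> Og g0.
have [h Oh hE] := germ_solve GO 1 0 (ltn0Sn 0) (germ_dx GO Og).
exists h => //; pose u z := z.1 * h z - g z.
have Ou : O u by rewrite /u; germs.
have : germ_eq (lie (euler K 1 0) u) (fun=> 0).
  nearby (germ_derivable GO Oh); nearby (germ_derivable GO Og); nearby hE.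
  at_point z; rewrite /lie/= => hEz dg dh.
  by derive_at u z; rewrite <- hEz; ring_partials.
move=> /(germ_euler GO Ou) uE; near=> z.
have : u z = u (0 ^+ 1 * z.1, 0 ^+ 0 * z.2) by near: z.
rewrite /u/= expr1 !mul0r expr0 mul1r sub0r (_ : g (0, z.2) = 0) ?oppr0//.
  by move/eqP; rewrite subr_eq0 => /eqP.
by near: z.
Unshelve. all: by end_near. Qed.

(** * The weighted Euler operator and its eigenfunctions *)

Section Weights.
Variables (w1 w2 : nat).
Hypotheses (w1_gt0 : (0 < w1)%N) (w2_gt0 : (0 < w2)%N).
Local Notation W := (lie (euler K w1 w2)).

Lemma euler_const u : O u -> germ_eq (W u) (fun=> 0) -> germ_eq u (fun=> u 0).
Proof.
move=> Ou /(germ_euler GO Ou); apply: filterS => z ->.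
by rewrite !expr0n !eqn0Ngt w1_gt0 w2_gt0 !mul0r.
Qed.

(* W (x^m u^w1) = 0 for m = -k, so x^m u^w1 is constant, hence 0. *)
Lemma euler_neg u (k : int) : k < 0 -> O u ->
  germ_eq (W u) (fun z => k%:~R * u z) -> germ_eq u (fun=> 0).
Proof.
case: k => // m _ Ou Wu.
(* Here k is [Negz m], that is -(m+1), so the two factors have opposite weights w1 (m+1) and -w1
   (m+1). *)
pose v z := z.1 ^+ m.+1 * u z ^+ w1.
have Ov : O v by rewrite /v; germs.
have : germ_eq (W v) (fun=> 0).
  nearby (germ_derivable GO Ou); nearby Wu; at_point z => Wuz du.
  rewrite /lie/=; derive_at v z.
  have -> : u z ^+ w1 = u z ^+ w1.-1 * u z by rewrite -exprSr prednK.
  transitivity (w1%:R * z.1 ^+ m.+1 * u z ^+ w1.-1 * (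
    W u z + m.+1%:R * u z)); first by rewrite /lie/= exprS; ring_partials.
  by rewrite Wuz NegzE mulrNz; ring.
move=> /(euler_const Ov) v0.
have uw0 : germ_eq (fun z => u z ^+ w1) (fun=> 0).
  apply: (polynomial_fun_cancel (g := fun z => z.1 ^+ m.+1)).
  - exists ('X ^+ m.+1) => z; rewrite !hornerE//.
  - by exists (1, 0); rewrite expr1n oner_neq0.
  - exact: (germ_continuous GO (germ_exp w1 Ou)).
  - by near=> z; transitivity (v 0);
      [near: z | rewrite /v/= expr0n/= mul0r].
near=> z; have /eqP : u z ^+ w1 = 0 by near: z.
by rewrite expf_eq0 => /andP[_ /eqP].
Unshelve. all: by end_near. Qed.

(** The commutator of W and d/dx is -w1 d/dx; the symmetry of second derivatives enters here. *)
Lemma euler_dx u v : O u -> germ_eq (W u) v ->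
  germ_eq (W (dx u)) (fun z => dx v z - w1%:R * dx u z).
Proof.
move=> Ou /germ_eq_dx Wu.
nearby (germ_derivable GO (germ_dx GO Ou)).
nearby (germ_derivable GO (germ_dy GO Ou)).
nearby (germ_dxy GO Ou); nearby Wu; at_point z => <- H duy dux.
by rewrite {1}/lie/=; derive_at (W u) z; rewrite -> H; ring_partials.
Qed.

Lemma euler_dy u v : O u -> germ_eq (W u) v ->
  germ_eq (W (dy u)) (fun z => dy v z - w2%:R * dy u z).
Proof.
move=> Ou /germ_eq_dy Wu.
nearby (germ_derivable GO (germ_dx GO Ou)).
nearby (germ_derivable GO (germ_dy GO Ou)).
nearby (germ_dxy GO Ou); nearby Wu; at_point z => <- H duy dux.
by rewrite {1}/lie/=; derive_at (W u) z; rewrite -> H; ring_partials.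
Qed.

(* al - al(0) = w1 x g1 + w2 y g2 where (W + w1) g1 = al_x and
   (W + w2) g2 = al_y, and W (x h) = x (W + w1) h. *)
Lemma euler_primitive al : O al ->
  exists2 g, O g & germ_eq (W g) (fun z => al z - al 0).
Proof.
move=> Oal.
have [g1 Og1 g1E] := germ_solve GO w1 w2 w1_gt0 (germ_dx GO Oal).
have [g2 Og2 g2E] := germ_solve GO w1 w2 w2_gt0 (germ_dy GO Oal).
(* A second inversion: [g1] and [g2] only recover al - al(0) itself, whereas w1 x h1 + w2 y h2 is a
   preimage of w1 x g1 + w2 y g2 under W. *)
have [h1 Oh1 h1E] := germ_solve GO w1 w2 w1_gt0 Og1.
have [h2 Oh2 h2E] := germ_solve GO w1 w2 w2_gt0 Og2.
pose v g h z : K := w1%:R * z.1 * g z + w2%:R * z.2 * h z - al z.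
have Ov g h : O g -> O h -> O (v g h) by move=> *; rewrite /v; germs.
have : germ_eq (W (v g1 g2)) (fun=> 0).
  nearby (germ_derivable GO Og1); nearby (germ_derivable GO Og2).
  nearby (germ_derivable GO Oal); nearby g1E; nearby g2E.
  at_point z; rewrite /lie/= => g2z g1z dal d2 d1.
  by derive_at (v g1 g2) z; rewrite <- g1z, <- g2z; ring_partials.
move=> /(euler_const (Ov _ _ Og1 Og2)) vE.
pose g z := w1%:R * z.1 * h1 z + w2%:R * z.2 * h2 z.
exists g; first by rewrite /g; germs.
nearby (germ_derivable GO Oh1); nearby (germ_derivable GO Oh2).
nearby h1E; nearby h2E; nearby vE.
at_point z; rewrite /lie/= => H h2z h1z d2 d1.
have -> : al z - al 0 = w1%:R * z.1 * g1 z + w2%:R * z.2 * g2 z.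
  have -> : al 0 = - v g1 g2 0 by rewrite /v/= !mulr0 !mul0r !add0r opprK.
  by rewrite -H /v; ring.
by derive_at g z; rewrite <- h1z, <- h2z; ring_partials.
Qed.

(** Strong induction on k: u_x and u_y are eigenfunctions for k - w1 and k - w2, hence polynomial
    (zero if that degree is negative), and k u = w1 x u_x + w2 y u_y gives u back when k > 0. No
    Taylor expansion is involved, so flat functions cause no trouble. *)
Lemma euler_eigen_polynomial (k : int) u : O u ->
  germ_eq (W u) (fun z => k%:~R * u z) ->
  exists2 e, polynomial_fun e & germ_eq u e.
Proof.
case: k => [n|n] Ou Wu; last first.
  by exists (fun=> 0); [exact: polynomial_fun_cst | exact: euler_neg Wu].
have [m nm] := ubnP n; elim: m n nm u Ou Wu => // m IHm [|n] nm u Ou Wu.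
  exists (fun=> u 0); first exact: polynomial_fun_cst.
  by apply: (euler_const Ou); apply: filterS Wu => z ->; rewrite mul0r.
have step w v : (0 < w)%N -> O v ->
    germ_eq (W v) (fun z => (n.+1%:R - w%:R) * v z) ->
    exists2 e, polynomial_fun e & germ_eq v e.
  move=> w_gt0 Ov Wv; have [wn|nw] := leqP w n.+1.
    apply: (IHm (n.+1 - w)%N) => //; first by lia.
    by apply: filterS Wv => z ->; rewrite -natrB.
  exists (fun=> 0); first exact: polynomial_fun_cst.
  apply: (@euler_neg _ (n.+1%:Z - w%:Z)) => //; first by lia.
  by apply: filterS Wv => z ->; rewrite rmorphB.
have [|p pp pE] := step w1 (dx u) w1_gt0 (germ_dx GO Ou).
  have := euler_dx Ou Wu; apply: filterS2 (germ_derivable GO Ou) => z du ->.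
  by derive_at (fun z => n.+1%:~R * u z) z; rewrite mulr0 addr0 mulrBl.
have [|q pq qE] := step w2 (dy u) w2_gt0 (germ_dy GO Ou).
  have := euler_dy Ou Wu; apply: filterS2 (germ_derivable GO Ou) => z du ->.
  by derive_at (fun z => n.+1%:~R * u z) z; rewrite mulr0 addr0 mulrBl.
exists (fun z => n.+1%:R^-1 * (w1%:R * z.1 * p z + w2%:R * z.2 * q z)).
  apply: polynomial_fun_mul; first exact: polynomial_fun_cst.
  by apply: polynomial_fun_add; apply: polynomial_fun_mul => //;
    apply: polynomial_fun_mul; by [exact: polynomial_fun_cst
    | exact: polynomial_fun_fst | exact: polynomial_fun_snd].
nearby pE; nearby qE; nearby Wu; at_point z => H <- <-.
by rewrite (_ : _ + _ = W u z)// H mulKf// pnatr_eq0.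
Qed.

(** * The Jacobian ideal and the syzygies of the gradient *)

Section FiniteCodimension.
Variables (d : int) (f : scalar K).
Hypotheses (f_qh : quasi_homogeneous w1 w2 d f) (f_codim : finite_codimension O
  f).
Local Notation I := (jacobian_ideal O f).
Local Notation p := (dx f).
Local Notation q := (dy f).

Let f_pol : polynomial_fun f. Proof. by case: f_qh. Qed.
Let Of : O f. Proof. exact: germ_polynomial. Qed.
Let p_pol : polynomial_fun p. Proof. exact: polynomial_fun_dx. Qed.
Let q_pol : polynomial_fun q. Proof. exact: polynomial_fun_dy. Qed.
Let Op : O p. Proof. exact: germ_dx. Qed.
Let Oq : O q. Proof. exact: germ_dy. Qed.
Let WfE : forall z, W f z = d%:~R * f z. Proof. by case: f_qh. Qed.

Lemma euler_dxf : germ_eq (W p) (fun z => (d%:~R - w1%:R) * p z).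
Proof.
have Wf : germ_eq (W f) (fun z => d%:~R * f z) by at_point z; exact: WfE.
nearby (euler_dx Of Wf); nearby (germ_derivable GO Of); at_point z => df ->.
by derive_at (fun z => d%:~R * f z) z; rewrite mulr0 addr0 mulrBl.
Qed.

Lemma euler_dyf : germ_eq (W q) (fun z => (d%:~R - w2%:R) * q z).
Proof.
have Wf : germ_eq (W f) (fun z => d%:~R * f z) by at_point z; exact: WfE.
nearby (euler_dy Of Wf); nearby (germ_derivable GO Of); at_point z => df ->.
by derive_at (fun z => d%:~R * f z) z; rewrite mulr0 addr0 mulrBl.
Qed.

Lemma ideal_lincomb g h (c e : K) : I g -> I h -> I (fun z =>
  c * g z + e * h z).
Proof.
move=> [Og [a [b [Oa Ob gE]]]] [Oh [a' [b' [Oa' Ob' hE]]]].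
split; first by germs.
exists (fun z => c * a z + e * a' z), (fun z => c * b z + e * b' z).
split; [by germs | by germs |].
by nearby gE; nearby hE; at_point z => -> ->; ring.
Qed.

Lemma ideal_sum n (g : 'I_n -> scalar K) (c : 'I_n ->
  K) : (forall i, I (g i)) ->
  I (fun z => \sum_i c i * g i z).
Proof.
elim: n g c => [|n IHn] g c Ig.
  under eq_fun do rewrite big_ord0.
  split; first exact: (germ_cst GO).
  exists (fun=> 0), (fun=> 0); split; [germs|germs|].
  by at_point z; rewrite !mul0r addr0.
under eq_fun do rewrite big_ord_recl.
have := ideal_lincomb (c ord0) 1 (Ig ord0) (IHn _ (fun i => c (lift ord0 i))
  (fun i => Ig (lift ord0 i))).
by under eq_fun do rewrite mul1r.
Qed.

(** Leibniz rule: the generators f_x and f_y are themselves eigenfunctions of W. *)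
Lemma ideal_euler g : I g -> I (W g).
Proof.
move=> [Og [a [b [Oa Ob gE]]]]; split; first by rewrite /lie/=; germs.
exists (fun z => W a z + (d%:~R - w1%:R) * a z), (fun z =>
  W b z + (d%:~R - w2%:R) * b z).
split; [by rewrite /lie/=; germs | by rewrite /lie/=; germs |].
nearby (germ_eq_dx gE); nearby (germ_eq_dy gE).
nearby euler_dxf; nearby euler_dyf.
nearby (germ_derivable GO Oa); nearby (germ_derivable GO Ob).
nearby (germ_derivable GO Op); nearby (germ_derivable GO Oq).
pose h z := a z * p z + b z * q z; rewrite -/h.
at_point z => dq dp db da Wq Wp gy gx.
transitivity (W h z); first by rewrite /lie gx gy.
transitivity (W a z * p z + a z * W p z + W b z * q z + b z * W q z).
  by rewrite /lie/=; derive_at h z; ring_partials.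
by rewrite Wq Wp; ring_partials.
Qed.

Lemma ideal_scaleV c g : c != 0 -> I (fun z => c * g z) -> I g.
Proof.
move=> c0 Icg; have := ideal_lincomb c^-1 0 Icg Icg.
by under eq_fun do rewrite mul0r addr0 mulKf//.
Qed.

(* (W - w s) P(l) has lower degree than P, of degree s; it vanishes only when
   P is a monomial. *)
Lemma ideal_power l (w : nat) (P : {poly K}) : (0 < w)%N -> O l ->
  germ_eq (W l) (fun z => w%:R * l z) ->
  P != 0 -> I (fun z => P.[l z]) -> exists m, I (fun z => l z ^+ m).
Proof.
move=> w_gt0 Ol Wl.
have OP (Q : {poly K}) : O (fun z => Q.[l z]).
  elim/poly_ind: Q => [|Q c IHQ].
    by under eq_fun do rewrite horner0; germs.
  by under eq_fun do rewrite !hornerE; germs.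
have WP (Q : {poly K}) :
    germ_eq (W (fun z => Q.[l z])) (fun z => w%:R * l z * Q^`().[l z]).
  elim/poly_ind: Q => [|Q c IHQ].
    have -> : (fun z => (0 : {poly K}).[l z]) = (fun=> 0).
      by apply/funext => z; rewrite horner0.
    at_point z; rewrite /lie/=; have [_ -> ->] := has_partials_cst (0 : K) z.
    by rewrite deriv0 horner0 !mulr0 addr0.
  pose g z := Q.[l z].
  nearby (germ_derivable GO Ol); nearby (germ_derivable GO (OP Q : O g)).
  nearby Wl; nearby IHQ; at_point z => WQz Wlz dQ dl.
  rewrite [X in W X](_ : _ = (fun z => g z * l z + c)); last first.
    by apply/funext => t; rewrite !hornerE.
  transitivity (W g z * l z + W l z * g z).
    rewrite /lie/=; derive_at (fun z => g z * l z + c) z; ring_partials.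
  by rewrite WQz Wlz /g derivD derivM derivX derivC !hornerE; ring.
have [k] := ubnP (size P); elim: k P => // k IHk P Pk P0 IP.
pose s := (size P).-1.
(* Since W (P(l)) = w l P'(l), the function Q(l) is (W / w - s) P(l). The i-th coefficient of P is
   multiplied by i - s, which kills the leading one. *)
pose Q : {poly K} := P^`() * 'X - s%:R *: P.
have QE i : Q`_i = (i%:R - s%:R) * P`_i.
  rewrite coefB coefMX coefZ coef_deriv; case: i => [|i]/=;
    first by rewrite !sub0r mulNr.
  by rewrite mulrBl !mulr_natl.
have [Q0|Q0] := eqVneq Q 0.
  have PE : P = lead_coef P *: 'X^s.
    apply/polyP => i; rewrite coefZ coefXn; have [->|si] := eqVneq i s.
      by rewrite mulr1 lead_coefE.
    have /eqP : Q`_i = 0 by rewrite Q0 coef0.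
    by rewrite QE mulr0 mulf_eq0 subr_eq0 eqr_nat (negPf si) => /eqP.
  exists s; apply: (@ideal_scaleV (lead_coef P));
    first by rewrite lead_coef_eq0.
  by move: IP; rewrite {1}PE; under eq_fun do rewrite !hornerE.
apply: (IHk Q) => //.
  rewrite -ltnS; apply: leq_trans Pk; rewrite ltnS.
  have sP : size P = s.+1 by rewrite /s prednK// lt0n size_poly_eq0.
  rewrite sP ltnS; apply/leq_sizeP => j; rewrite leq_eqVlt => /predU1P[<-|sj].
    by rewrite QE subrr mul0r.
  by rewrite QE nth_default ?mulr0// sP.
have [_ [a [b [Oa Ob QabE]]]] := ideal_lincomb w%:R^-1 (- s%:R) (ideal_euler IP)
  IP.
split=> //; exists a, b; split=> //.
nearby QabE; nearby (WP P); at_point z => WPz <-; rewrite WPz.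
rewrite /Q hornerD hornerN hornerMX hornerZ; field.
by rewrite pnatr_eq0 -lt0n.
Qed.

(** If the quotient has dimension n, the n + 1 powers 1, l, ..., l^n are dependent in it: their
    coordinates form a matrix with more rows than columns, and a vector of its left kernel gives the
    coefficients of a nonzero polynomial P with P(l) in the ideal. *)
Lemma ideal_power_of l (w : nat) : (0 < w)%N -> O l ->
  germ_eq (W l) (fun z => w%:R * l z) -> exists m, I (fun z => l z ^+ m).
Proof.
move=> w_gt0 Ol Wl; have [n [u [_ _ uspan]]] := f_codim.
have /choice[c cE] (i : 'I_n.+1) : exists c : 'I_n -> K,
    I ((fun z => l z ^+ i) - \sum_j c j *: u j).
  by apply: uspan; germs.
pose C := \matrix_(i, j) c i j.
have /rowV0Pn[lam /sub_kermxP lamC lam0] : kermx C != 0.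
  by rewrite -mxrank_eq0 mxrank_ker subn_eq0 -ltnNge ltnS rank_leq_col.
pose P : {poly K} := \poly_(i < n.+1) lam 0 (inord i).
apply: (@ideal_power l w P) => //.
  apply: contraNneq lam0 => P0; apply/eqP/rowP => i; rewrite mxE.
  by have := coef0 K i; rewrite -P0 coef_poly ltn_ord inord_val.
have := ideal_sum (lam 0) cE; congr (I _); apply/funext => z.
rewrite horner_poly.
transitivity (\sum_i (lam 0 i * l z ^+ i - \sum_j lam 0 i * (c i j * u j z))).
  apply: eq_bigr => i _; rewrite [(_ - _) z]/= fct_sumE -mulr_sumr -mulrBr.
  by [].
rewrite sumrB [X in _ - X](_ : _ = 0) ?subr0; last first.
  rewrite exchange_big/= big1// => j _.
  have /rowP/(_ j) := lamC; rewrite !mxE => H.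
  rewrite -[RHS](mul0r (u j z)) -[in RHS]H mulr_suml.
  by apply: eq_bigr => i _; rewrite mxE mulrA.
by apply: eq_bigr => i _; rewrite inord_val.
Qed.

Let power_x : exists m A B, [/\ O A, O B &
  germ_eq (fun z => z.1 ^+ m) (fun z => A z * p z + B z * q z)].
Proof.
have [|m [_ [A [B ?]]]] := ideal_power_of w1_gt0 (germ_fst GO);
  last by exists m, A, B.
at_point z; rewrite /lie/=; have [_ -> ->] := has_partials_fst z.
by rewrite mulr1 mulr0 addr0.
Qed.

Let power_y : exists m A B, [/\ O A, O B &
  germ_eq (fun z => z.2 ^+ m) (fun z => A z * p z + B z * q z)].
Proof.
have [|m [_ [A [B ?]]]] := ideal_power_of w2_gt0 (germ_snd GO);
  last by exists m, A, B.
at_point z; rewrite /lie/=; have [_ -> ->] := has_partials_snd z.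
by rewrite mulr1 mulr0 add0r.
Qed.

Lemma near0_axis (P : K * K -> Prop) : (\forall z \near (0 : K * K), P z) ->
  \forall z \near (0 : K * K), P (0, z.2).
Proof.
have : (fun z : K * K => (0 : K, z.2)) @ (0 : K * K) --> ((0, 0) : K * K).
  apply: (@cvg_pair _ _ _ _ (nbhs (0 : K)) (nbhs (0 : K)) _ _ _ (fun=> 0) snd).
    exact: cvg_cst.
  exact: cvg_snd.
exact.
Qed.

Lemma snd_exp_neq0 m : ~ germ_eq (fun z => z.2 ^+ m) (fun=> 0).
Proof.
have pm : polynomial_fun (fun z : K * K => z.2 ^+ m).
  by exists ('X ^+ m)%:P => z; rewrite !hornerE.
have n0 : (0 : K, 1 : K).2 ^+ m != 0 by rewrite expr1n oner_neq0.
move=> /(polynomial_fun_dense pm n0)[z zm0].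
by rewrite zm0 eqxx.
Qed.

(** Otherwise y^m, which is a combination of f_x and f_y, would vanish on the axis x = 0. *)
Lemma gradient_axis_neq0 :
  (exists w : K * K, p (0, w.2) != 0) \/ (exists w : K * K, q (0, w.2) != 0).
Proof.
have [m [A [B [_ _ yE]]]] := power_y.
apply: contrapT => /not_orP[/forallNP p0 /forallNP q0].
apply: (@snd_exp_neq0 m); nearby (near0_axis yE); at_point z => /= ->.
have /negP := p0 z; rewrite negbK => /eqP ->.
have /negP := q0 z; rewrite negbK => /eqP ->.
by rewrite !mulr0 addr0.
Qed.

Lemma polynomial_fun_axis g : polynomial_fun g -> polynomial_fun (fun z =>
  g (0, z.2)).
Proof. by move=> [P gP]; exists (P.[0%:P])%:P => z; rewrite gP !hornerE. Qed.

Lemma continuous_axis g : O g ->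
  \forall z \near (0 : K * K), {for z, continuous (fun z : K * K =>
    g (0, z.2))}.
Proof.
move=> Og; nearby (near0_axis (germ_continuous GO Og)); at_point z => cg.
apply: (@continuous_comp _ _ _ (fun z : K * K => (0 : K, z.2)) g) => //.
apply: (@cvg_pair _ _ _ _ (nbhs (0 : K)) (nbhs z.2) _ _ _ (fun=> 0) snd).
  exact: cvg_cst.
exact: cvg_snd.
Qed.

Lemma divide_fst g h : O g -> O h ->
  germ_eq (fun z => z.1 * g z) (fun z => z.1 * h z) -> germ_eq g h.
Proof.
move=> Og Oh gh.
have : germ_eq (fun z => g z - h z) (fun=> 0).
  apply: (polynomial_fun_cancel (g := fst)).
  - exact: polynomial_fun_fst.
  - by exists (1, 0); rewrite oner_neq0.
  - by apply: (germ_continuous GO); germs.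
  - by nearby gh; at_point z => E; rewrite mulrBr E subrr.
move=> E; nearby E; at_point z => /eqP.
by rewrite subr_eq0 => /eqP.
Qed.

(* Exactness of the Koszul complex of f_x, f_y. *)
Lemma gradient_syzygy a b : O a -> O b ->
  germ_eq (fun z => a z * p z + b z * q z) (fun=> 0) ->
  exists al, [/\ O al, germ_eq a (fun z => al z * q z)
    & germ_eq b (fun z => - (al z * p z))].
Proof.
move=> Oa Ob ab0; have [m [A [B [OA OB xE]]]] := power_x.
(* Cramer's rule: multiply a by x^m = A p + B q and replace a p by - b q. *)
pose ga z := a z * B z - b z * A z.
have Oga : O ga by rewrite /ga; germs.
have gaq : germ_eq (fun z => z.1 ^+ m * a z) (fun z => ga z * q z).
  nearby ab0; nearby xE; at_point z => -> abz.
  rewrite /ga -[LHS]subr0 -[X in _ - X](mulr0 (A z)) -abz; ring_partials.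
have gap : germ_eq (fun z => z.1 ^+ m * b z) (fun z => - (ga z * p z)).
  nearby ab0; nearby xE; at_point z => -> abz.
  rewrite /ga -[LHS]subr0 -[X in _ - X](mulr0 (B z)) -abz; ring_partials.
clearbody ga; clear A B OA OB xE ab0.
elim: m ga Oga gaq gap => [|m IHm] ga Oga gaq gap.
  exists ga; split=> //.
    by nearby gaq; at_point z => <-; rewrite mul1r.
  by nearby gap; at_point z => <-; rewrite mul1r.
(* The factor x^(m+1) makes ga p and ga q vanish on x = 0, where p or q is a nonzero polynomial in
   y. So x divides ga, and one power of x is cancelled. *)
have ga0 : \forall z \near (0 : K * K), ga (0, z.2) = 0.
  case: gradient_axis_neq0 => [] [w w0].
  - apply: (polynomial_fun_cancel (polynomial_fun_axis p_pol)) (continuous_axis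
      Oga) _.
      by exists w.
    nearby (near0_axis gap); at_point z; rewrite expr0n/= mul0r mulrC => /eqP.
    by rewrite eq_sym oppr_eq0 => /eqP.
  - apply: (polynomial_fun_cancel (polynomial_fun_axis q_pol)) (continuous_axis
      Oga) _.
      by exists w.
    by nearby (near0_axis gaq); at_point z; rewrite expr0n/= mul0r mulrC.
have [ga' Oga' gaE] := germ_hadamard Oga ga0.
apply: (IHm ga') => //.
- apply: divide_fst; [by germs | by germs |].
  by nearby gaE; nearby gaq; at_point z => E1 E2; rewrite mulrA -exprS E1 E2
    mulrA.
- apply: divide_fst; [by germs | by germs |].
  nearby gaE; nearby gap; at_point z => E1 E2.
  by rewrite mulrA -exprS E1 E2 mulrN mulrA.
Qed.

Lemma gradient_neq0 : germ_eq p (fun=> 0) -> germ_eq q (fun=> 0) -> False.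
Proof.
have [m [A [B [_ _ yE]]]] := power_y.
move=> p0 q0; apply: (@snd_exp_neq0 m).
by nearby yE; nearby p0; nearby q0; at_point z => -> -> ->;
  rewrite !mulr0 addr0.
Qed.

(** For d = 0, W f = 0 makes f constant near 0, so its gradient vanishes and cannot generate a power
    of y. *)
Lemma degree_neq0 : d%:~R != 0 :> K.
Proof.
apply/negP => /eqP d0.
have fc : germ_eq f (fun=> f 0).
  by apply: (euler_const Of); at_point z; rewrite WfE d0 mul0r.
apply: gradient_neq0.
- nearby (germ_eq_dx fc); at_point z => ->.
  by have [_ -> _] := has_partials_cst (f 0) z.
- nearby (germ_eq_dy fc); at_point z => ->.
  by have [_ _ ->] := has_partials_cst (f 0) z.
Qed.

Lemma f_neq0 : exists w, f w != 0.
Proof.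
apply: contrapT => /forallNP f0.
have fc : germ_eq f (fun=> 0).
  by at_point z; have /negP := f0 z; rewrite negbK => /eqP.
apply: gradient_neq0.
- nearby (germ_eq_dx fc); at_point z => ->.
  by have [_ -> _] := has_partials_cst (0 : K) z.
- nearby (germ_eq_dy fc); at_point z => ->.
  by have [_ _ ->] := has_partials_cst (0 : K) z.
Qed.

(** * Normal form of cocycles and the basis of the cohomology *)

Let k : int := d - w1%:Z - w2%:Z.
Let kE : k%:~R = d%:~R - w1%:R - w2%:R :> K.
Proof. by rewrite /k !rmorphB. Qed.

Let germ_eulerE : germ_eq f (fun z => d%:~R^-1 * (w1%:R * z.1 * p z +
  w2%:R * z.2 * q z)).
Proof.
at_point z; have := WfE z; rewrite /lie/= => ->.
by rewrite mulKf// degree_neq0.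
Qed.

(** [quasi_homogeneous] asks for the identity at every point; a polynomial that vanishes near 0
    vanishes everywhere. *)
Lemma polynomial_quasi_homogeneous j e : polynomial_fun e ->
  germ_eq (W e) (fun z => j%:~R * e z) -> quasi_homogeneous w1 w2 j e.
Proof.
move=> pe We; split=> // z; apply/eqP; rewrite -subr_eq0; apply/negPn/negP =>
  n0.
have pW : polynomial_fun (fun z => W e z - j%:~R * e z).
  have mulc c g : polynomial_fun g -> polynomial_fun (fun z => c * g z).
    by move=> pg; apply: polynomial_fun_mul => //; exact: polynomial_fun_cst.
  under eq_fun do rewrite -mulNr.
  apply: polynomial_fun_add; last exact: mulc.
  rewrite /lie/=; apply: polynomial_fun_add; apply: polynomial_fun_mul.
  - exact/mulc/polynomial_fun_fst.
  - exact: polynomial_fun_dx.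
  - exact/mulc/polynomial_fun_snd.
  - exact: polynomial_fun_dy.
have [z' Wz'] := polynomial_fun_dense pW n0 We.
by rewrite Wz' subrr eqxx.
Qed.

Lemma Z1_normal_form (X : vfield K) : Z1 O f X ->
  exists c e g, [/\ quasi_homogeneous w1 w2 k e, O g &
    \forall z \near (0 : K * K),
      X.1 z = c * q z + e z * (w1%:R * z.1) + f z * dy g z /\
      X.2 z = - (c * p z) + e z * (w2%:R * z.2) - f z * dx g z].
Proof.
case: X => a b [[/= Oa Ob] Xf].
have dn0 := degree_neq0.
(* The cocycle condition reads X f = (div X) f = h d f = h (W f), so X - h W is a syzygy of the
   gradient. *)
pose h z := d%:~R^-1 * (dx a z + dy b z).
have Oh : O h by rewrite /h; germs.
have [|||al [Oal aE bE]] := @gradient_syzygy (fun z => a z - w1%:R * z.1 * h z)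
    (fun z => b z - w2%:R * z.2 * h z).
- by germs.
- by germs.
- nearby Xf; at_point z; rewrite /delta2/lie/divergence/= => /eqP.
  rewrite subr_eq0 => /eqP E.
  transitivity (a z * p z + b z * q z -
      h z * (w1%:R * z.1 * p z + w2%:R * z.2 * q z)); first by ring_partials.
  rewrite E; have := WfE z; rewrite /lie/= => ->; rewrite /h.
  by atomize_partials; field.
have [g Og gE] : exists2 g, O g &
    germ_eq (W g) (fun z => d%:~R * al z - d%:~R * al 0).
  exact: (euler_primitive (germ_scale d%:~R Oal)).
(* The subtracted term is H_g f / d, the W-coefficient of the coboundary f H_g, whose
   H_f-coefficient W g / d is al - al(0). *)
pose h' z := h z - d%:~R^-1 * (dy g z * p z - dx g z * q z).
have Oh' : O h' by rewrite /h'; germs.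
have Wh' : germ_eq (W h') (fun z => k%:~R * h' z).
  nearby (germ_derivable GO Oa); nearby (germ_derivable GO Ob).
  nearby (germ_derivable GO Oh); nearby (germ_derivable GO Oal).
  nearby (germ_derivable GO (germ_dx GO Og)).
  nearby (germ_derivable GO (germ_dy GO Og)).
  nearby (germ_derivable GO Op); nearby (germ_derivable GO Oq).
  nearby (euler_dx Og gE); nearby (euler_dy Og gE).
  nearby euler_dxf; nearby euler_dyf; nearby (germ_dxy GO Of).
  nearby (germ_eq_dx aE); nearby (germ_eq_dy bE).
  at_point z => by_ ax pq Wq Wp Wgy Wgx dq dp dgy dgx dal dh db da.
  have hz : d%:~R * h z = dx a z + dy b z by rewrite mulVKf.
  (* Take the divergence of X = h W + al H_f: d h = W h + (w1 + w2) h + H_f al, as H_f is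
     divergence-free. *)
  have Wh : W h z = k%:~R * h z - (dx al z * q z - dy al z * p z).
    have -> : k%:~R * h z =
        dx a z + dy b z - w1%:R * h z - w2%:R * h z by rewrite kE -hz; ring.
    move: ax by_.
    derive_at (fun z => a z - w1%:R * z.1 * h z) z.
    derive_at (fun z => al z * q z) z.
    derive_at (fun z => b z - w2%:R * z.2 * h z) z.
    derive_at (fun z => - (al z * p z)) z.
    rewrite -> pq; move=> /eqP; rewrite subr_eq => /eqP -> /eqP.
    by rewrite subr_eq => /eqP ->; rewrite /lie/=; ring_partials.
  transitivity (W h z - d%:~R^-1 * (W (dy g) z * p z + dy g z * W p z
     - (W (dx g) z * q z + dx g z * W q z))).
    by rewrite {1}/lie/=; derive_at h' z; rewrite /lie/=; ring_partials.
  rewrite Wq Wp Wgy Wgx Wh kE.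
  derive_at (fun z => d%:~R * al z - d%:~R * al 0) z.
  by rewrite /h'; atomize_partials; field.
have [e pe eE] := euler_eigen_polynomial Oh' Wh'.
exists (al 0), e, g; split=> //.
  apply: polynomial_quasi_homogeneous => //.
  nearby (germ_eq_dx eE); nearby (germ_eq_dy eE); nearby eE; nearby Wh'.
  by at_point z => Whz <- ey ex; rewrite -Whz /lie ex ey.
nearby aE; nearby bE; nearby gE; nearby eE; nearby germ_eulerE.
at_point z => -> <- Wg bz az.
have alz : al z = al 0 + d%:~R^-1 * W g z by rewrite Wg; field.
split.
- have -> : a z = al z * q z + w1%:R * z.1 * h z by rewrite -az; ring.
  by rewrite alz /h' /lie/=; atomize_partials; field.
- have -> : b z = - (al z * p z) + w2%:R * z.2 * h z by rewrite -bz; ring.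
  by rewrite alz /h' /lie/=; atomize_partials; field.
Qed.

Lemma normal_form_unique c e g : quasi_homogeneous w1 w2 k e -> O g ->
  (\forall z \near (0 : K * K),
    c * q z + e z * (w1%:R * z.1) = f z * dy g z /\
    - (c * p z) + e z * (w2%:R * z.2) = - (f z * dx g z)) ->
  c = 0 /\ forall z, e z = 0.
Proof.
move=> [pe We] Og E; have dn0 := degree_neq0; have Oe := germ_polynomial pe.
(* Apply both sides of c H_f + e W = f H_g to f: as H_f f = 0, this leaves f (d e - H_g f) = 0, and
   f can be cancelled. *)
pose v z := e z - d%:~R^-1 * (dy g z * p z - dx g z * q z).
have Ov : O v by rewrite /v; germs.
have v0 : germ_eq v (fun=> 0).
  apply: (polynomial_fun_cancel f_pol f_neq0 (germ_continuous GO Ov)).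
  nearby E; at_point z => -[E1 E2].
  transitivity (d%:~R^-1 * ((c * q z + e z * (w1%:R * z.1)) * p z +
     (- (c * p z) + e z * (w2%:R * z.2)) * q z -
     (f z * dy g z * p z - f z * dx g z * q z))).
    have <- : d%:~R^-1 * (w1%:R * z.1 * p z + w2%:R * z.2 * q z) = f z.
      have := WfE z; rewrite /lie/= => ->.
      by rewrite mulKf.
    rewrite /v; atomize_partials; field.
    exact: dn0.
  by rewrite E1 E2; ring_partials.
(* With the W-coefficients equal, the relation becomes u H_f = 0; whichever of p and q is a nonzero
   polynomial is cancelled. *)
pose u z := c - d%:~R^-1 * W g z.
have Ou : O u by rewrite /u /lie/=; germs.
have u0 : germ_eq u (fun=> 0).
  case: gradient_axis_neq0 => -[w w0].
  - apply: (polynomial_fun_cancel p_pol _ (germ_continuous GO Ou)).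
      by exists (0, w.2).
    nearby E; nearby v0; nearby germ_eulerE; at_point z => fz vz [_ E2].
    transitivity (- (- (c * p z) + e z * (w2%:R * z.2) + f z * dx g z) +
      v z * (w2%:R * z.2)).
      by rewrite fz /u /v /lie/=; ring_partials.
    by rewrite E2 vz; ring_partials.
  - apply: (polynomial_fun_cancel q_pol _ (germ_continuous GO Ou)).
      by exists (0, w.2).
    nearby E; nearby v0; nearby germ_eulerE; at_point z => fz vz [E1 _].
    transitivity (c * q z + e z * (w1%:R * z.1) - f z * dy g z -
      v z * (w1%:R * z.1)).
      by rewrite fz /u /v /lie/=; ring_partials.
    by rewrite E1 vz; ring_partials.
(* Evaluate at the origin, where W g vanishes. Then W g = 0 nearby, so g is constant and [v0] gives
   e = 0. *)
have c0 : c = 0.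
  have := nbhs_singleton u0; rewrite /u/lie/=.
  by rewrite !mulr0 !mul0r addr0 mulr0 subr0.
split=> // w.
have gc : germ_eq g (fun=> g 0).
  apply: (euler_const Og); nearby u0; at_point z.
  rewrite /u c0 sub0r => /eqP; rewrite oppr_eq0 mulf_eq0 invr_eq0 (negPf dn0).
  by move=> /eqP.
apply/eqP/negPn/negP => ew.
have e0 : germ_eq e (fun=> 0).
  nearby (germ_eq_dx gc); nearby (germ_eq_dy gc); nearby v0; at_point z.
  have [_ -> ->] := has_partials_cst (g 0) z => vz gy gx.
  move: vz; rewrite /v gy gx.
  by rewrite !mul0r subrr mulr0 subr0.
have [z' e'z] := polynomial_fun_dense pe ew e0.
by rewrite e'z eqxx.
Qed.

Lemma H1_family_sum r (e : 'I_r -> scalar K) (c : option 'I_r -> K) z :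
  let X := \sum_i c i *: H1_family w1 w2 f e i in
  let E := \sum_j c (Some j) *: e j in
  X.1 z = c None * q z + E z * (w1%:R * z.1) /\
  X.2 z = - (c None * p z) + E z * (w2%:R * z.2).
Proof.
move=> X E; have EE : E z = \sum_j c (Some j) * e j z by rewrite /E fct_sumE.
have X1 : X.1 z = \sum_i c i * (H1_family w1 w2 f e i).1 z.
  by rewrite /X (raddf_sum fst) fct_sumE.
have X2 : X.2 z = \sum_i c i * (H1_family w1 w2 f e i).2 z.
  by rewrite /X (raddf_sum snd) fct_sumE.
rewrite EE X1 X2 !sum_option !mulr_suml /= mulrN.
by split; congr (_ + _); apply: eq_bigr => j _; exact: mulrA.
Qed.

Lemma quasi_homogeneous_lincomb (j : int) r (e : 'I_r -> scalar K) (c : 'I_r ->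
  K) :
  (forall i, quasi_homogeneous w1 w2 j (e i)) ->
  quasi_homogeneous w1 w2 j (\sum_i c i *: e i).
Proof.
move=> eqh; have cst0 : quasi_homogeneous w1 w2 j (0 : scalar K).
  split=> [|z]; first exact: (polynomial_fun_cst (0 : K)).
  by rewrite /lie; have [_ -> ->] := has_partials_cst (0 : K) z;
    rewrite !mulr0 addr0.
elim/big_ind: _ => // [g h [pg Wg] [ph Wh]|i _].
  split=> [|z]; first exact: polynomial_fun_add.
  have dg := polynomial_fun_derivable_xy z pg.
  have dh := polynomial_fun_derivable_xy z ph.
  rewrite (_ : g + h = fun z => g z + h z)//.
  transitivity (W g z + W h z); last by rewrite Wg Wh -mulrDr.
  by rewrite /lie/=; derive_at (fun z => g z + h z) z; ring_partials.
have [pe We] := eqh i.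
split=> [|z].
  by apply: (@polynomial_fun_mul _ (fun=> c i)) => //;
    exact: polynomial_fun_cst.
have de := polynomial_fun_derivable_xy z pe.
rewrite (_ : c i *: e i = fun z => c i * e i z)//.
transitivity (c i * W (e i) z); last by rewrite We mulrCA.
by rewrite /lie/=; derive_at (fun z => c i * e i z) z; ring_partials.
Qed.

(** H_f annihilates f and is divergence-free. For e W, the condition is d e = W e + (w1 + w2) e,
    which is what fixes the degree k = d - w1 - w2. *)
Lemma H1_family_Z1 r (e : 'I_r -> scalar K) i :
  (forall j, quasi_homogeneous w1 w2 k (e j)) -> Z1 O f (H1_family w1 w2 f e i).
Proof.
move=> eqh; case: i => [j|]; last first.
  split; first by split=> /=; germs.
  nearby (germ_derivable GO Op); nearby (germ_derivable GO Oq).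
  nearby (germ_dxy GO Of); at_point z => pq dq dp.
  rewrite /delta2/lie/divergence/=; derive_at (fun z => - p z) z.
  by rewrite -> pq; ring_partials.
have [pe We] := eqh j; have Oe := germ_polynomial pe.
split; first by split=> /=; germs.
nearby (germ_derivable GO Oe); at_point z => de.
rewrite /delta2/divergence.
transitivity (e j z * W f z - (W (e j) z + w1%:R * e j z + w2%:R * e j z) * f
  z).
  rewrite /lie/=; derive_at (fun z => e j z * (w1%:R * z.1)) z.
  by derive_at (fun z => e j z * (w2%:R * z.2)) z; ring_partials.
by rewrite We WfE kE; ring.
Qed.

Lemma H1_family_basis r (e : 'I_r -> scalar K) :
  is_basis (quasi_homogeneous w1 w2 k) e -> is_H1_basis O f (H1_family w1 w2 f
    e).
Proof.
move=> [eqh eindep espan].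
have Z1e i := H1_family_Z1 i eqh.
split=> // [c [_ [g [Og E1 E2]]]|X ZX].
  have [c0 E0] : c None = 0 /\ forall z, (\sum_j c (Some j) *: e j) z = 0.
    apply: (normal_form_unique (g := g)) => //.
      exact: quasi_homogeneous_lincomb.
    nearby E1; nearby E2; at_point z.
    have [-> ->] := H1_family_sum e c z.
    by rewrite /delta1/=mulrN => -> ->.
  case=> [j|//]; apply: (eindep (fun j => c (Some j))).
  by apply/funext => z; exact: E0.
have [c [E [g [Eqh Og XE]]]] := Z1_normal_form ZX.
have [ce ceE] := espan E Eqh.
pose c' i := if i is Some j then ce j else c.
exists c'.
have EE : E = \sum_j ce j *: e j by apply/eqP; rewrite -subr_eq0; apply/eqP.
have EqX : \forall z \near (0 : K * K),
    (X - \sum_i c' i *: H1_family w1 w2 f e i).1 z = (delta1 f g).1 z /\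
    (X - \sum_i c' i *: H1_family w1 w2 f e i).2 z = (delta1 f g).2 z.
  nearby XE; at_point z => -[X1 X2].
  rewrite /delta1/=; have [S1 S2] := H1_family_sum e c' z.
  rewrite -[LHS in LHS = _ /\ _]/(X.1 z - (\sum_i c' i *: H1_family w1 w2 f e
    i).1 z).
  rewrite -[X in _ /\ X = _]/(X.2 z - (\sum_i c' i *: H1_family w1 w2 f e i).2
    z).
  rewrite S1 S2 X1 X2 EE /c'; split; ring_partials.
have [Og1 Og2] : vfield_germ O (delta1 f g) by split=> /=; germs.
split.
  split; [apply: (germ_ext GO Og1) | apply: (germ_ext GO Og2)].
    by nearby EqX; at_point z => -[-> _].
  by nearby EqX; at_point z => -[_ ->].
by exists g; split=> //; nearby EqX; at_point z => -[].
Qed.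

Lemma H1_family_dim r (e : 'I_r -> scalar K) :
  is_basis (quasi_homogeneous w1 w2 k) e -> H1_dim O f r.+1.
Proof.
move=> /H1_family_basis ub; eexists.
have hb : bijective (unlift (@ord0 r)).
  exists (fun i => if i is Some j then lift ord0 j else ord0).
    by move=> i; case: unliftP => [j ->|->].
  by case=> [j|]; rewrite ?liftK ?unlift_none.
exact: (quot_basis_card hb ub).
Qed.

End FiniteCodimension.
End Weights.
End GermClass.

(** * Convergent power series *)

Section QuantitativeCalculus.
Variable K : numFieldType.
Implicit Types (f : scalar K) (z w : K * K).

Lemma norm_fst_le z : `|z.1| <= `|z|.
Proof.
by rewrite prod_normE/= comparable_le_max ?real_comparable ?normr_real// lexx.
Qed.

Lemma norm_snd_le z : `|z.2| <= `|z|.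
Proof.
by rewrite prod_normE/= comparable_le_max ?real_comparable ?normr_real// lexx
  orbT.
Qed.

(** The order of [K] may be partial, as on the complex numbers; positive elements are real, hence
    comparable. *)
Lemma pos_min (a b : K) : 0 < a -> 0 < b ->
  exists c, [/\ 0 < c, c <= a & c <= b].
Proof.
move=> a0 b0; have [ab|ba] := real_leP (gtr0_real a0) (gtr0_real b0).
- by exists a.
- by exists b; split=> //; exact: ltW.
Qed.

(** A quadratic remainder survives summation and integration, so this serves for power series and
    for integrals with a parameter in place of an interchange of limits. The [D + 1] in the proof
    allows [D = 0]. *)
Lemma is_derive_quadratic (V : normedModType K) (f : V ->
  K) (z w : V) (g r D : K) :
  0 < r -> 0 <= D ->
  (forall h, `|h| <= r -> `|f (h *: w + z) - f z - h * g| <= D * `|h| ^+ 2) ->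
  is_derive z w f g.
Proof.
move=> r0 D0 fg.
have cv : (fun h => h^-1 *: ((f \o shift z) (h *: w) - f z)) @ 0^' --> g.
  apply/cvgrPdist_lt => e e0; rewrite near_withinE.
  apply/(@nbhs_norm0P K K).
  have d0 : 0 < e / (D + 1) by rewrite divr_gt0// ltr_wpDl.
  have [m [m0 mr me]] := pos_min r0 d0.
  exists m => // h /= hm h0.
  have hr : `|h| <= r by rewrite ltW// (lt_le_trans hm).
  have he : `|h| < e / (D + 1) by exact: lt_le_trans me.
  have -> : g - h^-1 *: (f (h *: w + z) - f z) = - (h^-1 * (f (h *: w + z) - f z
    - h * g)).
    by rewrite [_ *: _]/(_ * _) mulrBr mulKf// opprB.
  rewrite normrN normrM normfV mulrC ltr_pdivrMr ?normr_gt0//.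
  apply: le_lt_trans (fg _ hr) _; rewrite expr2 mulrA ltr_pM2r ?normr_gt0//.
  move: he; rewrite ltr_pdivlMr ?ltr_wpDl// mulrC mulrDl mul1r;
    apply: le_lt_trans.
  by rewrite lerDl.
by apply: DeriveDef; [apply/cvg_ex; exists g | exact: cvg_lim].
Qed.

Lemma continuous_lipschitz f z (r L : K) : 0 < r -> 0 <= L ->
  (forall z', `|z' - z| <= r -> `|f z' - f z| <= L * `|z' - z|) ->
  {for z, continuous f}.
Proof.
move=> r0 L0 fL; apply/cvgrPdist_lt => e e0; apply/(@nbhs_normP K (K * K)%type).
have d0 : 0 < e / (L + 1) by rewrite divr_gt0// ltr_wpDl.
have [m [m0 mr me]] := pos_min r0 d0.
exists m => // z'; rewrite /ball_/= distrC => zm.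
have zr : `|z' - z| <= r by rewrite ltW// (lt_le_trans zm).
have ze : `|z' - z| < e / (L + 1) by exact: lt_le_trans me.
rewrite distrC; apply: le_lt_trans (fL _ zr) _.
move: ze; rewrite ltr_pdivlMr ?ltr_wpDl// mulrC mulrDl mul1r;
  apply: le_lt_trans.
by rewrite lerDl.
Qed.

End QuantitativeCalculus.

Section AnalyticGerms.
Variable K : numFieldType.
Implicit Types (u v a b : nat -> nat -> K) (C M l : K) (z : K * K).

(* Archimedean and complete, in the only form needed. *)
Hypothesis half_exp_small : forall e : K, 0 < e -> exists n, 2^-1 ^+ n < e.
Hypothesis geometric_cvg : forall (s : nat -> K) C,
  (forall n, `|s n.+1 - s n| <= C * 2^-1 ^+ n) -> exists l, s @ \oo --> l.

(* Small enough to absorb the n^4 terms in the product of two square sums: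
   theta^n = 2^-n (2^-n)^4 and n 2^-n <= 1. *)
Let theta : K := 2^-1 ^+ 5.

(** * Double series with geometric decay, summed over squares *)

Definition square_sum u (n : nat) : K := \sum_(i < n) \sum_(j < n) u i j.
Definition sums u l := square_sum u @ \oo --> l.
Definition decays u C := forall i j, `|u i j| <= C * theta ^+ (i + j).

Lemma half_gt0 : 0 < 2^-1 :> K. Proof. by rewrite invr_gt0. Qed.
Lemma half_ge0 : 0 <= 2^-1 :> K. Proof. by rewrite ltW// half_gt0. Qed.
Let theta_gt0 : 0 < theta. Proof. by rewrite exprn_gt0// half_gt0. Qed.
Let theta_ge0 : 0 <= theta. Proof. exact: ltW. Qed.
Local Hint Resolve half_ge0 half_gt0 theta_gt0 theta_ge0 : core.

Lemma natr_le_exp2 n : n%:R <= 2 ^+ n :> K.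
Proof. by rewrite -natrX ler_nat ltnW// ltn_expl. Qed.

Lemma natr_half n : n%:R * 2^-1 ^+ n <= 1 :> K.
Proof.
by rewrite exprVn ler_pdivrMr ?exprn_gt0// mul1r natr_le_exp2.
Qed.

Lemma thetaX n : theta ^+ n = 2^-1 ^+ n * 2^-1 ^+ n * 2^-1 ^+ n * 2^-1 ^+
  n * 2^-1 ^+ n :> K.
Proof. by rewrite /theta -exprM -!exprD; congr (_ ^+ _); lia. Qed.

Lemma geometric_ge0 u C : decays u C -> 0 <= C.
Proof. by move=> /(_ 0%N 0%N); rewrite expr0 mulr1; apply: le_trans. Qed.

Lemma half_exp_le1 n : 2^-1 ^+ n <= 1 :> K.
Proof. by rewrite exprn_ile1// invf_le1// ler1n. Qed.

Lemma cvg0_geometric (s : nat -> K) C :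
  (forall n, `|s n| <= C * 2^-1 ^+ n) -> s @ \oo --> (0 : K).
Proof.
move=> sC; apply/cvgrPdist_lt => e e0.
have C0 : 0 <= C by have := sC 0%N; rewrite expr0 mulr1; apply: le_trans.
have [n ne] : exists n, 2^-1 ^+ n < e / (C + 1).
  by apply: half_exp_small; rewrite divr_gt0// ltr_wpDl.
exists n => // m /= nm; rewrite sub0r normrN; apply: le_lt_trans (sC m) _.
move: ne; rewrite ltr_pdivlMr ?ltr_wpDl// => /(le_lt_trans _); apply.
rewrite mulrC ler_pM ?exprn_ge0 ?lerDl//.
by rewrite -(subnKC nm) exprD ler_piMr ?exprn_ge0 ?half_exp_le1.
Qed.

Lemma cvg_norm_bound (s : nat -> K) l M :
  s @ \oo --> l -> (forall n, `|s n| <= M) -> `|l| <= M.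
Proof.
move=> sl sM; have Mr : M \is Num.real.
  by rewrite ger0_real// (le_trans _ (sM 0%N)).
rewrite real_leNgt ?normr_real//; apply/negP => Ml.
have [n _ /(_ n (leqnn n))] := cvgr_norm_gt _ sl _ Ml.
by rewrite real_ltNge ?normr_real// sM.
Qed.

Lemma sumsD u v l l' : sums u l -> sums v l' ->
  sums (fun i j => u i j + v i j) (l + l').
Proof.
rewrite /sums => ul vl.
rewrite (_ : square_sum _ = square_sum u \+ square_sum v); first exact: cvgD.
apply/funext => n; rewrite /= /square_sum -big_split; apply: eq_bigr => i _.
exact: big_split.
Qed.

Lemma sumsZ c u l : sums u l -> sums (fun i j => c * u i j) (c * l).
Proof.
rewrite /sums => ul.
rewrite (_ : square_sum _ = fun n => c * square_sum u n).
  by apply: cvgM => //; exact: cvg_cst.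
apply/funext => n; rewrite /square_sum mulr_sumr; apply: eq_bigr => i _.
by rewrite mulr_sumr.
Qed.

Lemma sumsB u v l l' : sums u l -> sums v l' ->
  sums (fun i j => u i j - v i j) (l - l').
Proof.
move=> ul /(@sumsZ (-1) _ _) vl; have := sumsD ul vl; rewrite mulN1r.
by under eq_fun do under eq_fun do rewrite mulN1r.
Qed.

Lemma half_sum n : \sum_(i < n) 2^-1 ^+ i = 2 - 2 * 2^-1 ^+ n :> K.
Proof.
elim: n => [|n IHn]; first by rewrite big_ord0 expr0 mulr1 subrr.
by rewrite big_ord_recr/= IHn exprS; field.
Qed.

Lemma theta_exp_half n : theta ^+ n <= 2^-1 ^+ n.
Proof.
rewrite thetaX -[leRHS]mul1r ler_wpM2r ?exprn_ge0//.
by rewrite !mulr_ile1 ?mulr_ge0 ?exprn_ge0 ?half_exp_le1.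
Qed.

Lemma theta_sum_le2 n : \sum_(i < n) theta ^+ i <= 2 :> K.
Proof.
apply: (@le_trans _ _ (\sum_(i < n) 2^-1 ^+ i)).
  by apply: ler_sum => i _; exact: theta_exp_half.
by rewrite half_sum gerBl mulr_ge0// exprn_ge0.
Qed.

Lemma square_sum_bound u C n : decays u C -> `|square_sum u n| <= 4 * C.
Proof.
move=> uC; have C0 := geometric_ge0 uC.
apply: (@le_trans _ _ (C * (\sum_(i < n) theta ^+ i) * (\sum_(j < n) theta ^+
  j))).
  rewrite [C * _]mulr_sumr mulr_suml; apply: le_trans (ler_norm_sum _ _ _) _.
  apply: ler_sum => i _; rewrite mulr_sumr.
  apply: le_trans (ler_norm_sum _ _ _) _; apply: ler_sum => j _.
  by rewrite -mulrA -exprD.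
have s0 : 0 <= \sum_(i < n) theta ^+ i :> K by rewrite sumr_ge0// => i _;
  rewrite exprn_ge0.
rewrite (_ : 4 * C = C * 2 * 2); last by ring.
by rewrite ler_pM ?mulr_ge0// ?ler_wpM2l ?theta_sum_le2.
Qed.

Lemma sums_bound u C l : decays u C -> sums u l -> `|l| <= 4 * C.
Proof. by move=> uC ul; apply: (cvg_norm_bound ul) => n;
  exact: square_sum_bound. Qed.

Lemma row_bound u C m n : decays u C -> `|\sum_(i < m) u i n| <= 2 * C * 2^-1 ^+
  n.
Proof.
move=> uC; have C0 := geometric_ge0 uC; apply: le_trans (ler_norm_sum _ _ _) _.
apply: (@le_trans _ _ (C * theta ^+ n * \sum_(i < m) theta ^+ i)).
  rewrite mulr_sumr; apply: ler_sum => i _; apply: le_trans (uC _ _) _.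
  by rewrite addnC exprD mulrA.
rewrite (_ : 2 * C * _ = C * 2^-1 ^+ n * 2); last by ring.
apply: ler_pM; rewrite ?theta_sum_le2 ?mulr_ge0 ?exprn_ge0//.
  by rewrite sumr_ge0// => i _; rewrite exprn_ge0.
by rewrite ler_wpM2l// theta_exp_half.
Qed.

Lemma geometric_tr u C : decays u C -> decays (fun i j => u j i) C.
Proof. by move=> uC i j; rewrite addnC. Qed.

(** Enlarging the n-th square adds one row and one column, each of norm at most 2 C 2^-n. *)
Lemma geometric_sums u C : decays u C -> exists l, sums u l.
Proof.
move=> uC; apply: (@geometric_cvg _ (4 * C)) => n.
rewrite /square_sum big_ord_recr/=.
rewrite (eq_bigr (fun i : 'I_n => \sum_(j < n) u i j + u i n)); last first.
  by move=> i _; rewrite big_ord_recr.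
rewrite big_split/=; set A := \sum_(i < n) \sum_(j < n) u i j.
set B := \sum_(i < n) u i n; set D := \sum_(j < n.+1) u n j.
rewrite (_ : A + B + D - A = B + D); last by ring.
apply: le_trans (ler_normD _ _) _.
rewrite (_ : 4 * C * _ = 2 * C * 2^-1 ^+ n + 2 * C * 2^-1 ^+ n); last by ring.
by apply: lerD; [exact: row_bound | exact: (row_bound _ _ (geometric_tr uC))].
Qed.

Definition shift_rows u i j : K := if i is i'.+1 then u i' j else 0.

(** A square of side n + 1 of the shifted family is the n by n square of [u] plus one column, which
    tends to 0. This realigns the indices of a differentiated series with those of the original
    one. *)
Lemma sums_shift u C l : decays u C -> sums u l -> sums (shift_rows u) l.
Proof.
move=> uC ul; rewrite /sums -cvg_shiftS.
rewrite (_ : (fun n => _) = fun n => square_sum u n + \sum_(i < n) u i n).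
  rewrite -[l]addr0; apply: cvgD => //.
  by apply: (@cvg0_geometric _ (2 * C)) => n; exact: row_bound.
apply/funext => n; rewrite /square_sum big_ord_recl/= [X in X + _]big1// add0r.
rewrite -big_split; apply: eq_bigr => i _.
by rewrite /= big_ord_recr.
Qed.

Definition cauchy_product u v i j : K :=
  \sum_(i1 < i.+1) \sum_(j1 < j.+1) u i1 j1 * v (i - i1)%N (j - j1)%N.

Lemma triangle_sum n (F : nat -> nat -> K) :
  \sum_(i < n) \sum_(i1 < i.+1) F i1 (i - i1)%N =
  \sum_(i1 < n) \sum_(i2 < n | (i1 + i2 < n)%N) F i1 i2.
Proof.
transitivity (\sum_(0 <= i < n) \sum_(0 <= i1 < n | (i1 <= i)%N) F i1
  (i - i1)%N).
  rewrite big_mkord; apply: eq_bigr => i _; rewrite big_mkord.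
  by rewrite (big_ord_widen n (fun i1 => F i1 (i - i1)%N))//=; apply: eq_bigl =>
    j.
rewrite (exchange_big_dep_nat xpredT)//= big_mkord; apply: eq_bigr => i1 _.
transitivity (\sum_(i2 < n - i1) F i1 i2).
  transitivity (\sum_(i1 <= i < n) F i1 (i - i1)%N).
    by rewrite (big_nat_widenl i1 0 n).
  rewrite -{1}[i1 : nat]add0n big_addn big_mkord; apply: eq_bigr => i2 _.
  by rewrite addnK.
rewrite (big_ord_widen n (fun i2 => F i1 i2)) ?leq_subr//.
by apply: eq_bigl => i2; rewrite ltn_subRL.
Qed.

Lemma norm_sum_le n (F : 'I_n -> K) (B : K) :
  (forall i, `|F i| <= B) -> `|\sum_i F i| <= n%:R * B.
Proof.
move=> FB; apply: le_trans (ler_norm_sum _ _ _) _.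
apply: (@le_trans _ _ (\sum_(i < n) B)); first by apply: ler_sum => i _;
  exact: FB.
by rewrite sumr_const card_ord mulr_natl.
Qed.

(** The product of the squares contains all i1, i2, j1, j2 < n; the Cauchy product keeps those with
    i1 + i2 < n and j1 + j2 < n. Each discarded term has total degree at least n, so is at most C C'
    theta^n, and there are at most n^4 of them. *)
Lemma square_sum_conv u v C C' n : decays u C -> decays v C' ->
  `|square_sum u n * square_sum v n - square_sum (cauchy_product u v) n| <=
  C * C' * 2^-1 ^+ n.
Proof.
move=> uC vC; have C0 := geometric_ge0 uC; have C'0 := geometric_ge0 vC.
pose t i1 i2 j1 j2 := u i1 j1 * v i2 j2.
have -> : square_sum u n * square_sum v n =
    \sum_(i1 < n) \sum_(i2 < n) \sum_(j1 < n) \sum_(j2 < n) t i1 i2 j1 j2.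
  rewrite /square_sum mulr_suml; apply: eq_bigr => i1 _.
  rewrite mulr_suml [RHS]exchange_big/=; apply: eq_bigr => j1 _.
  rewrite mulr_sumr; apply: eq_bigr => i2 _.
  by rewrite mulr_sumr.
have -> : square_sum (cauchy_product u v) n =
    \sum_(i1 < n) \sum_(i2 < n | (i1 + i2 < n)%N)
      \sum_(j1 < n) \sum_(j2 < n | (j1 + j2 < n)%N) t i1 i2 j1 j2.
  rewrite -(triangle_sum _ (fun i1 i2 =>
    \sum_(j1 < n) \sum_(j2 < n | (j1 + j2 < n)%N) t i1 i2 j1 j2)).
  apply: eq_bigr => i _; rewrite /cauchy_product exchange_big/=;
    apply: eq_bigr => i1 _.
  by rewrite -(triangle_sum _ (t i1 (i - i1)%N)).
rewrite -sumrB;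
  apply: (@le_trans _ _ (n%:R * (n%:R * (n%:R * (n%:R * (C * C' * theta ^+
  n)))))).
  have tb i1 i2 j1 j2 : ~~ ((i1 + i2 < n) && (j1 + j2 < n))%N ->
      `|t i1 i2 j1 j2| <= C * C' * theta ^+ n.
    move=> ij; rewrite /t normrM; apply: (@le_trans _ _
        (C * theta ^+ (i1 + j1) * (C' * theta ^+ (i2 + j2)))).
      by apply: ler_pM.
    rewrite mulrACA -exprD ler_wpM2l ?mulr_ge0//.
    have /subnKC <- : (n <= i1 + j1 + (i2 + j2))%N by lia.
    rewrite exprD ler_piMr ?exprn_ge0//.
    exact: le_trans (theta_exp_half _) (half_exp_le1 _).
  apply: norm_sum_le => i1; rewrite [X in _ - X]big_mkcond -sumrB/=.
  apply: norm_sum_le => i2; case: ifP => i12.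
    rewrite -sumrB; apply: norm_sum_le => j1; rewrite [X in _ - X]big_mkcond
      -sumrB/=.
    apply: norm_sum_le => j2; case: ifP => j12.
      by rewrite subrr normr0 !mulr_ge0// exprn_ge0.
    by rewrite subr0; apply: tb; rewrite i12 j12.
  rewrite subr0; apply: norm_sum_le => j1; apply: norm_sum_le => j2.
  by apply: tb; rewrite i12.
rewrite thetaX; set h := 2^-1 ^+ n.
rewrite (_ : _ * (n%:R * _) = C * C' * h * (n%:R * h) * (n%:R * h) * (n%:R * h)
  * (n%:R * h));
  last by ring.
have h0 : 0 <= h by rewrite exprn_ge0.
have nh : n%:R * h <= 1 by exact: natr_half.
have nh0 : 0 <= n%:R * h by rewrite mulr_ge0.
have X0 : 0 <= C * C' * h by rewrite !mulr_ge0.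
by do 4! (apply: le_trans (ler_piMr _ nh) _; first by rewrite !mulr_ge0).
Qed.

Lemma sumsM u v C C' l l' : decays u C -> decays v C' ->
  sums u l -> sums v l' -> sums (cauchy_product u v) (l * l').
Proof.
move=> uC vC ul vl; rewrite /sums.
rewrite (_ : square_sum _ = fun n => square_sum u n * square_sum v n -
  (square_sum u n * square_sum v n - square_sum (cauchy_product u v) n));
    last first.
  by apply/funext => n; rewrite opprB addrC subrK.
rewrite -[l * l']subr0; apply: cvgB; first exact: cvgM.
by apply: (@cvg0_geometric _ (C * C')) => n; exact: square_sum_conv.
Qed.

(** * Power series with geometrically bounded coefficients *)

Definition monomials a z i j : K := a i j * z.1 ^+ i * z.2 ^+ j.
Definition pseries a z : K := lim (square_sum (monomials a z) @ \oo).
(** Cauchy estimates with explicit constants: they characterize convergence near 0 and, unlike a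
    radius of convergence, pass through each operation on coefficients by simple arithmetic. *)
Definition tame a C M := [/\ 0 <= C, 0 < M & forall i j, `|a i j| <= C * M ^+
  (i + j)].
Definition small_at M z := `|z.1| * M <= theta /\ `|z.2| * M <= theta.

Lemma near_small M : 0 < M -> \forall z \near (0 : K * K), small_at M z.
Proof.
move=> M0; apply/nbhs_norm0P; exists (theta / M) => /=;
  first by rewrite divr_gt0.
move=> z /= zM; split; rewrite -ler_pdivlMr// ltW//; apply: le_lt_trans zM.
- exact: norm_fst_le.
- exact: norm_snd_le.
Qed.

Lemma smallW M M' z : M <= M' -> small_at M' z -> small_at M z.
Proof.
by move=> MM' [z1 z2]; split; [apply: le_trans z1|apply: le_trans z2];
  rewrite ler_wpM2l.
Qed.

Lemma tameW a C M C' M' : C <= C' -> M <= M' -> tame a C M -> tame a C' M'.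
Proof.
move=> CC' MM' [C0 M0 aC]; split; [exact: le_trans CC' | exact: lt_le_trans
  MM' |].
move=> i j; apply: le_trans (aC i j) _.
by rewrite ler_pM ?exprn_ge0 ?(ltW M0)// lerXn2r// nnegrE ltW// (lt_le_trans
  M0).
Qed.

Lemma geometric_monomials a C M z : tame a C M -> small_at M z ->
  decays (monomials a z) C.
Proof.
move=> [C0 M0 aC] [z1 z2] i j.
rewrite /monomials !normrM !normrX.
apply: (@le_trans _ _ (C * M ^+ (i + j) * `|z.1| ^+ i * `|z.2| ^+ j)).
  by rewrite !ler_wpM2r ?exprn_ge0.
rewrite (_ : _ * _ = C * ((`|z.1| * M) ^+ i * (`|z.2| * M) ^+ j)); last first.
  by rewrite exprD !exprMn; ring.
rewrite ler_wpM2l// exprD ler_pM ?exprn_ge0 ?mulr_ge0 ?(ltW M0)//.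
- by rewrite lerXn2r ?nnegrE ?mulr_ge0 ?(ltW M0).
- by rewrite lerXn2r ?nnegrE ?mulr_ge0 ?(ltW M0).
Qed.

Lemma pseriesE a z l : sums (monomials a z) l -> pseries a z = l.
Proof. exact: cvg_lim. Qed.

Lemma pseries_sums a C M z : tame a C M -> small_at M z ->
  sums (monomials a z) (pseries a z).
Proof.
move=> aC zM; have [l al] := geometric_sums (geometric_monomials aC zM).
by rewrite (pseriesE al).
Qed.

Definition is_series (f : scalar K) := exists a C M, tame a C M /\ germ_eq f
  (pseries a).

Lemma analytic_germP f : analytic_germ f <-> is_series f.
Proof.
split=> [[a /nbhs_norm0P[e/= e0 fa]]|[a [C [M [aC fE]]]]].
  have [s s0 se] : exists2 s, 0 < s & s < e.
    by exists (e / 2); rewrite ?divr_gt0// ltr_pdivrMr// ltr_pMr// ltr1n.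
  (* At the diagonal point (s, s) every term is |a_ij| s^(i+j), and a nonnegative term is bounded by
     any partial sum containing it. *)
  have [|/cvg_ex[l al] _] := fa (s, s).
    by rewrite /= prod_normE/= maxxx gtr0_norm.
  exists a, (`|l| + 1), s^-1; split; last first.
    apply/nbhs_norm0P; exists e => // z /= /fa[_ fz]; symmetry; exact: cvg_lim.
  split; [by rewrite addr_ge0| by rewrite invr_gt0|move=> i j].
  have [n _ nB] := cvgr_norm_lt _ al (`|l| + 1) (ltr_pwDr ltr01 (lexx _)).
  (* A square that is beyond the rank [n] of the bound and also contains the index (i, j). *)
  pose m := maxn n (maxn i j).+1.
  have := nB m (leq_maxl _ _) => /= sB.
  rewrite exprVn ler_pdivlMr ?exprn_gt0//.
  apply: le_trans _ (ltW sB); rewrite [leRHS]ger0_norm; last first.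
    by rewrite sumr_ge0// => i1 _; rewrite sumr_ge0.
  have im : (i < m)%N by rewrite /m; lia.
  have jm : (j < m)%N by rewrite /m; lia.
  rewrite (bigD1 (Ordinal im))//= (bigD1 (Ordinal jm))//= -addrA.
  rewrite !normrM !normrX/= (gtr0_norm s0) -mulrA -exprD lerDl.
  by rewrite addr_ge0// !sumr_ge0// => i1 _; rewrite sumr_ge0.
exists a; have M0 : 0 < M by case: aC.
nearby fE; nearby (near_small M0); at_point z => zM ->.
split; last exact: pseries_sums aC zM.
have gC : decays (fun i j => `|monomials a z i j|) C.
  by move=> i j; rewrite normr_id; exact: geometric_monomials aC zM _ _.
by have [l al] := geometric_sums gC; apply/cvg_ex; exists l.
Qed.

(** * Termwise differentiation, continuity and uniqueness of coefficients *)

Definition series_dx a i j : K := i.+1%:R * a i.+1 j.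

Lemma natr_le_exp2S n : n.+1%:R <= 2 ^+ n :> K.
Proof. by rewrite -natrX ler_nat ltn_expl. Qed.

Lemma tame_dx a C M : tame a C M -> tame (series_dx a) (C * M) (2 * M).
Proof.
move=> [C0 M0 aC]; split; [by rewrite mulr_ge0// ltW | by rewrite mulr_gt0 |].
move=> i j; rewrite /series_dx normrM normr_nat.
apply: (@le_trans _ _ (2 ^+ (i + j) * (C * M ^+ (i.+1 + j)))); last first.
  by rewrite addSn exprS exprMn le_eqVlt; apply/orP; left; apply/eqP; ring.
apply: ler_pM => //; apply: le_trans (natr_le_exp2S _) _.
by rewrite ler_eXn2l ?ltr1n// leq_addr.
Qed.

(** The factor r^2 on the left avoids the exponent i - 2. In the induction the remainder is
    multiplied by x + h and gains i h^2 x^(i-1); the bound closes because i^2 + i <= (i+1)^2. *)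
Lemma power_taylor_bound (r x h : K) i : 0 < r -> `|x| <= r -> `|x + h| <= r ->
  r ^+ 2 * `|(x + h) ^+ i - x ^+ i - i%:R * h * x ^+ i.-1| <=
  i%:R ^+ 2 * `|h| ^+ 2 * r ^+ i.
Proof.
move=> r0 xr xhr; elim: i => [|i IHi].
  by rewrite !expr0 subrr !mul0r subrr normr0 mulr0 expr0n/= !mul0r.
have -> : (x + h) ^+ i.+1 - x ^+ i.+1 - i.+1%:R * h * x ^+ i.+1.-1 =
    (x + h) * ((x + h) ^+ i - x ^+ i - i%:R * h * x ^+ i.-1) + i%:R * h ^+
      2 * x ^+ i.-1.
  by case: i {IHi} => [|i]; rewrite /= ?exprS ?expr0 -?natr1; ring.
apply: le_trans (_ : r * (i%:R ^+ 2 * `|h| ^+ 2 * r ^+ i) + i%:R * `|h| ^+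
  2 * r ^+ i.+1 <= _); last first.
  rewrite [r ^+ i.+1]exprS (_ : _ + _ = (i%:R ^+ 2 + i%:R) * (`|h| ^+
    2 * (r * r ^+ i))); last by ring.
  rewrite -[leRHS]mulrA ler_wpM2r// ?mulr_ge0 ?exprn_ge0 ?(ltW r0)//.
  by rewrite -!natrX -natrD ler_nat; lia.
rewrite -[leLHS]/(_ * _); apply: le_trans (_ : _ <= r ^+ 2 * (`|x + h| * `|(x +
  h) ^+ i - x ^+ i - i%:R * h * x ^+ i.-1|
   + i%:R * `|h| ^+ 2 * `|x| ^+ i.-1)) _.
  rewrite ler_wpM2l ?exprn_ge0 ?(ltW r0)//; apply: le_trans (ler_normD _ _) _.
  by rewrite !normrM !normrX normr_nat.
rewrite mulrDr; apply: lerD.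
  rewrite mulrCA; apply: ler_pM => //; rewrite mulr_ge0// exprn_ge0 ?ltW//.
case: i {IHi} => [|i]; first by rewrite !mul0r mulr0.
rewrite mulrCA ler_wpM2l ?mulr_ge0 ?exprn_ge0//=.
by rewrite -[leRHS]/(r ^+ (2 + i)) exprD ler_wpM2l ?exprn_ge0
  ?(ltW r0)// lerXn2r// nnegrE ltW.
Qed.

Lemma pseries_taylor a C M : tame a C M -> exists r D, [/\ 0 < r, 0 <= D &
  forall x h y, `|x| <= r -> `|x + h| <= r -> `|y| <= r ->
  `|pseries a (x + h, y) - pseries a (x, y) - h * pseries (series_dx a) (x, y)|
    <= D * `|h| ^+ 2].
Proof.
move=> aC; have [C0 M0 aM] := aC; have da := tame_dx aC.
(* The factor 4 covers the bound 2 M of the derived series and absorbs i^2 <= 4^i in the Taylor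
   remainders. *)
pose r := theta / (4 * M).
have r0 : 0 < r by rewrite divr_gt0// mulr_gt0.
have rE : 4 * M * r = theta by rewrite /r mulrC divfK// mulf_neq0// lt0r_neq0.
have r_ge0 := ltW r0; clearbody r.
exists r, (4 * (C / r ^+ 2)); split=> // [|x h y xr xhr yr].
  by rewrite mulr_ge0// divr_ge0// exprn_ge0// ltW.
have rM z : `|z.1| <= r -> `|z.2| <= r -> small_at M z /\ small_at (2 * M) z.
  move=> zr1 zr2; have H : small_at (4 * M) z.
    by split; rewrite -rE mulrC ler_wpM2l// ltW// mulr_gt0.
  split; apply: smallW H; first by rewrite ler_peMl ?ltW// ltr1n.
  by rewrite ler_wpM2r ?ltW// ltr_nat.
have [sxh _] := rM (x + h, y) xhr yr; have [sx s2x] := rM (x, y) xr yr.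
(* The remainder is the sum of one double series, made of the remainders of the monomials. It
   suffices to bound these termwise; [sums_bound] supplies the factor 4 of the constant. *)
have := sumsB (sumsB (pseries_sums aC sxh) (pseries_sums aC sx))
  (@sumsZ h _ _ (sums_shift (geometric_monomials da s2x) (pseries_sums da
    s2x))).
rewrite -mulrA; apply: sums_bound => i j.
have -> : monomials a (x + h, y) i j - monomials a (x, y) i j -
   h * shift_rows (monomials (series_dx a) (x, y)) i j =
   a i j * y ^+ j * ((x + h) ^+ i - x ^+ i - i%:R * h * x ^+ i.-1).
  rewrite /shift_rows/monomials/series_dx; case: i => [|i]/=; last by ring.
  by rewrite !expr0; ring.
have rn0 : r != 0 by rewrite lt0r_neq0.
rewrite -(ler_pM2l (exprn_gt0 2 r0)) !normrM normrX mulrCA.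
rewrite [leRHS](_ : _ = C * (`|h| ^+ 2 * theta ^+ (i + j))); last by field.
apply: (@le_trans _ _ (C * M ^+ (i + j) * r ^+ j * (i%:R ^+ 2 * `|h| ^+ 2 * r ^+
  i))).
  rewrite ler_pM ?mulr_ge0 ?exprn_ge0 ?r_ge0//; last exact: power_taylor_bound.
  rewrite ler_pM ?exprn_ge0// lerXn2r// nnegrE ltW//.
rewrite -rE.
rewrite (_ : C * M ^+ (i + j) * _ * _ = C * (`|h| ^+ 2 * (i%:R ^+ 2 * (M * r) ^+
  (i + j)))); last first.
  by rewrite !exprD !exprMn; ring.
rewrite ler_wpM2l// ler_wpM2l ?exprn_ge0// -[4 * M * r]mulrA [leRHS]exprMn
  ler_wpM2r//.
  by rewrite exprn_ge0// mulr_ge0// ltW.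
apply: (@le_trans _ _ ((2 ^+ i) ^+ 2)).
  by rewrite lerXn2r ?nnegrE ?exprn_ge0// natr_le_exp2.
by rewrite exprAC -natrX ler_eXn2l ?ltr1n// leq_addr.
Qed.

(** In the Taylor estimate, one factor |h| of the remainder is at most r + r, and the derived series
    is at most 4 C M. *)
Lemma pseries_lipschitz_x a C M : tame a C M -> exists r L, [/\ 0 < r, 0 <= L &
  forall x x' y, `|x| <= r -> `|x'| <= r -> `|y| <= r ->
  `|pseries a (x', y) - pseries a (x, y)| <= L * `|x' - x|].
Proof.
move=> aC; have [r [D [r0 D0 aD]]] := pseries_taylor aC.
have [C0 M0 _] := aC; have da := tame_dx aC.
have M20 : 0 < 2 * M by rewrite mulr_gt0.
have d0 : 0 < theta / (2 * M) by rewrite divr_gt0.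
have [s [s0 sr sM]] := pos_min r0 d0.
exists s, (D * (r + r) + 4 * (C * M)); split=> //.
  by rewrite addr_ge0// !mulr_ge0// ?addr_ge0// ltW.
move=> x x' y xs x's ys; have /(_ x (x' - x) y) := aD.
rewrite [x + (x' - x)]addrC subrK => /(_ (le_trans xs sr) (le_trans x's sr)
  (le_trans ys sr)).
set Q := (_ * pseries _ _) => PQ.
rewrite -[X in `|X|](subrK Q); apply: le_trans (ler_normD _ _) _;
  rewrite mulrDl lerD//.
  apply: le_trans PQ _; rewrite expr2 mulrA ler_wpM2r// ler_wpM2l//.
  by apply: le_trans (ler_normB _ _) _; rewrite lerD// (le_trans _ sr).
rewrite normrM mulrC ler_wpM2r//.
have sz : small_at (2 * M) (x, y).
  by split=> /=; rewrite -ler_pdivlMr// (le_trans _ sM).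
exact: sums_bound (geometric_monomials da sz) (pseries_sums da sz).
Qed.

Lemma tame_tr a C M : tame a C M -> tame (fun i j => a j i) C M.
Proof. by move=> [C0 M0 aC]; split=> // i j; rewrite addnC. Qed.

(** Squares are symmetric, so each statement about y follows from the one about x. *)
Lemma pseries_tr a z : pseries (fun i j => a j i) (z.2, z.1) = pseries a z.
Proof.
rewrite /pseries; congr (lim (_ @ \oo)); apply/funext => n.
rewrite /square_sum exchange_big; apply: eq_bigr => i _; apply: eq_bigr => j _.
by rewrite /monomials/= mulrAC.
Qed.

Lemma pseries_is_derive_x a C M : tame a C M -> \forall z \near (0 : K * K),
  is_derive z ((1, 0) : K * K) (pseries a) (pseries (series_dx a) z).
Proof.
move=> aC; have [r [D [r0 D0 aD]]] := pseries_taylor aC.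
have r20 : 0 < r / 2 by rewrite divr_gt0.
have r2r : r / 2 <= r by rewrite ler_pdivrMr// ler_peMr ?ler1n// ltW.
apply/nbhs_norm0P; exists (r / 2) => // -[x y] /= xyr.
have xr := le_lt_trans (norm_fst_le (x, y)) xyr.
have yr := le_lt_trans (norm_snd_le (x, y)) xyr.
apply: (is_derive_quadratic r20 D0) => h hr.
rewrite (_ : h *: (1, 0) + (x, y) = (x + h, y)); last first.
  by congr (_, _); rewrite /= ?scaler0 ?add0r// [_ *: _]mulr1 addrC.
apply: aD.
- exact: le_trans (ltW xr) r2r.
- by rewrite (le_trans (ler_normD _ _))// [leRHS](splitr r) lerD// ltW.
- exact: le_trans (ltW yr) r2r.
Qed.

Lemma near0_swap (P : K * K -> Prop) : (\forall z \near (0 : K * K), P z) ->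
  \forall z \near (0 : K * K), P (z.2, z.1).
Proof.
move=> /nbhs_norm0P[e e0 eP]; apply/nbhs_norm0P; exists e => // z /= ze.
apply: eP; rewrite /= prod_normE/= comparable_gt_max ?real_comparable
  ?normr_real//.
by rewrite (le_lt_trans (norm_snd_le z) ze) (le_lt_trans (norm_fst_le z) ze).
Qed.

Definition series_dy a i j : K := j.+1%:R * a i j.+1.

Lemma pseries_is_derive_y a C M : tame a C M -> \forall z \near (0 : K * K),
  is_derive z ((0, 1) : K * K) (pseries a) (pseries (series_dy a) z).
Proof.
move=> aC; have := near0_swap (pseries_is_derive_x (tame_tr aC)).
apply: filterS => -[x y]/= [dT vT].
have E : (fun h : K => h^-1 *: ((pseries a \o +%R^~ (x, y)) (h *: (0, 1))
  - pseries a (x, y))) =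
  (fun h => h^-1 *: ((pseries (fun i j => a j i) \o +%R^~ (y, x)) (h *: (1, 0))
    -
    pseries (fun i j => a j i) (y, x))).
  by apply/funext => h; rewrite /= -(pseries_tr a (x, y)) -(pseries_tr a (_ +
    _)).
apply: DeriveDef; first by rewrite /derivable E.
by move: vT; rewrite /derive E => ->; rewrite -(pseries_tr (series_dy a) (x,
  y)).
Qed.

Lemma tame_dy a C M : tame a C M -> tame (series_dy a) (C * M) (2 * M).
Proof. by move=> aC; exact: tame_tr (tame_dx (tame_tr aC)). Qed.

Lemma pseries_dx a C M : tame a C M ->
  germ_eq (dx (pseries a)) (pseries (series_dx a)).
Proof.
move=> aC; nearby (pseries_is_derive_x aC); at_point z => d.
by rewrite /dx derive_val.
Qed.

Lemma pseries_dy a C M : tame a C M ->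
  germ_eq (dy (pseries a)) (pseries (series_dy a)).
Proof.
move=> aC; nearby (pseries_is_derive_y aC); at_point z => d.
by rewrite /dy derive_val.
Qed.

Lemma pseries_derivable a C M : tame a C M ->
  \forall z \near (0 : K * K), derivable_xy (pseries a) z.
Proof.
move=> aC; nearby (pseries_is_derive_x aC); nearby (pseries_is_derive_y aC).
by at_point z => dy_ dx_; split; exact: ex_derive.
Qed.

Lemma pseries_continuous a C M : tame a C M ->
  \forall z \near (0 : K * K), {for z, continuous (pseries a)}.
Proof.
move=> aC; have [r1 [L1 [r10 L10 aL1]]] := pseries_lipschitz_x aC.
have [r2 [L2 [r20 L20 aL2]]] := pseries_lipschitz_x (tame_tr aC).
have [r [r0 rr1 rr2]] := pos_min r10 r20.
have rh0 : 0 < r / 2 by rewrite divr_gt0.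
apply/nbhs_norm0P; exists (r / 2) => // -[x y] /= xyr.
have xr := ltW (le_lt_trans (norm_fst_le (x, y)) xyr).
have yr := ltW (le_lt_trans (norm_snd_le (x, y)) xyr).
apply: (continuous_lipschitz rh0 (addr_ge0 L10 L20)) => -[x' y'] zr.
have hr : r / 2 <= r by rewrite ler_pdivrMr// ler_peMr ?ler1n// ltW.
have x'r : `|x'| <= r.
  rewrite -(subrK x x') (le_trans (ler_normD _ _))// [leRHS]splitr lerD//.
  exact: le_trans (norm_fst_le ((x', y') - (x, y))) zr.
have y'r : `|y'| <= r.
  rewrite -(subrK y y') (le_trans (ler_normD _ _))// [leRHS]splitr lerD//.
  exact: le_trans (norm_snd_le ((x', y') - (x, y))) zr.
rewrite -(subrKA (pseries a (x, y'))) (le_trans (ler_normD _ _))// mulrDl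
  lerD//.
  apply: le_trans (aL1 x x' y' _ _ _) _.
  - exact: le_trans (le_trans xr hr) rr1.
  - exact: le_trans x'r rr1.
  - exact: le_trans y'r rr1.
  by rewrite ler_wpM2l// (norm_fst_le ((x', y') - (x, y))).
rewrite -(pseries_tr a (x, y')) -(pseries_tr a (x, y)).
apply: le_trans (aL2 y y' x _ _ _) _.
- exact: le_trans (le_trans yr hr) rr2.
- exact: le_trans y'r rr2.
- exact: le_trans (le_trans xr hr) rr2.
by rewrite ler_wpM2l// (norm_snd_le ((x', y') - (x, y))).
Qed.

Lemma pseries_at0 a : pseries a 0 = a 0%N 0%N.
Proof.
apply: pseriesE; rewrite /sums -cvg_shiftS.
rewrite (_ : (fun n => _) = fun=> a 0%N 0%N); first exact: cvg_cst.
have E i j : monomials a 0 i j = if (i == 0) && (j == 0) then a 0%N 0%N else 0.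
  by case: i => [|i]; case: j => [|j];
    rewrite /monomials/= ?expr0n/= ?mulr1 ?mulr0 ?mul0r.
apply/funext => n; rewrite /square_sum big_ord_recl/= big_ord_recl/= E/=.
rewrite big1 => [|i _]; last by rewrite E.
by rewrite big1 ?addr0// => i _; rewrite big1// => j _; rewrite E.
Qed.

(** Each differentiation brings a coefficient one step closer to the constant term, which is the
    value at 0; the factors i + 1 and j + 1 are invertible. *)
Lemma pseries_inj a C M : tame a C M -> germ_eq (pseries a) (fun=> 0) ->
  forall i j, a i j = 0.
Proof.
move=> + + i; elim: i a C M => [|i IHi] a C M aC a0 j.
  elim: j a C M aC a0 => [|j IHj] a C M aC a0.
    by rewrite -pseries_at0; exact: nbhs_singleton a0.
  have H : series_dy a 0%N j = 0.
    apply: (IHj _ _ _ (tame_dy aC)).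
    nearby (pseries_dy aC); nearby (germ_eq_dy a0); at_point z => -> <-.
    by have [_ _ ->] := has_partials_cst (0 : K) z.
  by move: H => /eqP; rewrite /series_dy mulf_eq0 pnatr_eq0/= => /eqP.
have H : series_dx a i j = 0.
  apply: (IHi _ _ _ (tame_dx aC)).
  nearby (pseries_dx aC); nearby (germ_eq_dx a0); at_point z => -> <-.
  by have [_ -> _] := has_partials_cst (0 : K) z.
by move: H => /eqP; rewrite /series_dx mulf_eq0 pnatr_eq0/= => /eqP.
Qed.

(** * Algebra of power series and the Euler operator on coefficients *)

Lemma tameD a b C M C' M' : tame a C M -> tame b C' M' ->
  tame (fun i j => a i j + b i j) (C + C') (M + M').
Proof.
move=> aC bC; have [C0 M0 _] := aC; have [C'0 M'0 _] := bC.
have [_ _ aM] : tame a C (M + M') by apply: tameW aC => //; rewrite lerDl ltW.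
have [_ _ bM] : tame b C' (M + M') by apply: tameW bC => //; rewrite lerDr ltW.
split; [exact: addr_ge0 | exact: addr_gt0 | move=> i j].
by rewrite (le_trans (ler_normD _ _))// mulrDl lerD.
Qed.

Lemma pseriesD a b C M C' M' : tame a C M -> tame b C' M' ->
  germ_eq (pseries (fun i j => a i j + b i j)) (fun z =>
    pseries a z + pseries b z).
Proof.
move=> aC bC; have M0 : 0 < M by case: aC. have M'0 : 0 < M' by case: bC.
nearby (near_small M0); nearby (near_small M'0); at_point z => zM' zM.
apply: pseriesE; have := sumsD (pseries_sums aC zM) (pseries_sums bC zM').
by congr (sums _ _); apply/funext => i; apply/funext => j; rewrite /monomials;
  ring.
Qed.

(** The (i+1)(j+1) terms of a coefficient are absorbed by 2^(i+j), whence the doubled rate. *)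
Lemma tame_conv a b C M C' M' : tame a C M -> tame b C' M' ->
  tame (cauchy_product a b) (C * C') (2 * (M + M')).
Proof.
move=> aC bC; have [C0 M0 _] := aC; have [C'0 M'0 _] := bC.
have [_ N0 aM] : tame a C (M + M') by apply: tameW aC => //; rewrite lerDl ltW.
have [_ _ bM] : tame b C' (M + M') by apply: tameW bC => //; rewrite lerDr ltW.
split; [exact: mulr_ge0 | by rewrite mulr_gt0 | move=> i j].
set N := M + M' in N0 aM bM *.
apply: (@le_trans _ _ (i.+1%:R * (j.+1%:R * (C * C' * N ^+ (i + j))))).
  apply: norm_sum_le => i1; apply: norm_sum_le => j1; rewrite normrM.
  apply: (@le_trans _ _ (C * N ^+ (i1 + j1) * (C' * N ^+ (i - i1 + (j - j1))))).
    by rewrite ler_pM.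
  rewrite mulrACA -exprD (_ : (i1 + j1 + _ = i + j)%N)//.
  by have := ltn_ord i1; have := ltn_ord j1; lia.
rewrite [leRHS](_ : _ = 2 ^+ i * (2 ^+ j * (C * C' * N ^+ (i + j))));
  last first.
  by rewrite exprMn !exprD; ring.
have Q0 : 0 <= C * C' * N ^+ (i + j) by rewrite !mulr_ge0// exprn_ge0// ltW.
have jQ : j.+1%:R * (C * C' * N ^+ (i + j)) <= 2 ^+ j * (C * C' * N ^+ (i + j)).
  by apply: ler_wpM2r => //; exact: natr_le_exp2S.
by apply: ler_pM => //; [exact: mulr_ge0 | exact: natr_le_exp2S].
Qed.

Lemma pseriesM a b C M C' M' : tame a C M -> tame b C' M' ->
  germ_eq (pseries (cauchy_product a b)) (fun z => pseries a z * pseries b z).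
Proof.
move=> aC bC; have M0 : 0 < M by case: aC. have M'0 : 0 < M' by case: bC.
nearby (near_small M0); nearby (near_small M'0); at_point z => zM' zM.
apply: pseriesE.
have := sumsM (geometric_monomials aC zM) (geometric_monomials bC zM')
  (pseries_sums aC zM) (pseries_sums bC zM').
congr (sums _ _); apply/funext => i; apply/funext => j.
rewrite /cauchy_product /monomials !mulr_suml; apply: eq_bigr => i1 _.
rewrite !mulr_suml; apply: eq_bigr => j1 _.
have i1i : (i1 <= i)%N by rewrite -ltnS.
have j1j : (j1 <= j)%N by rewrite -ltnS.
have -> : z.1 ^+ i = z.1 ^+ i1 * z.1 ^+ (i - i1) by rewrite -exprD subnKC.
have -> : z.2 ^+ j = z.2 ^+ j1 * z.2 ^+ (j - j1) by rewrite -exprD subnKC.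
by ring.
Qed.

Lemma tameZ (s : nat -> nat -> K) a C M : (forall i j, `|s i j| <= 1) ->
  tame a C M -> tame (fun i j => s i j * a i j) C M.
Proof.
move=> s1 [C0 M0 aC]; split=> // i j; rewrite normrM.
by apply: le_trans (aC i j); rewrite ler_piMl.
Qed.

(** Multiplication by x is the row shift, which moves the coefficient (i+1) a_(i+1, j) of the
    derivative back to row i + 1. *)
Lemma pseries_x_dx a C M : tame a C M ->
  tame (fun i j => i%:R * a i j) C (2 * M) /\
  germ_eq (pseries (fun i j => i%:R * a i j)) (fun z => z.1 * dx (pseries a) z).
Proof.
move=> aC; have [C0 M0 aM] := aC; have da := tame_dx aC; split.
  split=> // [|i j]; first by rewrite mulr_gt0.
  rewrite normrM normr_nat exprMn mulrCA ler_pM//.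
  by rewrite (le_trans (natr_le_exp2 _))// ler_eXn2l ?ltr1n// leq_addr.
have M20 : 0 < 2 * M by rewrite mulr_gt0.
nearby (near_small M20); nearby (pseries_dx aC); at_point z => -> sz.
apply: pseriesE.
pose u i j := z.1 * monomials (series_dx a) z i j.
have uC : decays u (`|z.1| * (C * M)).
  by move=> i j; rewrite normrM -mulrA ler_wpM2l// (geometric_monomials da sz).
have := sums_shift uC (@sumsZ z.1 _ _ (pseries_sums da sz)).
congr (sums _ _); apply/funext => -[|i]; apply/funext => j.
  by rewrite /shift_rows/monomials !mul0r.
by rewrite /shift_rows/u/monomials/series_dx exprS; ring.
Qed.

Lemma pseries_y_dy a C M : tame a C M ->
  tame (fun i j => j%:R * a i j) C (2 * M) /\
  germ_eq (pseries (fun i j => j%:R * a i j)) (fun z => z.2 * dy (pseries a) z).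
Proof.
move=> aC; have [T E] := pseries_x_dx (tame_tr aC).
split; first exact: tame_tr T.
nearby (near0_swap E); nearby (pseries_dy aC).
nearby (near0_swap (pseries_dx (tame_tr aC))); at_point z => /= Dx -> Ez.
by rewrite -(pseries_tr (series_dy a)) -pseries_tr Ez Dx.
Qed.

Lemma pseriesZ c a C M : tame a C M ->
  exists C', tame (fun i j => c * a i j) C' M /\
    germ_eq (pseries (fun i j => c * a i j)) (fun z => c * pseries a z).
Proof.
move=> aC; have [C0 M0 aM] := aC; exists (`|c| * C); split.
  by split=> // [|i j]; rewrite ?mulr_ge0// normrM -mulrA ler_wpM2l.
nearby (near_small M0); at_point z => zM.
apply: pseriesE; have := @sumsZ c _ _ (pseries_sums aC zM).
by congr (sums _ _); apply/funext => i; apply/funext => j; rewrite /monomials;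
  ring.
Qed.

Lemma euler_pseries (w1 w2 k : nat) a C M : tame a C M ->
  exists C' M', tame (fun i j => (w1 * i + w2 * j + k)%:R * a i j) C' M' /\
    germ_eq (pseries (fun i j => (w1 * i + w2 * j + k)%:R * a i j))
      (fun z => lie (euler K w1 w2) (pseries a) z + k%:R * pseries a z).
Proof.
move=> aC; have [T1 E1] := pseries_x_dx aC; have [T2 E2] := pseries_y_dy aC.
have [C1 [T1' E1']] := pseriesZ w1%:R T1.
have [C2 [T2' E2']] := pseriesZ w2%:R T2.
have [C3 [T3' E3']] := pseriesZ k%:R aC.
have T := tameD (tameD T1' T2') T3'.
have TE : (fun i j => (w1 * i + w2 * j + k)%:R * a i j) = (fun i j =>
    w1%:R * (i%:R * a i j) + w2%:R * (j%:R * a i j) + k%:R * a i j).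
  by apply/funext => i; apply/funext => j; rewrite !natrD !natrM; ring.
rewrite TE; do 2 eexists; split; first exact: T.
nearby E1; nearby E2; nearby E1'; nearby E2'; nearby E3'.
nearby (pseriesD T1' T2'); nearby (pseriesD (tameD T1' T2') T3').
at_point z => -> -> -> -> -> -> ->.
by rewrite /lie/=; ring_partials.
Qed.

Lemma series_ext f g : is_series f -> germ_eq f g -> is_series g.
Proof.
move=> [a [C [M [aC fE]]]] fg; exists a, C, M; split=> //.
by nearby fE; nearby fg; at_point z => <-.
Qed.

Lemma near_axes (P : K * K -> Prop) (a b : nat) : (\forall z \near (0 : K * K),
  P z) ->
  \forall z \near (0 : K * K), P (0 ^+ a * z.1, 0 ^+ b * z.2).
Proof.
move=> /nbhs_norm0P[e e0 eP]; apply/nbhs_norm0P; exists e => // z /= ze.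
have H n (x : K) : `|x| < e -> `|0 ^+ n * x| < e.
  by case: n => [|n] xe; rewrite expr0n/= ?mul1r// mul0r normr0.
apply: eP; rewrite /= prod_normE/= comparable_gt_max ?real_comparable
  ?normr_real//.
by rewrite !H// (le_lt_trans (norm_fst_le z) ze, le_lt_trans (norm_snd_le z)
  ze).
Qed.

Lemma series_cst c : is_series (fun=> c).
Proof.
pose a (i j : nat) : K := if (i == 0%N) && (j == 0%N) then c else 0.
have aC : tame a `|c| 1.
  split=> // i j; rewrite expr1n mulr1 /a.
  by case: ifP => // _; rewrite normr0.
exists a, `|c|, 1; split=> //.
at_point z; symmetry; apply: pseriesE; rewrite /sums -cvg_shiftS.
rewrite (_ : (fun n => _) = fun=> c); first exact: cvg_cst.
apply/funext => n; rewrite /square_sum big_ord_recl/= big_ord_recl/=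
  {1}/monomials !mulr1.
rewrite big1 => [|i _]; last by rewrite /monomials/= !mul0r.
by rewrite big1 ?addr0// => i _; rewrite big1// => j _; rewrite /monomials/=
  !mul0r.
Qed.

Lemma series_fst : is_series (fun z => z.1).
Proof.
pose a (i j : nat) : K := if (i == 1%N) && (j == 0%N) then 1 else 0.
have aC : tame a 1 1.
  split=> // i j; rewrite expr1n mulr1 /a.
  by case: ifP => // _; rewrite ?normr0 ?normr1.
exists a, 1, 1; split=> //.
(* Only squares of side at least 2 contain the index (1, 0). *)
at_point z; symmetry; apply: pseriesE; rewrite /sums -2!cvg_shiftS.
rewrite (_ : (fun n => _) = fun=> z.1); first exact: cvg_cst.
have E i j : monomials a z i j = if (i == 1%N) && (j == 0%N) then z.1 else 0.
  rewrite /monomials /a; case: ifP => [/andP[/eqP -> /eqP ->]|_].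
    by rewrite expr1 mulr1 mul1r.
  by rewrite !mul0r.
apply/funext => n; rewrite /square_sum.
rewrite /=.
rewrite (bigD1 (lift ord0 ord0))//= (bigD1 ord0)//= E/= big1 => [|j j0];
  last first.
  by rewrite E/= (_ : (j : nat) == 0%N = false)//; apply: negbTE.
rewrite addr0 big1 ?addr0// => i i1; rewrite big1// => j _.
by rewrite E (_ : (i : nat) == 1%N = false)//; apply: negbTE.
Qed.

Lemma series_snd : is_series (fun z => z.2).
Proof.
have [a [C [M [aC aE]]]] := series_fst.
exists (fun i j => a j i), C, M; split; first exact: tame_tr.
by nearby (near0_swap aE); at_point z => /= ->; rewrite -pseries_tr.
Qed.

Lemma analytic_germ_class : germ_class (@analytic_germ K).
Proof.
suff : germ_class is_series.
  by congr germ_class; apply/funext => f; apply/propext; split=>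
    /analytic_germP.
split.
- exact: series_ext.
- exact: series_cst.
- exact: series_fst.
- exact: series_snd.
- move=> f g [a [C [M [aC fE]]]] [b [C' [M' [bC gE]]]].
  do 3 eexists; split; first exact: tameD aC bC.
  by nearby fE; nearby gE; nearby (pseriesD aC bC); at_point z => -> -> ->.
- move=> f g [a [C [M [aC fE]]]] [b [C' [M' [bC gE]]]].
  do 3 eexists; split; first exact: tame_conv aC bC.
  by nearby fE; nearby gE; nearby (pseriesM aC bC); at_point z => -> -> ->.
- move=> f [a [C [M [aC fE]]]].
  nearby (pseries_continuous aC); nearby (near_germ_eq fE); at_point z => fz cz.
  have ez := nbhs_singleton fz.
  suff : f @ z --> pseries a z by rewrite -ez.
  by apply: cvg_trans cz; apply: near_eq_cvg; apply: filterS fz => w ->.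
- move=> f [a [C [M [aC fE]]]].
  nearby (pseries_derivable aC); nearby (near_germ_eq fE); at_point z =>
    fz [d1 d2].
  have fz' : {near z, pseries a =1 f} by apply: filterS fz => w ->.
  by split; [exact: near_eq_derivable fz' d1 | exact: near_eq_derivable fz' d2].
- move=> f [a [C [M [aC fE]]]]; exists (series_dx a), (C * M), (2 * M).
  split; first exact: tame_dx.
  by nearby (germ_eq_dx fE); nearby (pseries_dx aC); at_point z => -> ->.
- move=> f [a [C [M [aC fE]]]]; exists (series_dy a), (C * M), (2 * M).
  split; first exact: tame_dy.
  by nearby (germ_eq_dy fE); nearby (pseries_dy aC); at_point z => -> ->.
- move=> f [a [C [M [aC fE]]]].
  nearby (germ_eq_dx (germ_eq_dy fE)); nearby (germ_eq_dy (germ_eq_dx fE)).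
  nearby (germ_eq_dx (pseries_dy aC)); nearby (germ_eq_dy (pseries_dx aC)).
  nearby (pseries_dx (tame_dy aC)); nearby (pseries_dy (tame_dx aC)).
  at_point z => E1 E2 E3 E4 E5 E6; rewrite E6 E4 E2 E5 E3 E1.
  congr (pseries _ z); apply/funext => i; apply/funext => j.
  by rewrite /series_dx/series_dy mulrCA.
- move=> w1 w2 k f k0 [a [C [M [aC fE]]]].
  (* W + k is diagonal on monomials. As k > 0, its eigenvalues are at least 1, so dividing by them
     preserves the coefficient bounds. *)
  pose s (i j : nat) : K := (w1 * i + w2 * j + k)%:R^-1.
  have s1 i j : `|s i j| <= 1.
    rewrite normfV normr_nat invf_le1 ?ler1n ?ltr0n; lia.
  have sC := tameZ s1 aC.
  have [C' [M' [T E]]] := euler_pseries w1 w2 k sC.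
  exists (pseries (fun i j => s i j * a i j)).
    by exists (fun i j => s i j * a i j), C, M; split=> //; at_point z.
  nearby E; nearby fE; at_point z => -> <-; congr (pseries _ z).
  apply/funext => i; apply/funext => j; rewrite mulVKf// pnatr_eq0; lia.
- move=> w1 w2 u [a [C [M [aC uE]]]] Wu.
  have [C' [M' [T E]]] := euler_pseries w1 w2 0 aC.
  have a0 i j : (w1 * i + w2 * j + 0)%:R * a i j = 0.
    apply: (pseries_inj T); nearby E; nearby Wu.
    nearby (germ_eq_dx uE); nearby (germ_eq_dy uE).
    at_point z => uy ux <- ->.
    by rewrite mul0r addr0 /lie ux uy.
  nearby uE; nearby (near_axes w1 w2 uE); at_point z => -> ->.
  rewrite /pseries; congr (lim (_ @ \oo)); apply/funext => n.
  apply: eq_bigr => i _; apply: eq_bigr => j _; rewrite /monomials/=.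
  (* A surviving monomial has w1 i = w2 j = 0: in each variable the weight or the exponent is 0, and
     either way the factor 0^w does not change the monomial. *)
  have [->|an0] := eqVneq (a i j) 0; first by rewrite !mul0r.
  have /eqP := a0 i j; rewrite mulf_eq0 (negPf an0) orbF pnatr_eq0 !addn_eq0
    !muln_eq0.
  rewrite eqxx andbT => /andP[/orP[]/eqP-> /orP[]/eqP->];
    by rewrite ?expr0 ?mulr1 ?mul1r.
Qed.

End AnalyticGerms.

(** * The Archimedean property and completeness of the real and complex fields *)

Section ScalarFields.
Variable R : realType.

Lemma real_half_exp_small (e : R) : 0 < e -> exists n, 2^-1 ^+ n < e.
Proof.
move=> e0; exists (Num.bound e^-1); rewrite exprVn invf_plt ?posrE ?exprn_gt0//.
apply: lt_le_trans (archi_boundP _) (natr_le_exp2 _ _).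
by rewrite invr_ge0 ltW.
Qed.

(** The sequence is its first term plus the partial sums of its increments, an absolutely convergent
    series. *)
Lemma real_geometric_cvg (s : nat -> R) (C : R) :
  (forall n, `|s n.+1 - s n| <= C * 2^-1 ^+ n) -> exists l : R, s @ \oo --> l.
Proof.
move=> sC; pose u n := s n.+1 - s n.
have /cvg_ex[l ul] : cvgn (series u).
  apply: normed_cvg; apply: (@series_le_cvg _ _ (geometric C 2^-1)) => //.
  - by move=> n; exact: normr_ge0.
  - by move=> n /=; exact: le_trans (normr_ge0 _) (sC n).
  by apply: is_cvg_geometric_series; rewrite ger0_norm ?invr_ge0// invf_lt1//
    ltr1n.
exists (s 0%N + l).
have : (fun n => s 0%N + series u n) @ \oo --> s 0%N + l.
  by apply: cvgD => //; exact: cvg_cst.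
rewrite (_ : (fun n => s 0%N + series u n) = s)//; apply/funext => n.
by rewrite /series/= /u telescope_sumr// addrC subrK.
Qed.

Lemma complex_half_exp_small (e : R[i]) : 0 < e -> exists n, 2^-1 ^+ n < e.
Proof.
move=> e0; have er : (complex.Re e)%:C%C = e by rewrite RRe_real// gtr0_real.
move: e0; rewrite -er ltcR => /real_half_exp_small[n ne].
exists n; rewrite (_ : 2^-1 ^+ n = (2^-1 ^+ n)%:C%C) ?ltcR//.
by rewrite rmorphXn/= fmorphV rmorph_nat.
Qed.

Lemma norm_Re_le (z : R[i]) : `|complex.Re z| <= complex.Re `|z|.
Proof. by have := normc_ge_Re z; rewrite normc_def lecR. Qed.

Lemma norm_Im_le (z : R[i]) : `|complex.Im z| <= complex.Re `|z|.
Proof.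
by rewrite normc_def/= -sqrtr_sqr ler_wsqrtr// lerDr sqr_ge0.
Qed.

Lemma norm_complex_le (z : R[i]) : `|z| <= (`|complex.Re z| + `|complex.Im
  z|)%:C%C.
Proof.
rewrite normc_def lecR -(ger0_norm (addr_ge0 (normr_ge0 _) (normr_ge0 _)))
  -sqrtr_sqr.
rewrite ler_wsqrtr// sqrrD !real_normK ?num_real// -addrA lerD2l lerDr.
by rewrite mulrn_wge0// mulr_ge0.
Qed.

Let complexes : numFieldType := R[i].

Lemma complex_geometric_cvg (s : nat -> complexes) (C : complexes) :
  (forall n, `|s n.+1 - s n| <= C * 2^-1 ^+ n) ->
  exists l : complexes, s @ \oo --> l.
Proof.
move=> sC; have C0 : 0 <= C by have := sC 0%N; rewrite expr0 mulr1;
  apply: le_trans.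
have CE : (complex.Re C)%:C%C = C by rewrite RRe_real// ger0_real.
have bound n : complex.Re `|s n.+1 - s n| <= complex.Re C * 2^-1 ^+ n.
  rewrite -lecR RRe_real ?normr_real// rmorphM/= CE rmorphXn/=
    fmorphV rmorph_nat.
  exact: sC.
have [a sa] : exists a : R, (fun n => complex.Re (s n)) @ \oo --> a.
  apply: (@real_geometric_cvg _ (complex.Re C)) => n.
  by rewrite -raddfB; apply: le_trans (norm_Re_le _) (bound n).
have [b sb] : exists b : R, (fun n => complex.Im (s n)) @ \oo --> b.
  apply: (@real_geometric_cvg _ (complex.Re C)) => n.
  by rewrite -raddfB; apply: le_trans (norm_Im_le _) (bound n).
exists (a +i* b)%C; apply/cvgrPdist_lt => e e0.
have er : (complex.Re e)%:C%C = e by rewrite RRe_real// gtr0_real.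
have r0 : 0 < complex.Re e / 2 by rewrite divr_gt0// -ltcR er.
move/cvgrPdist_lt : sa => /(_ _ r0) sa; move/cvgrPdist_lt : sb => /(_ _ r0) sb.
near=> n; apply: le_lt_trans (norm_complex_le _) _;
  rewrite -er ltcR [ltRHS]splitr.
apply: ltrD.
- by rewrite (_ : complex.Re _ = a - complex.Re (s n)); [near: n | case: (s n)].
- by rewrite (_ : complex.Im _ = b - complex.Im (s n)); [near: n | case: (s n)].
Unshelve. all: by end_near. Qed.

End ScalarFields.

(** * Smooth germs *)

Section SmoothGerms.
Variable R : realType.
Implicit Types (f g u : scalar R) (z w : R * R) (r : R).

Definition box r z := `|z.1| < r /\ `|z.2| < r.
Definition cbox r z := `|z.1| <= r /\ `|z.2| <= r.

Lemma near_box r z : box r z -> \forall w \near z, box r w.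
Proof.
move=> [z1 z2]; have e1 : 0 < r - `|z.1| by rewrite subr_gt0.
have e2 : 0 < r - `|z.2| by rewrite subr_gt0.
have [e [e0 ee1 ee2]] := pos_min e1 e2.
apply/nbhs_normP; exists e => // w /=; rewrite /ball_/= distrC => wz.
split.
- rewrite -(subrK z.1 w.1) (le_lt_trans (ler_normD _ _))// -ltrBrDr.
  by apply: lt_le_trans ee1; apply: le_lt_trans wz;
    exact: (norm_fst_le (w - z)).
- rewrite -(subrK z.2 w.2) (le_lt_trans (ler_normD _ _))// -ltrBrDr.
  by apply: lt_le_trans ee2; apply: le_lt_trans wz;
    exact: (norm_snd_le (w - z)).
Qed.

Lemma near0_boxP (P : R * R -> Prop) : (\forall z \near (0 : R * R), P z) <->
  exists2 r, 0 < r & forall z, box r z -> P z.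
Proof.
split=> [/nbhs_norm0P[e e0 eP]|[r r0 rP]].
  exists e => // z [z1 z2]; apply: eP => /=.
  by rewrite prod_normE/= gt_max z1 z2.
apply/nbhs_norm0P; exists r => // z /= zr; apply: rP; split.
- exact: le_lt_trans (norm_fst_le z) zr.
- exact: le_lt_trans (norm_snd_le z) zr.
Qed.

Definition smooth_on r f := forall z, box r z -> forall s : seq bool,
  {for z, continuous (iter_partial s f)} /\ derivable_xy (iter_partial s f) z.

Lemma smooth_germP f : smooth_germ f <-> exists2 r, 0 < r & smooth_on r f.
Proof.
rewrite /smooth_germ/=; split=> [/near0_boxP[r r0 rf]|[r r0 rf]].
  exists r; first exact: r0.
  by move=> z /rf fz s; have [c dx_ dy_] := fz s; exact (conj c (conj dx_ dy_)).
apply/near0_boxP; exists r; first exact: r0.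
by move=> z /rf fz s; have [c [dx_ dy_]] := fz s; exact (And3 c dx_ dy_).
Qed.

Lemma smooth_onW r r' f : r' <= r -> smooth_on r f -> smooth_on r' f.
Proof.
move=> rr' fr z [z1 z2]; apply: fr; split; exact: lt_le_trans rr'.
Qed.

Lemma smooth_on_dx r f : smooth_on r f -> smooth_on r (dx f).
Proof. by move=> fr z zr s; have := fr z zr (rcons s true);
  rewrite /iter_partial foldr_rcons. Qed.

Lemma smooth_on_dy r f : smooth_on r f -> smooth_on r (dy f).
Proof. by move=> fr z zr s; have := fr z zr (rcons s false);
  rewrite /iter_partial foldr_rcons. Qed.

Lemma smooth_on_continuous r f z : smooth_on r f -> box r z ->
  {for z, continuous f}.
Proof. by move=> fr /fr/(_ [::])[]. Qed.

Lemma smooth_on_derivable r f z : smooth_on r f -> box r z -> derivable_xy f z.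
Proof. by move=> fr /fr/(_ [::])[]. Qed.

(** A coinduction principle: exhibiting a class of functions stable under partial derivatives, up to
    equality on the box, avoids formulas for higher derivatives. *)
Lemma smooth_on_coind r (S : set (scalar R)) :
  (forall f, S f -> forall z, box r z -> {for z, continuous f} /\ derivable_xy f
    z) ->
  (forall f, S f -> exists2 g, S g & forall z, box r z -> dx f z = g z) ->
  (forall f, S f -> exists2 g, S g & forall z, box r z -> dy f z = g z) ->
  forall f, S f -> smooth_on r f.
Proof.
move=> Sreg Sdx Sdy f Sf z zr s.
have near_eq h g : (forall w, box r w -> h w = g w) ->
    forall w, box r w -> \forall w' \near w, h w' = g w'.
  by move=> hg w /near_box; apply: filterS => w' /hg.
have [g Sg fg] : exists2 g, S g & forall w, box r w -> iter_partial s f w = g w.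
  elim: s => [|b s [g Sg fg]]; first by exists f.
  case: b.
  - have [g' Sg' gg'] := Sdx g Sg; exists g' => // w wr.
    by rewrite -gg'//; apply: near_eq_derive; exact: (near_eq _ g).
  - have [g' Sg' gg'] := Sdy g Sg; exists g' => // w wr.
    by rewrite -gg'//; apply: near_eq_derive; exact: (near_eq _ g).
have [cg [dxg dyg]] := Sreg g Sg z zr; have fgz := near_eq _ _ fg z zr.
have gfz : {near z, g =1 iter_partial s f} by apply: filterS fgz => w ->.
split; last by split; [exact: near_eq_derivable gfz dxg |
  exact: near_eq_derivable gfz dyg].
suff : iter_partial s f @ z --> g z by rewrite -(fg z zr).
by apply: cvg_trans cg; apply: near_eq_cvg.
Qed.

Lemma smooth_on_eq r f g : (forall z, box r z -> f z = g z) ->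
  smooth_on r f -> smooth_on r g.
Proof.
move=> fg fr.
apply: (@smooth_on_coind r [set h | exists2 k, smooth_on r k & forall z,
  box r z -> k z = h z]);
  last by exists f.
- move=> h [k kr kh] z zr.
  have khz : {near z, k =1 h} by apply: filterS (near_box zr) => w /kh.
  have [kx ky] := smooth_on_derivable kr zr.
  split; last by split; [exact: near_eq_derivable khz kx |
    exact: near_eq_derivable khz ky].
  suff : h @ z --> k z by rewrite (kh z zr).
  apply: cvg_trans (smooth_on_continuous kr zr); apply: near_eq_cvg.
  by apply: filterS khz => w ->.
- move=> h [k kr kh]; exists (dx k); last first.
    move=> z zr; apply: near_eq_derive; apply: filterS (near_box zr) => w /kh;
      exact: esym.
  by exists (dx k); [exact: (smooth_on_dx kr) | move=> z _].
- move=> h [k kr kh]; exists (dy k); last first.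
    move=> z zr; apply: near_eq_derive; apply: filterS (near_box zr) => w /kh;
      exact: esym.
  by exists (dy k); [exact: (smooth_on_dy kr) | move=> z _].
Qed.

Lemma polynomial_fun_continuous f z : polynomial_fun f -> {for z, continuous f}.
Proof.
move: f; apply: polynomial_fun_ind => [c|||f g cf cg|f g cf cg].
- exact: cvg_cst.
- exact: cvg_fst.
- exact: cvg_snd.
- exact: cvgD.
- exact: cvgM.
Qed.

Lemma smooth_on_polynomial r f : polynomial_fun f -> smooth_on r f.
Proof.
move: f; apply: smooth_on_coind => f pf.
- move=> z zr; split; first exact: polynomial_fun_continuous.
  exact: polynomial_fun_derivable_xy.
- by exists (dx f) => //; exact: polynomial_fun_dx.
- by exists (dy f) => //; exact: polynomial_fun_dy.
Qed.

(** Single products are not stable under differentiation; by the Leibniz rule, the closure under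
    sums and products is, as [smooth_on_coind] requires. *)
Inductive smooth_algebra r : scalar R -> Prop :=
| smooth_algebra_base f : smooth_on r f -> smooth_algebra r f
| smooth_algebraD f g : smooth_algebra r f -> smooth_algebra r g ->
    smooth_algebra r (fun z => f z + g z)
| smooth_algebraM f g : smooth_algebra r f -> smooth_algebra r g ->
    smooth_algebra r (fun z => f z * g z).

Lemma smooth_algebra_smooth r f : smooth_algebra r f -> smooth_on r f.
Proof.
have reg h : smooth_algebra r h -> forall z, box r z -> {for z, continuous h} /\
  derivable_xy h z.
  elim=> {h} [h hr z zr|h g _ IHh _ IHg z zr|h g _ IHh _ IHg z zr].
  - by split; [exact: smooth_on_continuous hr zr | exact: smooth_on_derivable hr
      zr].
  - have [ch dh] := IHh z zr; have [cg dg] := IHg z zr; split;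
      first exact: cvgD.
    by have [d _ _] := has_partialsD (has_partials_at dh) (has_partials_at dg);
      exact d.
  - have [ch dh] := IHh z zr; have [cg dg] := IHg z zr; split;
      first exact: cvgM.
    by have [d _ _] := has_partialsM (has_partials_at dh) (has_partials_at dg);
      exact d.
move: f; apply: smooth_on_coind => // f.
- elim=> {f} [h hr|h g Sh [h' Sh' hh'] Sg [g' Sg' gg']|h g Sh [h' Sh' hh'] Sg
    [g' Sg' gg']].
  + by exists (dx h) => //; apply: smooth_algebra_base; exact: smooth_on_dx.
  + exists (fun z => h' z + g' z); first exact: smooth_algebraD.
    move=> z zr; rewrite -hh'// -gg'//; have [_ dh] := reg h Sh z zr;
      have [_ dg] := reg g Sg z zr.
    by have [_ d _] := has_partialsD (has_partials_at dh) (has_partials_at dg);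
      exact d.
  + exists (fun z => h z * g' z + g z * h' z).
      by apply: smooth_algebraD; exact: smooth_algebraM.
    move=> z zr; rewrite -hh'// -gg'//; have [_ dh] := reg h Sh z zr;
      have [_ dg] := reg g Sg z zr.
    by have [_ d _] := has_partialsM (has_partials_at dh) (has_partials_at dg);
      exact d.
- elim=> {f} [h hr|h g Sh [h' Sh' hh'] Sg [g' Sg' gg']|h g Sh [h' Sh' hh'] Sg
    [g' Sg' gg']].
  + by exists (dy h) => //; apply: smooth_algebra_base; exact: smooth_on_dy.
  + exists (fun z => h' z + g' z); first exact: smooth_algebraD.
    move=> z zr; rewrite -hh'// -gg'//; have [_ dh] := reg h Sh z zr;
      have [_ dg] := reg g Sg z zr.
    by have [_ _ d] := has_partialsD (has_partials_at dh) (has_partials_at dg);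
      exact d.
  + exists (fun z => h z * g' z + g z * h' z).
      by apply: smooth_algebraD; exact: smooth_algebraM.
    move=> z zr; rewrite -hh'// -gg'//; have [_ dh] := reg h Sh z zr;
      have [_ dg] := reg g Sg z zr.
    by have [_ _ d] := has_partialsM (has_partials_at dh) (has_partials_at dg);
      exact d.
Qed.

Lemma smooth_onD r f g : smooth_on r f -> smooth_on r g -> smooth_on r (fun z =>
  f z + g z).
Proof.
move=> fr gr; apply: smooth_algebra_smooth.
by apply: smooth_algebraD; exact: smooth_algebra_base.
Qed.

Lemma smooth_onM r f g : smooth_on r f -> smooth_on r g -> smooth_on r (fun z =>
  f z * g z).
Proof.
move=> fr gr; apply: smooth_algebra_smooth.
by apply: smooth_algebraM; exact: smooth_algebra_base.
Qed.

(** * Mean value estimates and the symmetry of second derivatives *)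

Lemma bounded_on_cbox r0 r f : r < r0 ->
  (forall z, box r0 z -> {for z, continuous f}) ->
  exists2 B, 0 <= B & forall z, cbox r z -> `|f z| <= B.
Proof.
move=> rr0 cf; pose A := `[- r, r]%classic `*` `[- r, r]%classic.
have AE z : cbox r z -> A z.
  by move=> [z1 z2]; split; rewrite /= in_itv/= -ler_norml.
have cA : compact A by apply: compact_setX; exact: segment_compact.
have : compact (f @` A).
  apply: continuous_compact => //; apply: continuous_in_subspaceT =>
    z /set_mem[].
  rewrite /= !in_itv/= -!ler_norml => z1 z2; apply: cf.
  by split; [exact: le_lt_trans z1 rr0 | exact: le_lt_trans z2 rr0].
move=> /compact_bounded[M [Mr HM]].
exists (`|M| + 1) => [|z /AE Az]; first by rewrite addr_ge0.
apply: (HM (`|M| + 1)); last by exists z.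
by rewrite ltr_pwDr// ler_norm.
Qed.

Lemma is_derive_slice_x f x y : derivable f (x, y) ((1, 0) : R * R) ->
  is_derive x 1 (fun s => f (s, y)) (dx f (x, y)).
Proof.
move=> df.
have E : (fun h : R => h^-1 *: (((fun s => f (s, y)) \o +%R^~ x) (h *: 1) - f
  (x, y))) =
    (fun h : R => h^-1 *: ((f \o +%R^~ (x, y)) (h *: (1, 0)) - f (x, y))).
  apply/funext => h; congr (_ *: (f _ - _)).
  by congr (_, _); rewrite /= scaler0 add0r.
by apply: DeriveDef; rewrite /derivable/derive/dx/derive E.
Qed.

Lemma is_derive_slice_y f x y : derivable f (x, y) ((0, 1) : R * R) ->
  is_derive y 1 (fun s => f (x, s)) (dy f (x, y)).
Proof.
move=> df.
have E : (fun h : R => h^-1 *: (((fun s => f (x, s)) \o +%R^~ y) (h *: 1) - f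
  (x, y))) =
    (fun h : R => h^-1 *: ((f \o +%R^~ (x, y)) (h *: (0, 1)) - f (x, y))).
  apply/funext => h; congr (_ *: (f _ - _)).
  by congr (_, _); rewrite /= scaler0 add0r.
by apply: DeriveDef; rewrite /derivable/derive/dy/derive E.
Qed.

(** The endpoints come in either order, and the intermediate point is located by its distances to
    them, the form that the estimates below consume. *)
Lemma mean_value (g dg : R -> R) r (x x' : R) :
  (forall t : R, `|t| <= r -> is_derive (t : R) (1 : R) g (dg t)) ->
    `|x| <= r -> `|x'| <= r ->
  exists c, [/\ `|c| <= r, `|c - x| <= `|x' - x|, `|c - x'| <= `|x' - x|
    & g x' - g x = (x' - x) * dg c].
Proof.
move=> dgE; wlog xx' : x x' / x <= x' => [H xr x'r|xr x'r].
  have [xx'|/ltW x'x] := leP x x'; first exact: H.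
  have [c [cr cx cx' gE]] := H _ _ x'x x'r xr.
  exists c; split=> //; [by rewrite [leRHS]distrC | by rewrite [leRHS]distrC |].
  by rewrite -opprB gE -mulNr opprB.
have sub t : t \in `[x, x'] -> `|t| <= r.
  move: xr x'r; rewrite in_itv/= !ler_norml =>
    /andP[rx _] /andP[_ x'r] /andP[xt tx'].
  by rewrite (le_trans rx xt) (le_trans tx' x'r).
have [||c cI ->] := @MVT_segment R g dg x x' xx'.
- move=> t tI; apply: dgE; apply: sub; exact: subset_itv_oo_cc.
- apply: continuous_in_subspaceT => t /set_mem tI.
  have [d _] := dgE t (sub t tI).
  by apply/differentiable_continuous/derivable1_diffP.
have /andP[xc cx'] : x <= c <= x' by move: cI; rewrite in_itv.
exists c; split; first exact: sub; last by rewrite mulrC.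
- by rewrite !ger0_norm ?subr_ge0// lerB.
- by rewrite distrC !ger0_norm ?subr_ge0// lerB.
Qed.

Lemma mean_value_x r0 r f x x' y : r < r0 -> smooth_on r0 f ->
  `|x| <= r -> `|x'| <= r -> `|y| <= r ->
  exists c, [/\ `|c| <= r, `|c - x| <= `|x' - x|, `|c - x'| <= `|x' - x|
    & f (x', y) - f (x, y) = (x' - x) * dx f (c, y)].
Proof.
move=> rr0 fr xr x'r yr.
refine (@mean_value (fun s => f (s, y)) (fun s => dx f (s, y)) r x x' _ xr x'r)
  => t tr.
apply: is_derive_slice_x; apply: (smooth_on_derivable fr _).1.
by split; [exact: le_lt_trans tr rr0 | exact: le_lt_trans yr rr0].
Qed.

Lemma mean_value_y r0 r f x y y' : r < r0 -> smooth_on r0 f ->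
  `|x| <= r -> `|y| <= r -> `|y'| <= r ->
  exists c, [/\ `|c| <= r, `|c - y| <= `|y' - y|, `|c - y'| <= `|y' - y|
    & f (x, y') - f (x, y) = (y' - y) * dy f (x, c)].
Proof.
move=> rr0 fr xr yr y'r.
refine (@mean_value (fun s => f (x, s)) (fun s => dy f (x, s)) r y y' _ yr y'r)
  => t tr.
apply: is_derive_slice_y; apply: (smooth_on_derivable fr _).2.
by split; [exact: le_lt_trans xr rr0 | exact: le_lt_trans tr rr0].
Qed.

Definition taxi z := `|z.1| + `|z.2|.

Lemma smooth_bound r0 r f : r < r0 -> smooth_on r0 f ->
  exists2 B, 0 <= B & forall z, cbox r z -> `|f z| <= B.
Proof.
by move=> rr0 fr; apply: (bounded_on_cbox rr0) => z; exact: smooth_on_continuous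
  fr.
Qed.

Lemma smooth_lipschitz r0 r f : r < r0 -> smooth_on r0 f ->
  exists2 B, 0 <= B & forall z z', cbox r z -> cbox r z' ->
    `|f z' - f z| <= B * taxi (z' - z).
Proof.
move=> rr0 fr.
have [B1 B10 fB1] := smooth_bound rr0 (smooth_on_dx fr).
have [B2 B20 fB2] := smooth_bound rr0 (smooth_on_dy fr).
exists (B1 + B2) => [|[x y] [x' y'] [/= xr yr] [/= x'r y'r]];
  first exact: addr_ge0.
have [c [cr _ _ cE]] := mean_value_x rr0 fr xr x'r y'r.
have [e [er _ _ eE]] := mean_value_y rr0 fr xr yr y'r.
rewrite -(subrKA (f (x, y'))) cE eE (le_trans (ler_normD _ _))// !normrM
  /taxi/=.
rewrite mulrDr; apply: lerD; rewrite mulrC; apply: ler_wpM2r => //.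
- by rewrite (le_trans (fB1 _ _)) ?lerDl.
- by rewrite (le_trans (fB2 _ _)) ?lerDr.
Qed.

(** Go from z to z' one coordinate at a time by the mean value theorem, then compare the partials at
    the intermediate points with those at z by their Lipschitz bounds. *)
Lemma smooth_quadratic r0 r f : r < r0 -> smooth_on r0 f ->
  exists2 B, 0 <= B & forall z z', cbox r z -> cbox r z' ->
    `|f z' - f z - (z'.1 - z.1) * dx f z - (z'.2 - z.2) * dy f z| <=
    B * taxi (z' - z) ^+ 2.
Proof.
move=> rr0 fr.
have [B1 B10 fB1] := smooth_lipschitz rr0 (smooth_on_dx fr).
have [B2 B20 fB2] := smooth_lipschitz rr0 (smooth_on_dy fr).
exists (B1 + B2) => [|[x y] [x' y'] [/= xr yr] [/= x'r y'r]];
  first exact: addr_ge0.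
have [c [cr cx _ cE]] := mean_value_x rr0 fr xr x'r y'r.
have [e [er ey _ eE]] := mean_value_y rr0 fr xr yr y'r.
have -> : f (x', y') - f (x, y) - (x' - x) * dx f (x, y) - (y' - y) * dy f (x,
  y) =
    (x' - x) * (dx f (c, y') - dx f (x, y)) + (y' - y) * (dy f (x, e) - dy f (x,
      y)).
  have -> : f (x', y') = f (x, y') + (x' - x) * dx f (c, y') by rewrite -cE
    addrC subrK.
  have -> : f (x, y') = f (x, y) + (y' - y) * dy f (x, e) by rewrite -eE addrC
    subrK.
  by ring_partials.
have T : taxi ((x', y') - (x, y)) = `|x' - x| + `|y' - y| by [].
rewrite T; apply: le_trans (ler_normD _ _) _.
rewrite -> (normrM (x' - x)), (normrM (y' - y)).
set u := `|x' - x| in cx *; set v := `|y' - y| in ey *.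
have u0 : 0 <= u by exact: normr_ge0. have v0 : 0 <= v by exact: normr_ge0.
have H1 : `|dx f (c, y') - dx f (x, y)| <= B1 * (u + v).
  apply: le_trans (fB1 (x, y) (c, y') _ _) _ => //.
  by rewrite ler_wpM2l// /taxi/= lerD2r.
have H2 : `|dy f (x, e) - dy f (x, y)| <= B2 * (u + v).
  apply: le_trans (fB2 (x, y) (x, e) _ _) _ => //.
  by rewrite ler_wpM2l// /taxi/= subrr normr0 add0r (le_trans ey)// lerDr.
have M1 := ler_wpM2l u0 H1; have M2 := ler_wpM2l v0 H2.
apply: le_trans (lerD M1 M2) _.
rewrite -subr_ge0 (_ : _ - _ = B1 * (u * v) + B1 * v ^+ 2 + B2 * (u * v) +
  B2 * u ^+ 2); last by ring.
by rewrite !addr_ge0// !mulr_ge0// exprn_ge0.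
Qed.

Lemma small_mul_eq0 (a B h0 : R) : 0 < h0 ->
  (forall h, 0 < h -> h < h0 -> `|a| <= B * h) -> a = 0.
Proof.
move=> h00 aB; apply/eqP; rewrite -normr_eq0 eq_le normr_ge0 andbT.
apply/ler_addgt0Pl => e e0; rewrite addr0.
have B0 : 0 < `|B| + 1 by rewrite ltr_wpDl.
have [h [hp hh0 he]] := pos_min h00 (divr_gt0 e0 B0).
have h20 : 0 < h / 2 by rewrite divr_gt0.
have h2h : h / 2 < h by rewrite ltr_pdivrMr// ltr_pMr// ltr1n.
apply: le_trans (aB _ h20 (lt_le_trans h2h hh0)) _.
have := le_trans (ltW h2h) he; rewrite ler_pdivlMr// => ?.
have : B <= `|B| + 1 by rewrite (le_trans (ler_norm B))// lerDl.
by move=> /(ler_wpM2r (ltW h20)) H; apply: le_trans H _; rewrite mulrC.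
Qed.

(** The double difference over a square of side h equals h^2 times either mixed derivative at some
    point of that square. Lipschitz bounds make the two mixed derivatives at z differ by O(h). *)
Lemma smooth_mixed r0 f z : smooth_on r0 f -> box r0 z ->
  dx (dy f) z = dy (dx f) z.
Proof.
case: z => x y fr [/= xr yr].
(* A radius strictly between m and r0 leaves room for increments h < r - m, while the closed box
   stays inside the open one. *)
pose m := Num.max `|x| `|y|.
have mr0 : m < r0 by rewrite /m gt_max xr yr.
have [mr rr0] := midf_lt mr0; set r := (m + r0) / 2 in mr rr0.
have xm : `|x| <= m by rewrite /m le_max lexx.
have ym : `|y| <= m by rewrite /m le_max lexx orbT.
have [B1 B10 L1] := smooth_lipschitz rr0 (smooth_on_dx (smooth_on_dy fr)).
have [B2 B20 L2] := smooth_lipschitz rr0 (smooth_on_dy (smooth_on_dx fr)).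
have rm0 : 0 < r - m by rewrite subr_gt0.
apply/eqP; rewrite -subr_eq0; apply/eqP.
apply: (@small_mul_eq0 _ (2 * (B1 + B2)) (r - m) rm0) => h h0 hr.
have hn : `|h| = h by rewrite gtr0_norm.
have xr' := le_trans xm (ltW mr); have yr' := le_trans ym (ltW mr).
have xhr : `|x + h| <= r by rewrite (le_trans (ler_normD _ _))// hn -lerBrDl;
  lra.
have yhr : `|y + h| <= r by rewrite (le_trans (ler_normD _ _))// hn -lerBrDl;
  lra.
have box_r s t : `|s| <= r -> `|t| <= r -> box r0 (s, t).
  by move=> sr tr; split; [exact: le_lt_trans sr rr0 | exact: le_lt_trans tr
    rr0].
have xhx : x + h - x = h by rewrite addrC addKr.
have yhy : y + h - y = h by rewrite addrC addKr.
pose D := f (x + h, y + h) - f (x + h, y) - (f (x, y + h) - f (x, y)).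
have [c [e [cx ey cr er D1]]] : exists c e, [/\ `|c - x| <= h, `|e - y| <= h,
    `|c| <= r, `|e| <= r & D = h * (h * dy (dx f) (c, e))].
  have [|c [cr cx _ cE]] := @mean_value (fun s => f (s, y + h) - f (s, y))
    (fun s => dx f (s, y + h) - dx f (s, y)) r x (x + h) _ xr' xhr.
    move=> s sr; apply: is_deriveB; apply: is_derive_slice_x;
      apply: (smooth_on_derivable fr _).1; exact: box_r.
  have [e [er ey _ eE]] := mean_value_y rr0 (smooth_on_dx fr) cr yr' yhr.
  exists c, e; split; [| |exact cr|exact er|].
  - by move: cx; rewrite ?xhx ?yhy hn.
  - by move: ey; rewrite ?xhx ?yhy hn.
  apply: (etrans cE); apply: (etrans (congr1 (fun t => (x + h - x) * t) eE)).
  by rewrite xhx yhy.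
have [c' [e' [cx' ey' cr' er' D2]]] : exists c e, [/\ `|c - x| <= h, `|e - y| <=
  h,
    `|c| <= r, `|e| <= r & D = h * (h * dx (dy f) (c, e))].
  have [|e' [er' ey' _ eE]] := @mean_value (fun s => f (x + h, s) - f (x, s))
    (fun s => dy f (x + h, s) - dy f (x, s)) r y (y + h) _ yr' yhr.
    move=> s sr; apply: is_deriveB; apply: is_derive_slice_y;
      apply: (smooth_on_derivable fr _).2; exact: box_r.
  have [c' [cr' cx' _ cE]] := mean_value_x rr0 (smooth_on_dy fr) xr' xhr er'.
  exists c', e'; split; [| |exact cr'|exact er'|].
  - by move: cx'; rewrite ?xhx ?yhy hn.
  - by move: ey'; rewrite ?xhx ?yhy hn.
  have DE : D = f (x + h, y + h) - f (x, y + h) - (f (x + h, y) - f (x, y)).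
    by rewrite /D; ring.
  apply: (etrans DE); apply: (etrans eE).
  apply: (etrans (congr1 (fun t => (y + h - y) * t) cE)).
  rewrite -> yhy; exact (congr1 (fun t => h * (t * dx (dy f) (c', e'))) xhx).
have E : dx (dy f) (c', e') = dy (dx f) (c, e).
  apply: (mulfI (lt0r_neq0 h0)); apply: (mulfI (lt0r_neq0 h0)).
  exact (etrans (esym D2) D1).
have T s t : `|s - x| <= h -> `|t - y| <= h -> taxi ((s, t) - (x, y)) <= 2 * h.
  by move=> sx ty; rewrite /taxi/= mulr_natl mulr2n lerD.
have N1 := L1 (x, y) (c', e') (conj xr' yr') (conj cr' er').
have N2 := L2 (x, y) (c, e) (conj xr' yr') (conj cr er).
have -> : dx (dy f) (x, y) - dy (dx f) (x, y) =
   - (dx (dy f) (c', e') - dx (dy f) (x, y)) + (dy (dx f) (c, e) - dy (dx f) (x,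
       y)).
  by rewrite -> E; ring_partials.
apply: le_trans (ler_normD _ _) _; rewrite normrN.
have M1 := ler_wpM2l B10 (T _ _ cx' ey'); have M2 :=
  ler_wpM2l B20 (T _ _ cx ey).
have := lerD (le_trans N1 M1) (le_trans N2 M2).
by rewrite -mulrDl [2 * (B1 + B2)]mulrC -mulrA.
Qed.

End SmoothGerms.

(** * Weighted means along the orbits of quasi-homogeneous dilations *)

Section WeightedMeans.
Variable R : realType.
Variables (a b : nat).
Implicit Types (f g u phi : scalar R) (z w : R * R) (r t : R).

(** The integral curve of W through z, in the exponential of its time, so that the limit point t = 0
    is included. *)
Definition curve z t : R * R := (t ^+ a * z.1, t ^+ b * z.2).

Lemma norm_expX_le1 t n : `|t| <= 1 -> `|t ^+ n| <= 1.
Proof. by move=> t1; rewrite normrX exprn_ile1. Qed.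

Lemma cbox_curve r z t : `|t| <= 1 -> cbox r z -> cbox r (curve z t).
Proof.
move=> t1 [z1 z2]; split; rewrite /curve/= normrM.
- by apply: le_trans z1; rewrite ler_piMl// norm_expX_le1.
- by apply: le_trans z2; rewrite ler_piMl// norm_expX_le1.
Qed.

Lemma box_curve r z t : `|t| <= 1 -> box r z -> box r (curve z t).
Proof.
move=> t1 [z1 z2]; split; rewrite /curve/= normrM.
- by apply: le_lt_trans z1; rewrite ler_piMl// norm_expX_le1.
- by apply: le_lt_trans z2; rewrite ler_piMl// norm_expX_le1.
Qed.

Lemma between_radii r0 z : box r0 z -> exists2 r, cbox r z & r < r0.
Proof.
move=> [z1 z2]; exists (Num.max `|z.1| `|z.2|); last by rewrite gt_max z1 z2.
by split; rewrite le_max lexx ?orbT.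
Qed.

Lemma curve_continuous z t : {for t, continuous (curve z)}.
Proof.
have c n (x : R) : {for t, continuous (fun s : R => s ^+ n * x)}.
  apply: (@continuousM _ _ (fun s : R => s ^+ n) (fun=> x)).
    exact: exprn_continuous.
  exact: cvg_cst.
exact: (@cvg_pair _ _ _ _ _ _ _ _ _ _ _ (c a z.1) (c b z.2)).
Qed.

Lemma along_curve_continuous r0 f z t : smooth_on r0 f -> box r0 z ->
  `|t| <= 1 ->
  {for t, continuous (f \o curve z)}.
Proof.
move=> fr zr t1; apply: continuous_comp; first exact: curve_continuous.
exact: smooth_on_continuous fr (box_curve t1 zr).
Qed.

Lemma power_increment (t h : R) n : `|t| <= 1 -> `|t + h| <= 1 -> `|h| <= 1 ->
  `|(t + h) ^+ n - t ^+ n| <= (n%:R + n%:R ^+ 2) * `|h|.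
Proof.
move=> t1 th1 h1; have := power_taylor_bound n ltr01 t1 th1.
rewrite !expr1n mul1r mulr1 => H.
rewrite -(subrK (n%:R * h * t ^+ n.-1) ((t + h) ^+ n - t ^+ n)).
apply: le_trans (ler_normD _ _) _; rewrite mulrDl addrC; apply: lerD.
  rewrite !normrM normr_nat ler_piMr ?mulr_ge0// norm_expX_le1//.
apply: le_trans H _; rewrite ler_wpM2l ?exprn_ge0//.
by rewrite expr2 ler_piMl.
Qed.

(** The chain rule, with [smooth_quadratic] in the role of total differentiability. *)
Lemma is_derive_curve r0 f z t : smooth_on r0 f -> box r0 z -> 0 < t -> t < 1 ->
  is_derive (t : R) (1 : R) (f \o curve z)
    (a%:R * t ^+ a.-1 * z.1 * dx f (curve z t) + b%:R * t ^+ b.-1 * z.2 * dy f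
      (curve z t)).
Proof.
move=> fr zr t0 t1; have [r zr' rr0] := between_radii zr.
have [B B0 fB] := smooth_quadratic rr0 fr.
have t10 : 0 < 1 - t by rewrite subr_gt0.
have [s [s0 st s1]] := pos_min t0 t10.
have tn : `|t| <= 1 by rewrite gtr0_norm// ltW.
pose p (n : nat) : R := n%:R + n%:R ^+ 2.
have p0 n : 0 <= p n by rewrite addr_ge0// exprn_ge0.
pose L := p a * `|z.1| + p b * `|z.2|.
pose X := dx f (curve z t); pose Y := dy f (curve z t).
(* First the quadratic error of f, the curve being L-Lipschitz; then the Taylor remainders of t^a
   and t^b, weighted by the partials of f. *)
pose D := B * L ^+ 2 + (a%:R ^+ 2 * `|z.1| * `|X| + b%:R ^+ 2 * `|z.2| * `|Y|).
have D0 : 0 <= D by rewrite !addr_ge0// !mulr_ge0// ?exprn_ge0// !addr_ge0//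
  !mulr_ge0.
apply: (is_derive_quadratic s0 D0) => h hs.
have -> : h *: (1 : R) + t = t + h by rewrite [_ *: _]mulr1 addrC.
rewrite -/X -/Y /=.
have h1 : `|h| <= 1 by rewrite (le_trans hs)// (le_trans st)// ltW.
have th1 : `|t + h| <= 1.
  by rewrite (le_trans (ler_normD _ _))// (gtr0_norm t0) -lerBrDl (le_trans hs).
have cE n (x : R) : (t + h) ^+ n * x - t ^+ n * x = ((t + h) ^+ n - t ^+ n) * x
  by rewrite mulrBl.
have V : taxi (curve z (t + h) - curve z t) <= L * `|h|.
  rewrite /taxi/curve/= !cE !normrM /L mulrDl lerD//.
  - by rewrite mulrAC ler_wpM2r// power_increment.
  - by rewrite mulrAC ler_wpM2r// power_increment.
have Q := fB _ _ (cbox_curve tn zr') (cbox_curve th1 zr').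
rewrite -/X -/Y in Q.
have V0 : 0 <= taxi (curve z (t + h) - curve z t) by rewrite addr_ge0.
have Q2 : B * taxi (curve z (t + h) - curve z t) ^+ 2 <= B * (L * `|h|) ^+ 2.
  by rewrite ler_wpM2l// lerXn2r// nnegrE (le_trans V0).
have T n : `|(t + h) ^+ n - t ^+ n - n%:R * h * t ^+ n.-1| <= n%:R ^+ 2 * `|h|
  ^+ 2.
  by have := power_taylor_bound n ltr01 tn th1; rewrite !expr1n mul1r mulr1.
set E := f (curve z (t + h)) - f (curve z t) - _ - _ in Q.
rewrite (_ : _ - _ - _ = E + (((t + h) ^+ a - t ^+ a - a%:R * h * t ^+ a.-1) *
  z.1 * X
    + ((t + h) ^+ b - t ^+ b - b%:R * h * t ^+ b.-1) * z.2 * Y)); last first.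
  by rewrite /E/X/Y/curve/=; ring_partials.
apply: le_trans (ler_normD _ _) _; rewrite /D [leRHS]mulrDl; apply: lerD.
  by apply: le_trans Q _; apply: le_trans Q2 _; rewrite exprMn mulrA.
apply: le_trans (ler_normD _ _) _; rewrite [leRHS]mulrDl; apply: lerD.
- rewrite !normrM [leRHS](_ : _ = a%:R ^+ 2 * `|h| ^+ 2 * `|z.1| * `|X|);
    last by ring.
  by apply: ler_wpM2r => //; apply: ler_wpM2r.
- rewrite !normrM [leRHS](_ : _ = b%:R ^+ 2 * `|h| ^+ 2 * `|z.2| * `|Y|);
    last by ring.
  by apply: ler_wpM2r => //; apply: ler_wpM2r.
Qed.

Lemma continuous01_integrable (g : R -> R) :
  (forall t : R, `|t| <= 1 -> {for t, continuous g}) ->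
  (@lebesgue_measure R).-integrable `[0, 1] (EFin \o g).
Proof.
move=> cg; apply: continuous_compact_integrable; first exact: segment_compact.
apply: continuous_in_subspaceT => t /set_mem; rewrite /= in_itv/= =>
  /andP[t0 t1].
by apply: cg; rewrite ger0_norm.
Qed.

Lemma Rintegral01_bound (g : R -> R) (B : R) :
  (forall t : R, `|t| <= 1 -> {for t, continuous g}) ->
  (forall t : R, 0 <= t -> t <= 1 -> `|g t| <= B) ->
  `|\int[@lebesgue_measure R]_(t in `[0, 1]) g t| <= B.
Proof.
move=> cg gB; have ig := continuous01_integrable cg.
apply: le_trans (le_normr_Rintegral _ ig) _ => //.
have -> : B = \int[@lebesgue_measure R]_(t in `[0, 1]) B.
  have m1 : lebesgue_measure (`[0, 1]%classic : set R) = 1%E.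
    by rewrite lebesgue_measure_itv/= lte_fin ltr01 oppr0 adde0.
  by rewrite Rintegral_cst// [X in fine X](_ : _ = 1%E) ?mulr1//; exact: m1.
apply: le_Rintegral => //.
- apply: (@continuous01_integrable (fun t => `|g t|)) => t t1.
  by apply: (@continuous_comp _ _ _ g Num.norm);
    [exact: cg | exact: norm_continuous].
- by apply: (@continuous01_integrable (fun=> B)) => t t1; exact: cvg_cst.
- by move=> t /=; rewrite in_itv/= => /andP[]; exact: gB.
Qed.

(** Exponent [k] inverts W + (k + 1), since t^k dt comes from differentiating t^(k+1). *)
Definition weighted_mean (k : nat) phi z : R :=
  \int[@lebesgue_measure R]_(t in `[0, 1]) (t ^+ k * phi (curve z t)).

Lemma weight_continuous r0 k phi z t : smooth_on r0 phi -> box r0 z ->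
  `|t| <= 1 ->
  {for t, continuous (fun t : R => t ^+ k * phi (curve z t))}.
Proof.
move=> fr zr t1; apply: (@continuousM _ _ (fun t : R =>
  t ^+ k) (phi \o curve z)).
  exact: exprn_continuous.
exact: along_curve_continuous fr zr t1.
Qed.

Lemma weight_integrable r0 k phi z : smooth_on r0 phi -> box r0 z ->
  (@lebesgue_measure R).-integrable `[0, 1]
    (EFin \o (fun t : R => t ^+ k * phi (curve z t))).
Proof.
move=> fr zr; apply: continuous01_integrable => t t1.
exact: weight_continuous fr zr t1.
Qed.

Lemma taxi_curve z z' (t : R) : `|t| <= 1 -> taxi (curve z' t - curve z t) <=
  taxi (z' - z).
Proof.
move=> t1; rewrite /taxi/curve/= -!mulrBr !normrM.
by apply: lerD; rewrite ler_piMl// norm_expX_le1.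
Qed.

Lemma taxi_ge0 z : 0 <= taxi z. Proof. exact: addr_ge0. Qed.

Lemma weighted_mean_lipschitz r0 r k phi : r < r0 -> smooth_on r0 phi ->
  exists2 B, 0 <= B & forall z z', cbox r z -> cbox r z' ->
    `|weighted_mean k phi z' - weighted_mean k phi z| <= B * taxi (z' - z).
Proof.
move=> rr0 fr; have [B B0 fB] := smooth_lipschitz rr0 fr.
have cb z : cbox r z -> box r0 z by move=> [z1 z2]; split;
  exact: le_lt_trans rr0.
exists B => // z z' zr z'r.
rewrite /weighted_mean -RintegralB//; [| exact: weight_integrable fr (cb _ z'r)
  | exact: weight_integrable fr (cb _ zr)].
apply: Rintegral01_bound => [t t1|t t0 t1].
  by apply: continuousB; [exact: weight_continuous fr (cb _ z'r) t1
    | exact: weight_continuous fr (cb _ zr) t1].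
have tn : `|t| <= 1 by rewrite ger0_norm.
rewrite -mulrBr normrM (le_trans (ler_piMl _ (norm_expX_le1 k tn)))//.
apply: le_trans (fB _ _ (cbox_curve tn zr) (cbox_curve tn z'r)) _.
by rewrite ler_wpM2l// taxi_curve.
Qed.

(** Integrate the quadratic estimate of [phi]; dilations with |t| <= 1 do not increase [taxi], so
    the constant is unchanged. Differentiation in x brings out t^a, which raises the exponent to k +
    a. *)
Lemma weighted_mean_quadratic r0 r k phi : r < r0 -> smooth_on r0 phi ->
  exists2 B, 0 <= B & forall z z', cbox r z -> cbox r z' ->
    `|weighted_mean k phi z' - weighted_mean k phi z
      - (z'.1 - z.1) * weighted_mean (k + a) (dx phi) z
      - (z'.2 - z.2) * weighted_mean (k + b) (dy phi) z| <= B * taxi (z' - z) ^+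
          2.
Proof.
move=> rr0 fr; have [B B0 fB] := smooth_quadratic rr0 fr.
have cb z : cbox r z -> box r0 z by move=> [z1 z2]; split;
  exact: le_lt_trans rr0.
exists B => // z z' zr z'r.
pose g0' (t : R) := t ^+ k * phi (curve z' t).
pose g0 (t : R) := t ^+ k * phi (curve z t).
pose gx (t : R) := (z'.1 - z.1) * (t ^+ (k + a) * dx phi (curve z t)).
pose gy (t : R) := (z'.2 - z.2) * (t ^+ (k + b) * dy phi (curve z t)).
have c0' (t : R) : `|t| <= 1 -> {for t, continuous g0'}.
  by move=> t1; exact: weight_continuous fr (cb _ z'r) t1.
have c0 (t : R) : `|t| <= 1 -> {for t, continuous g0}.
  by move=> t1; exact: weight_continuous fr (cb _ zr) t1.
have cx (t : R) : `|t| <= 1 -> {for t, continuous gx}.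
  move=> t1; apply: continuousM; first exact: cvg_cst.
  exact: weight_continuous (smooth_on_dx fr) (cb _ zr) t1.
have cy (t : R) : `|t| <= 1 -> {for t, continuous gy}.
  move=> t1; apply: continuousM; first exact: cvg_cst.
  exact: weight_continuous (smooth_on_dy fr) (cb _ zr) t1.
have c1 (t : R) : `|t| <= 1 -> {for t, continuous (fun t => g0' t - g0 t)}.
  by move=> t1; apply: continuousB; [exact: c0' | exact: c0].
have c2 (t : R) : `|t| <= 1 -> {for t, continuous (fun t =>
  g0' t - g0 t - gx t)}.
  by move=> t1; apply: continuousB; [exact: c1 | exact: cx].
have c3 (t : R) : `|t| <= 1 -> {for t, continuous (fun t =>
  g0' t - g0 t - gx t - gy t)}.
  by move=> t1; apply: continuousB; [exact: c2 | exact: cy].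
have ->: weighted_mean k phi z' - weighted_mean k phi z
      - (z'.1 - z.1) * weighted_mean (k + a) (dx phi) z
      - (z'.2 - z.2) * weighted_mean (k + b) (dy phi) z =
    \int[@lebesgue_measure R]_(t in `[0, 1]) (g0' t - g0 t - gx t - gy t).
  rewrite RintegralB//;
    [|exact: continuous01_integrable c2|exact: continuous01_integrable cy].
  rewrite RintegralB//;
    [|exact: continuous01_integrable c1|exact: continuous01_integrable cx].
  rewrite RintegralB//;
    [|exact: continuous01_integrable c0'|exact: continuous01_integrable c0].
  congr (_ - _ - _ - _); symmetry; apply: RintegralZl => //.
  - exact: weight_integrable (smooth_on_dx fr) (cb _ zr).
  - exact: weight_integrable (smooth_on_dy fr) (cb _ zr).
apply: Rintegral01_bound c3 _ => t t0 t1.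
have tn : `|t| <= 1 by rewrite ger0_norm.
have := fB _ _ (cbox_curve tn zr) (cbox_curve tn z'r).
set E := (X in `|X| <= _) => HE.
have -> : g0' t - g0 t - gx t - gy t = t ^+ k * E.
  by rewrite /g0'/g0/gx/gy/E/curve/= !exprD; ring_partials.
rewrite normrM; apply: le_trans (ler_piMl _ (norm_expX_le1 k tn)) _ => //.
apply: le_trans HE _; rewrite ler_wpM2l// lerXn2r ?nnegrE
  ?taxi_ge0// taxi_curve//.
Qed.

Lemma weighted_mean_is_derive r0 k phi z : smooth_on r0 phi -> box r0 z ->
  is_derive z ((1, 0) : R * R) (weighted_mean k phi) (weighted_mean (k + a)
    (dx phi) z) /\
  is_derive z ((0, 1) : R * R) (weighted_mean k phi) (weighted_mean (k + b)
    (dy phi) z).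
Proof.
move=> fr zr0; have [m zm mr0] := between_radii zr0.
have [mr rr0] := midf_lt mr0; set r := (m + r0) / 2 in mr rr0.
have [B B0 mB] := weighted_mean_quadratic k rr0 fr.
have rm0 : 0 < r - m by rewrite subr_gt0.
have [zm1 zm2] := zm.
have zr : cbox r z by split; [exact: le_trans zm1 (ltW mr) | exact: le_trans zm2
  (ltW mr)].
have n1 (h x : R) : `|x| <= m -> `|h| <= r - m -> `|h + x| <= r.
  by move=> xm hr; rewrite (le_trans (ler_normD _ _))// -(subrK m r) lerD.
split; apply: (is_derive_quadratic rm0 B0) => h hr.
- have hz : h *: ((1, 0) : R * R) + z = (h + z.1, z.2).
    by case: (z) => x y; congr (_, _); rewrite /= ?scaler0 ?add0r// [_ *:
      _]mulr1.
  have := mB z (h + z.1, z.2) zr; rewrite hz /taxi/= addrK subrr mul0r subr0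
    normr0 addr0.
  by apply; split; [exact: n1 | case: zr].
- have hz : h *: ((0, 1) : R * R) + z = (z.1, h + z.2).
    by case: (z) => x y; congr (_, _); rewrite /= ?scaler0 ?add0r// [_ *:
      _]mulr1.
  have := mB z (z.1, h + z.2) zr; rewrite hz /taxi/= addrK subrr mul0r subr0
    normr0 add0r.
  by apply; split; [case: zr | exact: n1].
Qed.

Lemma weighted_mean_continuous r0 k phi z : smooth_on r0 phi -> box r0 z ->
  {for z, continuous (weighted_mean k phi)}.
Proof.
move=> fr zr0; have [m zm mr0] := between_radii zr0.
have [mr rr0] := midf_lt mr0; set r := (m + r0) / 2 in mr rr0.
have [B B0 mB] := weighted_mean_lipschitz k rr0 fr.
have rm0 : 0 < r - m by rewrite subr_gt0.
have [zm1 zm2] := zm.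
have zr : cbox r z by split; [exact: le_trans zm1 (ltW mr) | exact: le_trans zm2
  (ltW mr)].
have B20 : 0 <= B * 2 by rewrite mulr_ge0.
apply: (continuous_lipschitz rm0 B20) => z' z'z.
apply: le_trans (mB z z' zr _) _.
  split.
  - rewrite -(subrK z.1 z'.1) (le_trans (ler_normD _ _))// -(subrK m r) lerD//.
    exact: le_trans (norm_fst_le (z' - z)) z'z.
  - rewrite -(subrK z.2 z'.2) (le_trans (ler_normD _ _))// -(subrK m r) lerD//.
    exact: le_trans (norm_snd_le (z' - z)) z'z.
rewrite -mulrA ler_wpM2l// mulr_natl mulr2n /taxi lerD//.
- exact: norm_fst_le.
- exact: norm_snd_le.
Qed.

(** Coinduction on the class of weighted means with all exponents: a partial derivative of one is
    another, with a larger or equal exponent. *)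
Lemma smooth_on_weighted_mean r0 k phi : smooth_on r0 phi ->
  smooth_on r0 (weighted_mean k phi).
Proof.
move=> fr; apply: (@smooth_on_coind _ r0
  [set psi | exists k phi, smooth_on r0 phi /\ psi = weighted_mean k phi]);
  last by exists k, phi.
- move=> _ [k' [f [fr' ->]]] z zr; split; first exact: weighted_mean_continuous
    fr' zr.
  by have [d1 d2] := weighted_mean_is_derive k' fr' zr; split; exact: ex_derive.
- move=> _ [k' [f [fr' ->]]]; exists (weighted_mean (k' + a) (dx f)).
    by exists (k' + a)%N, (dx f); split;
      [exact (smooth_on_dx fr') | exact erefl].
  by move=> z zr; have [d1 _] := weighted_mean_is_derive k' fr' zr;
    exact: derive_val.
- move=> _ [k' [f [fr' ->]]]; exists (weighted_mean (k' + b) (dy f)).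
    by exists (k' + b)%N, (dy f); split;
      [exact (smooth_on_dy fr') | exact erefl].
  by move=> z zr; have [_ d2] := weighted_mean_is_derive k' fr' zr;
    exact: derive_val.
Qed.

Lemma norm_unit_itv (t : R) : 0 <= t -> t <= 1 -> `|t| <= 1.
Proof. by move=> t0; rewrite ger0_norm. Qed.

(* Fundamental theorem of calculus for t^(k+1) phi(t^a x, t^b y). *)
Lemma weighted_mean_euler r0 k phi z : smooth_on r0 phi -> box r0 z ->
  lie (euler R a b) (weighted_mean k phi) z + k.+1%:R * weighted_mean k phi z =
    phi z.
Proof.
move=> fr zr.
have [d1 d2] := weighted_mean_is_derive k fr zr.
rewrite /lie/= /dx/dy (derive_val (is_derive := d1)) (derive_val (is_derive :=
  d2)).
pose G (t : R) := t ^+ k.+1 * phi (curve z t).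
pose g0 (t : R) := t ^+ k * phi (curve z t).
pose gx (t : R) := t ^+ (k + a) * dx phi (curve z t).
pose gy (t : R) := t ^+ (k + b) * dy phi (curve z t).
pose g (t : R) := a%:R * z.1 * gx t + b%:R * z.2 * gy t + k.+1%:R * g0 t.
have cG (t : R) : `|t| <= 1 -> {for t, continuous G}.
  by move=> t1; exact: weight_continuous fr zr t1.
have c0 (t : R) : `|t| <= 1 -> {for t, continuous (fun t => k.+1%:R * g0 t)}.
  move=> t1; apply: continuousM; first exact: cvg_cst.
  exact: weight_continuous fr zr t1.
have cx (t : R) : `|t| <= 1 -> {for t, continuous (fun t => a%:R * z.1 * gx t)}.
  move=> t1; apply: continuousM; first exact: cvg_cst.
  exact: weight_continuous (smooth_on_dx fr) zr t1.
have cy (t : R) : `|t| <= 1 -> {for t, continuous (fun t => b%:R * z.2 * gy t)}.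
  move=> t1; apply: continuousM; first exact: cvg_cst.
  exact: weight_continuous (smooth_on_dy fr) zr t1.
have cxy (t : R) : `|t| <= 1 ->
    {for t, continuous (fun t => a%:R * z.1 * gx t + b%:R * z.2 * gy t)}.
  by move=> t1; apply: continuousD; [exact: cx | exact: cy].
have cg (t : R) : `|t| <= 1 -> {for t, continuous g}.
  by move=> t1; apply: continuousD; [exact: cxy | exact: c0].
have dG (t : R) : 0 < t -> t < 1 -> is_derive (t : R) (1 : R) G (g t).
  move=> t0 t1.
  have dphi := is_derive_curve fr zr t0 t1.
  have dX : is_derive (t : R) (1 : R) (fun s : R => s ^+ k.+1) (k.+1%:R * t ^+
    k).
    apply: DeriveDef; first exact: exprn_derivable.
    by rewrite exp_derive/= [LHS]mulr1.
  have dM := @is_deriveM R R (fun s : R => s ^+ k.+1) (phi \o curve z) t 1 _ _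
    dX dphi.
  apply: (is_derive_eq dM).
  (* For a zero weight the truncated exponent is wrong, but both sides vanish. *)
  have aE : t ^+ k.+1 * (a%:R * t ^+ a.-1) = a%:R * t ^+ (k + a).
    by case: (a) => [|n]; rewrite ?mul0r ?mulr0// addnS -addSn exprD mulrCA.
  have bE : t ^+ k.+1 * (b%:R * t ^+ b.-1) = b%:R * t ^+ (k + b).
    by case: (b) => [|n]; rewrite ?mul0r ?mulr0// addnS -addSn exprD mulrCA.
  rewrite -[LHS]/(t ^+ k.+1 * (a%:R * t ^+ a.-1 * z.1 * dx phi (curve z t) +
    b%:R * t ^+ b.-1 * z.2 * dy phi (curve z t)) +
    phi (curve z t) * (k.+1%:R * t ^+ k)) /g/gx/gy/g0.
  transitivity (t ^+ k.+1 * (a%:R * t ^+ a.-1) * z.1 * dx phi (curve z t) +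
    t ^+ k.+1 * (b%:R * t ^+ b.-1) * z.2 * dy phi (curve z t) +
    phi (curve z t) * (k.+1%:R * t ^+ k)); first by ring_partials.
  by rewrite aE bE; ring_partials.
have LR : derivable_oo_LRcontinuous G 0 1.
  split.
  - by move=> t; rewrite in_itv/= => /andP[t0 t1]; have [] := dG t t0 t1.
  - by apply: cvg_at_right_filter; apply: cG; rewrite normr0.
  - by apply: cvg_at_left_filter; apply: cG; rewrite normr1.
have FTC : \int[@lebesgue_measure R]_(t in `[0, 1]) g t = G 1 - G 0.
  rewrite /Rintegral (continuous_FTC2 ltr01 _ LR)//.
  - apply: continuous_in_subspaceT => t /set_mem; rewrite /= in_itv/= =>
      /andP[t0 t1].
    by apply: cg; exact: norm_unit_itv.
  - move=> t; rewrite in_itv/= => /andP[t0 t1].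
    by have [_ <-] := dG t t0 t1; rewrite derive1E.
(* G vanishes at 0 thanks to the factor [t ^+ k.+1]: this is where the added constant must be
   positive. *)
have -> : phi z = G 1 - G 0.
  rewrite /G /curve !expr1n !mul1r expr0n/= mul0r subr0.
  by case: (z).
rewrite -FTC /g RintegralD//;
  [|exact: continuous01_integrable cxy|exact: continuous01_integrable c0].
rewrite RintegralD//;
  [|exact: continuous01_integrable cx|exact: continuous01_integrable cy].
rewrite !RintegralZl//.
- exact: weight_integrable fr zr.
- exact: weight_integrable (smooth_on_dy fr) zr.
- exact: weight_integrable (smooth_on_dx fr) zr.
Qed.

(** For 0 < t < 1 the derivative of u along the curve is W u / t = 0; continuity at the endpoints
    lets the mean value theorem reach t = 0. *)
Lemma euler_constant_curve r0 u z : smooth_on r0 u -> box r0 z ->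
  (forall w, box r0 w -> lie (euler R a b) u w = 0) -> u z = u (curve z 0).
Proof.
move=> ur zr Eu.
have cE n (t : R) : 0 < t -> n%:R * t ^+ n.-1 = t^-1 * (n%:R * t ^+ n).
  move=> t0; case: n => [|n]; first by rewrite !mul0r mulr0.
  by rewrite exprS [_ * (t * _)]mulrCA mulKf// lt0r_neq0.
have [||t _] := @MVT R (u \o curve z) (fun=> 0) 0 1 ltr01.
- move=> t; rewrite in_itv/= => /andP[t0 t1].
  apply: is_derive_eq (is_derive_curve ur zr t0 t1) _.
  have := Eu _ (box_curve (norm_unit_itv (ltW t0) (ltW t1)) zr);
    rewrite /lie/= => E.
  rewrite !cE//; transitivity (t^-1 * (a%:R * (t ^+ a * z.1) * dx u (curve z t)
    +
    b%:R * (t ^+ b * z.2) * dy u (curve z t))); first by ring_partials.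
  by rewrite E mulr0.
- apply: continuous_in_subspaceT => t /set_mem; rewrite /= in_itv/= =>
    /andP[t0 t1].
  exact: along_curve_continuous ur zr (norm_unit_itv t0 t1).
rewrite mul0r => /eqP; rewrite subr_eq0 => /eqP /= <-.
by congr u; rewrite /curve !expr1n !mul1r; case: (z).
Qed.

End WeightedMeans.

Lemma smooth_germ_class (R : realType) : germ_class (@smooth_germ R).
Proof.
pose S : set (scalar R) := [set f | exists2 r, 0 < r & smooth_on r f].
suff : germ_class S.
  by congr germ_class; apply/funext => f; apply/propext; split=> /smooth_germP.
have common f g : S f -> S g -> exists r, [/\ 0 < r, smooth_on r f & smooth_on r
  g].
  move=> [r r0 fr] [s s0 gs]; have [t [t0 tr ts]] := pos_min r0 s0.
  by exists t; split; [exact: t0 | exact: smooth_onW tr fr | exact: smooth_onW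
    ts gs].
split.
- move=> f g [r r0 fr] /near0_boxP[s s0 fg]; have [t [t0 tr ts]] :=
    pos_min r0 s0.
  exists t; first exact: t0.
  apply: smooth_on_eq (smooth_onW tr fr) => z [z1 z2]; apply: fg.
  by split; exact: lt_le_trans ts.
- by move=> c; exists 1; [exact: ltr01 | apply: smooth_on_polynomial;
    exact: polynomial_fun_cst].
- by exists 1; [exact: ltr01 | apply: smooth_on_polynomial;
    exact: polynomial_fun_fst].
- by exists 1; [exact: ltr01 | apply: smooth_on_polynomial;
    exact: polynomial_fun_snd].
- move=> f g Sf Sg; have [r [r0 fr gr]] := common f g Sf Sg.
  by exists r; [exact: r0 | exact: smooth_onD fr gr].
- move=> f g Sf Sg; have [r [r0 fr gr]] := common f g Sf Sg.
  by exists r; [exact: r0 | exact: smooth_onM fr gr].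
- move=> f [r r0 fr]; apply/near0_boxP; exists r; first exact: r0.
  by move=> z zr; exact: smooth_on_continuous fr zr.
- move=> f [r r0 fr]; apply/near0_boxP; exists r; first exact: r0.
  by move=> z zr; exact: smooth_on_derivable fr zr.
- by move=> f [r r0 fr]; exists r; [exact: r0 | exact: smooth_on_dx fr].
- by move=> f [r r0 fr]; exists r; [exact: r0 | exact: smooth_on_dy fr].
- move=> f [r r0 fr]; apply/near0_boxP; exists r; first exact: r0.
  by move=> z zr; exact: smooth_mixed fr zr.
- move=> a b [//|k] f _ [r r0 fr]; exists (weighted_mean a b k f).
    by exists r; [exact: r0 | exact: smooth_on_weighted_mean fr].
  apply/near0_boxP; exists r; first exact: r0.
  by move=> z zr; exact: weighted_mean_euler fr zr.
- move=> a b u [r r0 ur] /near0_boxP[s s0 Eu]; have [t [t0 tr ts]] :=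
    pos_min r0 s0.
  apply/near0_boxP; exists t; first exact: t0.
  move=> z zt; apply: (euler_constant_curve (smooth_onW tr ur) zt) => w [w1 w2].
  by apply: Eu; split; exact: lt_le_trans ts.
Qed.

Theorem theorem4p5 (R : realType) (c : category) (w1 w2 : nat)
    (w1_gt0 : (0 < w1)%N) (w2_gt0 : (0 < w2)%N) (d : int)
    (f : base_field R c * base_field R c -> base_field R c)
    (f_qh : quasi_homogeneous w1 w2 d f)
    (f_codim : finite_codimension (germs R c) f)
    (r : nat) (e : 'I_r -> base_field R c * base_field R c -> base_field R c)
    (e_basis : is_basis
      (quasi_homogeneous w1 w2 (d - w1%:Z - w2%:Z) : set _) e) :
  is_H1_basis (germs R c) f (H1_family w1 w2 f e) /\
  H1_dim (germs R c) f r.+1.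
Proof.
have GO : germ_class (germs R c).
  case: c {f f_qh f_codim e e_basis}.
  - apply: analytic_germ_class; last exact: complex_geometric_cvg.
    exact: complex_half_exp_small.
  - apply: analytic_germ_class; last exact: real_geometric_cvg.
    exact: real_half_exp_small.
  - exact: smooth_germ_class.
split.
- exact: (H1_family_basis GO w1_gt0 w2_gt0 f_qh f_codim e_basis).
- exact: (H1_family_dim GO w1_gt0 w2_gt0 f_qh f_codim e_basis).
Qed.
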